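(* Let $k$ be a field of characteristic zero, $m\ge 3$, let $R=k[x_{i,j}\mid 1\le i,j\le m,\ (i,j)\ne(m,m)]$, let $\mathcal{GC}$ be the $m\times m$ matrix whose $(i,j)$-entry is $x_{i,j}$ for $(i,j)\neq (m,m)$ and whose $(m,m)$-entry is $x_{m-1,m-1}$, let $f=\det(\mathcal{GC})$, and let $J\subset R$ be the gradient ideal of $f$. Let $P:=I_{m-1}(\mathcal{GC})$ denote the ideal of $(m-1)$-minors of $\mathcal{GC}$. Then: (i) $P$ is a Gorenstein prime ideal of codimension $4$. (ii) $J$ has codimension $4$ and $P$ is the minimal primary component of $J$ in $R$. (iii) $J$ defines a double structure on the variety defined by $P$, admitting one single embedded component, the latter being a linear space of codimension $4m-5$. (iv) Let $\mathbb{D}_{i,j}$ denote the cofactor of the $(i,j)$-entry of the generic matrix $(y_{i,j})_{1\le i,j\le m}$. Then the $(m-1)$-minors $\boldsymbol{\Delta}=\{\Delta_{i,j}\}$ of $\mathcal{GC}$ define a birational map from $\mathbb{P}^{m^2-2}$ to $\mathbb{P}^{m^2-1}$ onto a hypersurface of degree $m-1$ with defining equation $\mathbb{D}_{m,m}-\mathbb{D}_{m-1,m-1}$, and with inverse map defined by the linear system spanned by $\widetilde{\mathbb{D}}:=\{\mathbb{D}_{i,j}\mid (i,j)\ne(m,m)\}$ modulo $\mathbb{D}_{m,m}-\mathbb{D}_{m-1,m-1}$. (v) $J$ is not a reduction of $P$.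
   Context: The $x_{i,j}$ with $(i,j)\ne(m,m)$ are $m^2-1$ independent variables over $k$. The gradient ideal $J$ of $f$ is generated by the partial derivatives of $f$ with respect to all the variables of $R$. An ideal $P$ is called Gorenstein if $R/P$ is a Gorenstein ring. Codimension of an ideal means height. In (ii), ''$P$ is the minimal primary component of $J$'' means that $P$ is the only minimal prime of $J$ and that the $P$-primary component of $J$ in a primary decomposition is $P$ itself. In (iii), ''double structure'' on the variety of $P$ means $P^2\subset J\subset P$; ''one single embedded component, being a linear space of codimension $4m-5$'' means that $R/J$ has exactly one embedded associated prime and that this prime is generated by $4m-5$ linearly independent linear forms. In (iv), $\Delta_{j,i}$ denotes the (signed) cofactor of the $(i,j)$-entry of $\mathcal{GC}$, so that the adjugate matrix is $\mathrm{adj}(\mathcal{GC})=(\Delta_{i,j})$, and $y_{i,j}$ is the homogeneous coordinate of the target $\mathbb{P}^{m^2-1}$ corresponding to $\Delta_{i,j}$; $\mathbb{D}_{i,j}$ is likewise the signed cofactor. A rational map $\mathcal F$ given by forms $\mathbf f$ of the same degree, with image $W$, is birational onto $W$ if there are forms $g_0,\dots,g_n$ of the same degree in the target coordinates, not all vanishing modulo $I(W)$, with $(g_0(\mathbf f):\cdots:g_n(\mathbf f))=(x_0:\cdots:x_n)$; the $g_i$ define the inverse map. In (v), for ideals $J\subset P$, $J$ is a reduction of $P$ if $P^{n+1}=JP^n$ for some $n\ge 0$. *)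

(* Defs.v *)
From HB Require Import structures.
From mathcomp Require Import all_boot all_order all_algebra.
From mathcomp Require Import boolp classical_sets.
From mathcomp Require Import mpoly.

Set Implicit Arguments.
Unset Strict Implicit.
Unset Printing Implicit Defensive.

Import GRing.Theory.
Local Open Scope ring_scope.
Local Open Scope classical_set_scope.

Definition is_ideal (R : comNzRingType) (I : set R) : Prop :=
  [/\ I 0, forall x y, I x -> I y -> I (x + y) & forall a x, I x -> I (a * x)].

Definition ideal_gen (R : comNzRingType) (S : set R) : set R :=
  smallest (@is_ideal R) S.

Definition ideal_mul (R : comNzRingType) (I J : set R) : set R :=
  ideal_gen [set x * y | x in I & y in J].

Definition ideal_exp (R : comNzRingType) (I : set R) (n : nat) : set R :=
  iter n (ideal_mul I) setT.

Definition radical (R : comNzRingType) (I : set R) : set R :=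
  [set x | exists n, I (x ^+ n)].

Definition prime_ideal (R : comNzRingType) (P : set R) : Prop :=
  [/\ is_ideal P, ~ P 1 & forall x y, P (x * y) -> P x \/ P y].

Definition maximal_ideal (R : comNzRingType) (M : set R) : Prop :=
  [/\ is_ideal M, ~ M 1 &
      forall I, is_ideal I -> ~ I 1 -> M `<=` I -> I = M].

Definition primary_ideal (R : comNzRingType) (Q : set R) : Prop :=
  [/\ is_ideal Q, ~ Q 1 & forall x y, Q (x * y) -> Q x \/ radical Q y].

(* [prime_chain n P]: there is a chain C 0 < C 1 < ... < C n = P of primes. *)
Definition prime_chain (R : comNzRingType) (n : nat) (P : set R) : Prop :=
  exists C : nat -> set R,
    [/\ forall i, (i <= n)%N -> prime_ideal (C i),
        forall i, (i < n)%N -> C i `<` C i.+1 &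
        C n = P].

(* The height of a prime is the supremum of the lengths of the chains below
   it; the height of an ideal is the least height of a prime containing it. *)
Definition prime_height (R : comNzRingType) (P : set R) (h : nat) : Prop :=
  prime_chain h P /\ ~ prime_chain h.+1 P.

Definition ideal_height (R : comNzRingType) (I : set R) (h : nat) : Prop :=
  (exists Q, [/\ prime_ideal Q, I `<=` Q & prime_height Q h]) /\
  (forall Q, prime_ideal Q -> I `<=` Q -> prime_chain h Q).

Definition minimal_prime (R : comNzRingType) (I P : set R) : Prop :=
  [/\ prime_ideal P, I `<=` P &
      forall Q, prime_ideal Q -> I `<=` Q -> Q `<=` P -> Q = P].

Definition associated_prime (R : comNzRingType) (I P : set R) : Prop :=
  prime_ideal P /\ exists x, P = [set a | I (a * x)].

Definition embedded_prime (R : comNzRingType) (I P : set R) : Prop :=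
  associated_prime I P /\ ~ minimal_prime I P.

Definition primary_decomposition (R : comNzRingType) (I : set R)
    (n : nat) (D : 'I_n -> set R) : Prop :=
  [/\ forall i, primary_ideal (D i),
      I = \bigcap_i D i,
      injective (fun i => radical (D i)) &
      forall i, ~ (\bigcap_(j in [set j | j != i]) D j `<=` D i)].

(* [Q] is the [P]-primary component of [I] in some irredundant primary
   decomposition. *)
Definition primary_component (R : comNzRingType) (I P Q : set R) : Prop :=
  exists (n : nat) (D : 'I_n -> set R) (i : 'I_n),
    [/\ primary_decomposition I D, D i = Q & radical Q = P].

Definition reduction (R : comNzRingType) (J P : set R) : Prop :=
  J `<=` P /\ exists n, ideal_exp P n.+1 = ideal_mul J (ideal_exp P n).

Definition noetherian (A : comNzRingType) : Prop :=
  forall I : set A, is_ideal I ->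
    exists s : seq A, I = ideal_gen [set x | x \in s].

Definition injective_module (A : comNzRingType) (M : lmodType A) : Prop :=
  forall (N N' : lmodType A) (i : {linear N -> N'}) (g : {linear N -> M}),
    injective i -> exists h : {linear N' -> M}, forall x, h (i x) = g x.

(* [injdim_le n M]: there is an exact sequence
   0 -> M -> E_0 -> ... -> E_n -> 0 with all E_j injective, given here as a
   succession of short exact sequences. *)
Fixpoint injdim_le (A : comNzRingType) (n : nat) (M : lmodType A) : Prop :=
  if n is n'.+1 then
    exists (E C : lmodType A) (i : {linear M -> E}) (p : {linear E -> C}),
      [/\ injective_module E,
          injective i,
          forall e, p e = 0 <-> exists x, i x = e,
          forall c, exists e, p e = c &
          injdim_le n' C]
  else injective_module M.

Definition is_localization (A B : comNzRingType) (S : set A)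
    (phi : {rmorphism A -> B}) : Prop :=
  [/\ forall s, S s -> exists b, phi s * b = 1,
      forall b, exists a s, S s /\ b * phi s = phi a &
      forall a, phi a = 0 -> exists s, S s /\ s * a = 0].

(* Finite self-injective dimension at every maximal ideal; a localization is
   unique up to isomorphism, so any model of it may be used. *)
Definition gorenstein (A : comNzRingType) : Prop :=
  noetherian A /\
  forall M : set A, maximal_ideal M ->
    exists (B : comNzRingType) (phi : {rmorphism A -> B}),
      is_localization (~` M) phi /\ exists n, injdim_le n (B^o : lmodType B).

(* [A] below is the quotient ring R/P. *)
Definition gorenstein_ideal (R : comNzRingType) (P : set R) : Prop :=
  exists (A : comNzRingType) (pi : {rmorphism R -> A}),
    [/\ forall a, exists x, pi x = a,
        forall x, pi x = 0 <-> P x &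
        gorenstein A].

(* Variables of a polynomial ring are indexed by a finite type [I] through
   [enum_rank]. *)
Definition pvar (k : fieldType) (I : finType) (i : I) : {mpoly k[#|I|]} :=
  'X_(enum_rank i).

Definition gradient_ideal (k : fieldType) (n : nat) (f : {mpoly k[n]}) :
    set {mpoly k[n]} :=
  ideal_gen (range (fun i : 'I_n => mderiv i f)).

Definition linear_ideal (k : fieldType) (n c : nat) (E : set {mpoly k[n]}) :
    Prop :=
  exists l : 'I_c -> {mpoly k[n]},
    [/\ forall i, l i \is 1.-homog,
        forall a : 'I_c -> k, \sum_i a i *: l i = 0 -> forall i, a i = 0 &
        E = ideal_gen (range l)].

Definition minors_ideal (R : comNzRingType) (m t : nat) (A : 'M[R]_m) : set R :=
  ideal_gen [set d | exists f g : 'I_t -> 'I_m,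
    [/\ {homo f : a b / (a < b)%N}, {homo g : a b / (a < b)%N} &
        d = \det (mxsub f g A)]].

(* Source coordinates are indexed by [I], target coordinates by [T]. *)
Definition rational_map (k : fieldType) (I T : finType)
    (F : T -> {mpoly k[#|I|]}) : Prop :=
  (exists d, forall t, F t \is d.-homog) /\ exists t, F t != 0.

Definition psubst (k : fieldType) (I T : finType) (F : T -> {mpoly k[#|I|]})
    (p : {mpoly k[#|T|]}) : {mpoly k[#|I|]} :=
  p \mPo [tuple F (enum_val t) | t < #|T|].

(* The homogeneous ideal of the (closure of the) image. *)
Definition image_ideal (k : fieldType) (I T : finType)
    (F : T -> {mpoly k[#|I|]}) : set {mpoly k[#|T|]} :=
  [set p | psubst F p = 0].

(* The last clause says that (G_i(F))_i and (x_i)_i are proportional. *)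
Definition inverse_map (k : fieldType) (I T : finType)
    (F : T -> {mpoly k[#|I|]}) (G : I -> {mpoly k[#|T|]}) : Prop :=
  [/\ exists d, forall i, G i \is d.-homog,
      exists i, ~ image_ideal F (G i) &
      forall i j, psubst F (G i) * pvar k j = psubst F (G j) * pvar k i].

Definition birational_onto_image (k : fieldType) (I T : finType)
    (F : T -> {mpoly k[#|I|]}) : Prop :=
  rational_map F /\ exists G, inverse_map F G.

(* The [k]-span of the family [G], modulo the ideal [H]. *)
Definition span_mod (k : fieldType) (n : nat) (H : set {mpoly k[n]})
    (I : finType) (G : I -> {mpoly k[n]}) : set {mpoly k[n]} :=
  [set p | exists a : I -> k, H (p - \sum_i a i *: G i)].

(* Indices start at 0: [ord_last] and [ord_penult] are the 1-based m and m-1. *)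
Lemma ord_last_subproof (m : nat) : (3 <= m)%N -> (m.-1 < m)%N.
Proof. by case: m. Qed.

Lemma ord_penult_subproof (m : nat) : (3 <= m)%N -> (m.-2 < m)%N.
Proof. by case: m => [|[|m]] // _; apply: leqW. Qed.

Definition ord_last (m : nat) (hm : (3 <= m)%N) : 'I_m :=
  Ordinal (ord_last_subproof hm).

Definition ord_penult (m : nat) (hm : (3 <= m)%N) : 'I_m :=
  Ordinal (ord_penult_subproof hm).

Definition gc_var (m : nat) (hm : (3 <= m)%N) : finType :=
  {ij : 'I_m * 'I_m | ij != (ord_last hm, ord_last hm)}.

Lemma gc_var_penult_subproof (m : nat) (hm : (3 <= m)%N) :
  (ord_penult hm, ord_penult hm) != (ord_last hm, ord_last hm).
Proof.
by apply/eqP => -[] /eqP; case: m hm => [|[|m]] //= _; rewrite ltn_eqF.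
Qed.

Definition gc_var_penult (m : nat) (hm : (3 <= m)%N) : gc_var hm :=
  exist _ (ord_penult hm, ord_penult hm) (gc_var_penult_subproof hm).

(* [insubd] returns [gc_var_penult hm] exactly at the excluded last entry. *)
Definition GC (k : fieldType) (m : nat) (hm : (3 <= m)%N) :
    'M[{mpoly k[#|gc_var hm|]}]_m :=
  \matrix_(i, j) pvar k (insubd (gc_var_penult hm) (i, j)).

Definition generic_mx (k : fieldType) (m : nat) :
    'M[{mpoly k[#|{: 'I_m * 'I_m}|]}]_m :=
  \matrix_(i, j) pvar k (i, j).

(* Main.v *)
Require Import Defs.
From HB Require Import structures.
From mathcomp Require Import all_boot all_order all_algebra.
From mathcomp Require Import boolp classical_sets.
From mathcomp Require Import mpoly ring perm zify.

Set Implicit Arguments.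
Unset Strict Implicit.
Unset Printing Implicit Defensive.

Import GRing.Theory.
Local Open Scope ring_scope.
Local Open Scope classical_set_scope.

(* Write X for the matrix GC, of size m, and P for the ideal of its submaximal
   minors.

   On the Gulliksen-Negard complex of X, of length 4, the square of a submaximal
   minor acts null-homotopically, so by the acyclicity lemma the complex resolves
   R/P once P contains enough elements that are regular in succession. Adding to
   X a banded matrix in five new variables, which can be specialized to 0, one
   reads regularity off the leading forms. The same argument makes a minor of
   size m - 2 regular modulo P; once it is inverted, a matrix of rank m - 2 is
   determined by that block and its neighbours, subject to the one relation
   forced by the repeated variable, a quadratic equation generating a prime
   ideal. Hence P is prime, and counting parameters gives height 4.

   For the Gorenstein property, the maps from R to a k-vector space form an
   injective module, and those commuting with more and more variables give a
   finite injective resolution of R. The self-duality of the complex then moves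
   Ext(-, R/P) to Ext(-, R) with a shift by 4.

   With D the adjugate of X, p = m - 1 and l = m, the derivatives of det X are
   the D_ij, except that D_pp and D_ll occur only through their sum; so
   P = J + (D_ll). Let E be generated by the 4m - 5 variables in the two last rows
   and columns. Reading X D = D X = (det X) 1 modulo J gives E D_ll <= J, hence
   P^2 <= J since D_ll lies in E. Along a curve leaving the zero set of E, the
   generators of J have order 3 while D_ll has order 2, which shows that E is an
   embedded prime and that J is not a reduction of P.

   For (iv), adj (adj Y) = (det Y)^(m-2) Y, and det Y is regular modulo
   D_ll - D_pp. *)

(** The acyclicity lemma consumes four elements of the ideal of minors, and finding them in [R]
    itself would presuppose the height of P. After the deformation, the parts of top degree in the
    new variables are minors of a fixed band matrix with integer coefficients, whatever [X] is. Four
    of the variables are nilpotent modulo these minors, so powers of them are leading forms of the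
    elements wanted. Characteristic zero enters through the distinct integers on the main diagonal
    of the band. The fifth variable is there for the minor of size m - 2.

    Exactness is always stated modulo an ideal on lifts, and vanishing of Ext is a property of
    families of elements annihilated by a matrix, so the homological part stays over [R]. The ring
    R/P and its localizations are realized as subrings of one field, which the parametrization with
    kernel P provides.

    The height is squeezed between a chain of kernels, where each inclusion fixes one more entry of
    the last two by two block, and a bound by the number of variables that stay algebraically
    independent modulo P. *)

(* Matrix products and traces are treated as atoms; only the coefficients are compared. *)
Ltac mxlin :=
  repeat match goal with |- context[\tr ?a] => move: (\tr a) => ? end;
  repeat match goal with |- context[?a *m ?b] => move: (a *m b) => ? end;
  apply/matrixP => ? ?; rewrite !mxE; ring.

(** * The Gulliksen-Negard complex and its homotopies *)

Section GulliksenNegard.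
Variables (T : comNzRingType) (m : nat) (X : 'M[T]_m).
Local Notation M := 'M[T]_m.

(** The middle term is usually a subquotient of [M * M]: pairs of equal trace modulo diagonal scalar
    pairs. Here both neighbours receive an extra copy of [T] instead, so that every term is free;
    the components along [\det X] make the composites vanish. *)
Definition gn1 (p : M * T^o) : T^o := \tr (\adj X *m p.1) - \det X * p.2.
Definition gn2 (p : M * M) : M * T^o := (p.1 *m X - X *m p.2, \tr p.1 - \tr p.2).
Definition gn3 (p : M * T^o) : M * M :=
  (X *m p.1 + (p.2)%:M, p.1 *m X + (p.2)%:M).
Definition gn4 (s : T^o) : M * T^o := (s *: \adj X, - (s * \det X)).

Lemma gn12 p : gn1 (gn2 p) = 0.
Proof.
case: p => U V; rewrite /gn1 /gn2 /= mulmxBr !raddfB /=.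
rewrite mulmxA mxtrace_mulC !mulmxA mul_mx_adj mul_adj_mx !mul_scalar_mx.
by rewrite !mxtraceZ /= -mulrBr subrr.
Qed.

Lemma gn23 p : gn2 (gn3 p) = 0.
Proof.
case: p => N r; rewrite /gn2 /gn3 /= mulmxDl mulmxDr mulmxA !mxtraceD.
rewrite scalar_mxC opprD addrACA !subrr addr0 (mxtrace_mulC N X).
by rewrite opprD addrACA !subrr addr0.
Qed.

Lemma gn34 s : gn3 (gn4 s) = 0.
Proof.
rewrite /gn3 /gn4 /= -scalemxAr -scalemxAl mul_mx_adj mul_adj_mx.
by rewrite scale_scalar_mx raddfN /= subrr.
Qed.

Lemma gn1_is_linear : linear gn1.
Proof.
move=> a [N r] [N' r']; rewrite /gn1 /= mulmxDr -scalemxAr mxtraceD mxtraceZ.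
by rewrite /GRing.scale /=; ring.
Qed.

Lemma gn2_is_linear : linear gn2.
Proof.
move=> a [U V] [U' V']; rewrite /gn2 /= mulmxDr mulmxDl -scalemxAr -scalemxAl.
rewrite !mxtraceD !mxtraceZ /=; congr pair => /=.
  by rewrite scalerBr addrACA opprD.
by rewrite /GRing.scale /=; ring.
Qed.

Lemma gn3_is_linear : linear gn3.
Proof.
move=> a [N r] [N' r']; rewrite /gn3 /= mulmxDr mulmxDl -scalemxAr -scalemxAl.
by congr pair => /=; rewrite raddfD /= scalerDr scale_scalar_mx addrACA.
Qed.

Lemma gn4_is_linear : linear gn4.
Proof.
move=> a s s'; rewrite /gn4 /=; congr pair => /=.
  by rewrite scalerDl scalerA.
by rewrite /GRing.scale /=; ring.
Qed.

HB.instance Definition _ := GRing.isLinear.Build T _ _ _ gn1 gn1_is_linear.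
HB.instance Definition _ := GRing.isLinear.Build T _ _ _ gn2 gn2_is_linear.
HB.instance Definition _ := GRing.isLinear.Build T _ _ _ gn3 gn3_is_linear.
HB.instance Definition _ := GRing.isLinear.Build T _ _ _ gn4 gn4_is_linear.

Variables (k l : 'I_m).

(* [Z] is elementary, [D] is the submaximal minor [(\adj X) k l], and [Y] the
   derivative of [\adj X] in the direction [Z]; near a point where [D] is
   invertible, [Y / D] inverts [X] up to rank one. *)
Let A := \adj X.
Let f := \det X.
Let D := A k l.
Let Z : M := delta_mx l k.
Let Y : M := \adj (X + Z) - A.

Lemma tr_mul_delta (N : M) : \tr (N *m Z) = N k l.
Proof.
rewrite /mxtrace (bigD1 k) //= big1 ?addr0 => [|i Hi].
  by rewrite !mxE (bigD1 l) //= big1 ?addr0 ?mxE ?eqxx ?mulr1 // => j Hj;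
     rewrite mxE (negPf Hj) mulr0.
by rewrite !mxE big1 // => j _; rewrite mxE (negPf Hi) andbF mulr0.
Qed.

Lemma delta_mul_delta (N : M) : Z *m N *m Z = N k l *: Z.
Proof.
apply/matrixP => i j; rewrite !mxE (bigD1 l) //= big1 ?addr0 => [|a Ha].
  rewrite !mxE (bigD1 k) //= big1 ?addr0 => [|b Hb].
    rewrite !mxE !eqxx /= andbT; case: (i == l) => /=; rewrite ?mulr0 ?mul1r ?mul0r //.
  by rewrite mxE (negPf Hb) andbF mul0r.
by rewrite [X in _ * X]mxE (negPf Ha) mulr0.
Qed.

(** Row [k] of the adjugate consists of the cofactors of column [k], computed without that
    column. *)
Lemma adj_row_eq (B C : M) : (forall i j, j != k -> B i j = C i j) ->
  forall j, (\adj B) k j = (\adj C) k j.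
Proof.
move=> H j; rewrite !mxE /cofactor; congr (_ * \det _).
by apply/matrixP => a b; rewrite !mxE H // eq_sym neq_lift.
Qed.

Lemma adj_col_eq (B C : M) : (forall i j, i != l -> B i j = C i j) ->
  forall j, (\adj B) j l = (\adj C) j l.
Proof.
move=> H j; rewrite !mxE /cofactor; congr (_ * \det _).
by apply/matrixP => a b; rewrite !mxE H // eq_sym neq_lift.
Qed.

Lemma deltaY : Z *m Y = 0.
Proof.
apply/matrixP => i j; rewrite !mxE big1 // => b _; rewrite [Z i b]mxE.
case: (altP (b =P k)) => [->|_]; last by rewrite andbF mul0r.
suff ->: Y k j = 0 by rewrite mulr0.
rewrite /Y mxE [X in _ + X]mxE (@adj_row_eq (X + Z) X) ?subrr // => a b' Hb.
by rewrite !mxE (negPf Hb) andbF addr0.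
Qed.

Lemma Ydelta : Y *m Z = 0.
Proof.
apply/matrixP => i j; rewrite !mxE big1 // => b _; rewrite [Z b j]mxE.
case: (altP (b =P l)) => [->|_]; last by rewrite mulr0.
suff ->: Y i l = 0 by rewrite mul0r.
rewrite /Y mxE [X in _ + X]mxE (@adj_col_eq (X + Z) X) ?subrr // => a b' Hb.
by rewrite !mxE (negPf Hb) addr0.
Qed.

Lemma detXZ : \det (X + Z) = f + D.
Proof.
have H : (\adj (X + Z) *m (X + Z)) k k = f + D.
  have -> : (\adj (X + Z) *m (X + Z)) k k = (A *m (X + Z)) k k.
    rewrite !mxE; apply: eq_bigr => j _; congr (_ * _).
    apply: (@adj_row_eq (X + Z) X) => a b' Hb.
    by rewrite !mxE (negPf Hb) andbF addr0.
  have AZ : (A *m Z) k k = D.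
    rewrite mxE (bigD1 l) //= big1 ?addr0 => [|j Hj]; rewrite [Z _ _]mxE.
      by rewrite !eqxx mulr1.
    by rewrite (negPf Hj) mulr0.
  by rewrite mulmxDr mul_adj_mx mxE AZ mxE eqxx mulr1n.
by move: H; rewrite mul_adj_mx mxE eqxx mulr1n.
Qed.

(** This is [X *m A = f%:M] differentiated along [Z]; the second order term [Z *m Y] vanishes by
    [deltaY]. *)
Lemma XY : X *m Y = D%:M - Z *m A.
Proof.
have HZ : Z *m \adj (X + Z) = Z *m A.
  by move/eqP: deltaY; rewrite /Y mulmxBr subr_eq0 => /eqP.
rewrite /Y mulmxBr mul_mx_adj -[X in X *m _](addrK Z) mulmxBl mul_mx_adj.
by rewrite detXZ HZ raddfD /= addrAC [f%:M + _]addrC addrK.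
Qed.

Lemma YX : Y *m X = D%:M - A *m Z.
Proof.
have HZ : \adj (X + Z) *m Z = A *m Z.
  by move/eqP: Ydelta; rewrite /Y mulmxBl subr_eq0 => /eqP.
rewrite /Y mulmxBl mul_adj_mx -[X in _ *m X](addrK Z) mulmxBr mul_adj_mx.
by rewrite detXZ HZ raddfD /= addrAC [f%:M + _]addrC addrK.
Qed.

Lemma detY : f *: Y = D *: A - A *m Z *m A.
Proof.
have: A *m (X *m Y) = f *: Y by rewrite mulmxA mul_adj_mx mul_scalar_mx.
by rewrite XY mulmxBr mul_mx_scalar mulmxA => <-.
Qed.

(** Where [D] is invertible, [Z *m A] and [A *m Z] divided by [D] are the rank one idempotents
    complementary to the partial inverse of [X]. Together they contract the complex; the factor
    [D ^+ 2] clears the denominators of that contraction. *)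
Definition gh0 (s : T^o) : M * T^o := ((D * s) *: Z, 0).
Definition gh1 (p : M * T^o) : M * M :=
  (Z *m A *m p.1 *m Y,
   - (D *: (Y *m p.1)) + (\tr (Y *m p.1) - D * p.2) *: (A *m Z)).
Definition gh2 (p : M * M) : M * T^o :=
  (D *: (Y *m p.1) + A *m Z *m p.2 *m Y - \tr (A *m p.1 *m Z) *: Y,
   D * \tr (A *m p.1 *m Z)).
Definition gh3 (p : M * T^o) : T^o := D * \tr (p.1 *m Z).


Lemma trAZ : \tr (A *m Z) = D.
Proof. exact: tr_mul_delta. Qed.

Lemma gn_homotopy1 (p : M * T^o) :
  D ^+ 2 *: p = gn2 (gh1 p) + gh0 (gn1 p).
Proof.
have := (deltaY, Ydelta, XY, YX, detY) => -[[[[hZY hYZ] hXY] hYX] hfY].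
rewrite /gn1 /gn2 /gn3 /gn4 /gh0 /gh1 /gh2 /gh3 -/A -/f; clearbody Y.
case: p => W t; set tau := \tr (Y *m W) - D * t.
have ZAZ : Z *m A *m Z = D *: Z by exact: delta_mul_delta.
have ZAWAZ : Z *m A *m W *m A *m Z = \tr (A *m W *m A *m Z) *: Z.
  by rewrite tr_mul_delta -delta_mul_delta !mulmxA.
have fY : f * \tr (Y *m W) = D * \tr (A *m W) - \tr (A *m W *m A *m Z).
  rewrite -(mxtraceZ f) (scalemxAl f) hfY mulmxBl.
  rewrite raddfB /= -scalemxAl mxtraceZ; congr (_ - _).
  by rewrite -[A *m Z *m A *m W]mulmxA mxtrace_mulC !mulmxA.
congr pair => /=.
  have UX : Z *m A *m W *m Y *m X
      = D *: (Z *m A *m W) - \tr (A *m W *m A *m Z) *: Z.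
    by rewrite -mulmxA hYX mulmxBr mul_mx_scalar !mulmxA ZAWAZ.
  have XV : X *m (- (D *: (Y *m W)) + tau *: (A *m Z))
      = D *: (Z *m A *m W) - D ^+ 2 *: W + (tau * f) *: Z.
    rewrite mulmxDr mulmxN -!scalemxAr !mulmxA hXY mul_mx_adj mul_scalar_mx.
    by rewrite scalerA mulmxBl mul_scalar_mx scalerBr opprB scalerA expr2.
  rewrite UX XV.
  have -> : D * (\tr (A *m W) - f * t) = \tr (A *m W *m A *m Z) + tau * f.
    have -> : \tr (A *m W *m A *m Z) = D * \tr (A *m W) - f * \tr (Y *m W).
      by rewrite fY; ring.
    by rewrite /tau; ring.
  by mxlin.
rewrite addr0 mxtraceD (raddfN mxtrace) /= !mxtraceZ /=.
have -> : \tr (Z *m A *m W *m Y) = 0.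
  by rewrite mxtrace_mulC !mulmxA hYZ !mul0mx raddf0.
rewrite trAZ /tau /GRing.scale /=; ring.
Qed.

Lemma gn_homotopy2 (p : M * M) :
  D ^+ 2 *: p = gn3 (gh2 p) + gh1 (gn2 p).
Proof.
have := (deltaY, Ydelta, XY, YX, detY) => -[[[[hZY hYZ] hXY] hYX] hfY].
rewrite /gn1 /gn2 /gn3 /gn4 /gh0 /gh1 /gh2 /gh3 -/A -/f; clearbody Y.
case: p => U V; set r := \tr (A *m U *m Z).
have ZAUZ : Z *m A *m U *m Z = r *: Z.
  by rewrite /r tr_mul_delta -delta_mul_delta !mulmxA.
have ZVAZ : A *m Z *m V *m A *m Z = \tr (V *m A *m Z) *: (A *m Z).
  by rewrite tr_mul_delta scalemxAr -delta_mul_delta !mulmxA.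
have trZAU : \tr (Z *m A *m U) = r by rewrite -mulmxA mxtrace_mulC.
have trYUX : \tr (Y *m U *m X) = D * \tr U - r.
  by rewrite mxtrace_mulC mulmxA hXY mulmxBl mul_scalar_mx raddfB /= mxtraceZ trZAU.
have trAZV : \tr (A *m Z *m V) = \tr (V *m A *m Z).
  by rewrite mxtrace_mulC mulmxA.
have YW : Y *m (U *m X - X *m V) = Y *m U *m X - D *: V + A *m Z *m V.
  rewrite mulmxBr mulmxA [Y *m (X *m V)]mulmxA hYX mulmxBl mul_scalar_mx.
  by rewrite opprB addrA addrAC.
rewrite /= -/r; congr pair => /=.
  have XAZV : X *m (A *m Z *m V *m Y) = f *: (Z *m V *m Y).
    by rewrite -!mulmxA (mulmxA X) mul_mx_adj mul_scalar_mx.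
  have XYU : X *m (Y *m U) = D *: U - Z *m A *m U.
    by rewrite mulmxA hXY mulmxBl mul_scalar_mx.
  have ZAUXY : Z *m A *m (U *m X) *m Y = D *: (Z *m A *m U) - r *: (Z *m A).
    rewrite -!mulmxA hXY !mulmxBr !mul_mx_scalar -!scalemxAr !mulmxA ZAUZ.
    by rewrite -scalemxAl.
  have ZAXVY : Z *m A *m (X *m V) *m Y = f *: (Z *m V *m Y).
    rewrite -!mulmxA (mulmxA A) mul_adj_mx mul_scalar_mx -scalemxAr.
    by [].
  rewrite [X *m (_ - _)]mulmxBr [X *m (_ + _)]mulmxDr -!scalemxAr XAZV XYU hXY.
  rewrite [_ *m _ *m (_ - _)]mulmxBr.
  rewrite mulmxBl ZAUXY ZAXVY.
  by mxlin.
have AZVYX : A *m Z *m V *m Y *m X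
    = D *: (A *m Z *m V) - \tr (V *m A *m Z) *: (A *m Z).
  by rewrite -[_ *m Y *m X]mulmxA hYX mulmxBr mul_mx_scalar !mulmxA ZVAZ.
have trYW : \tr (Y *m (U *m X - X *m V)) - D * (\tr U - \tr V)
    = \tr (V *m A *m Z) - r.
  by rewrite YW mxtraceD raddfB /= trYUX trAZV mxtraceZ; ring.
rewrite trYW YW [(_ - r *: Y) *m X]mulmxBl mulmxDl -!scalemxAl AZVYX hYX.
by mxlin.
Qed.

Lemma gn_homotopy3 (p : M * T^o) :
  D ^+ 2 *: p = gn4 (gh3 p) + gh2 (gn3 p).
Proof.
have := (deltaY, Ydelta, XY, YX, detY) => -[[[[hZY hYZ] hXY] hYX] hfY].
rewrite /gn1 /gn2 /gn3 /gn4 /gh0 /gh1 /gh2 /gh3 -/A -/f; clearbody Y.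
case: p => N r.
have ZNZ : Z *m N *m Z = \tr (N *m Z) *: Z.
  by rewrite tr_mul_delta -delta_mul_delta.
have trA : \tr (A *m (X *m N + r%:M) *m Z) = f * \tr (N *m Z) + r * D.
  rewrite mulmxDr mulmxA mul_adj_mx mul_scalar_mx mul_mx_scalar mulmxDl.
  by rewrite -!scalemxAl mxtraceD !mxtraceZ trAZ.
have YA : Y *m (X *m N + r%:M) = D *: N - A *m Z *m N + r *: Y.
  by rewrite mulmxDr mulmxA hYX mulmxBl mul_scalar_mx mul_mx_scalar.
have ZBY : A *m Z *m (N *m X + r%:M) *m Y
    = D *: (A *m Z *m N) - \tr (N *m Z) *: (A *m Z *m A).
  rewrite mulmxDr mulmxDl mul_mx_scalar -scalemxAl -(mulmxA A Z Y) hZY.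
  rewrite mulmx0 scaler0 addr0 mulmxA -(mulmxA _ X Y) hXY mulmxBr mul_mx_scalar.
  have -> : A *m Z *m N *m (Z *m A) = A *m (Z *m N *m Z) *m A by rewrite !mulmxA.
  by rewrite ZNZ -scalemxAr -scalemxAl.
have fYD : A *m Z *m A = D *: A - f *: Y.
  by rewrite hfY opprB addrC subrK.
rewrite /= trA; congr pair => /=; last by rewrite /GRing.scale /=; ring.
rewrite YA ZBY fYD.
by mxlin.
Qed.

Lemma gn_homotopy4 s : D ^+ 2 * s = gh3 (gn4 s).
Proof. by rewrite /gh3 /gn4 /= -scalemxAl mxtraceZ /= trAZ; ring. Qed.

End GulliksenNegard.

(** * Ideals, regular elements and submaximal minors *)

Section Ideals.
Variable R : comNzRingType.
Implicit Types (I J : set R) (x y : R).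

Lemma ideal0 I : is_ideal I -> I 0. Proof. by case. Qed.
Lemma idealD I x y : is_ideal I -> I x -> I y -> I (x + y).
Proof. by case=> _ H _; apply: H. Qed.
Lemma idealMl I x y : is_ideal I -> I y -> I (x * y).
Proof. by case=> _ _ H; apply: H. Qed.
Lemma idealMr I x y : is_ideal I -> I x -> I (x * y).
Proof. by rewrite mulrC; apply: idealMl. Qed.
Lemma idealN I x : is_ideal I -> I x -> I (- x).
Proof. by rewrite -mulN1r; apply: idealMl. Qed.
Lemma idealB I x y : is_ideal I -> I x -> I y -> I (x - y).
Proof. by move=> iI Ix Iy; apply: idealD => //; apply: idealN. Qed.
Lemma ideal_sum I (A : Type) (r : seq A) (P : pred A) (F : A -> R) :
  is_ideal I -> (forall i, P i -> I (F i)) -> I (\sum_(i <- r | P i) F i).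
Proof. by move=> iI H; elim/big_ind: _ => //; [exact: ideal0 | move=> *; exact: idealD]. Qed.
Lemma ideal_subr I x y : is_ideal I -> I (x - y) -> I y -> I x.
Proof. by move=> iI Ixy Iy; rewrite -(subrK y x); apply: idealD. Qed.
Lemma ideal_subl I x y : is_ideal I -> I (x - y) -> I x -> I y.
Proof. by move=> iI Ixy Ix; rewrite -(subKr x y) ; apply: idealB. Qed.

Lemma is_ideal_gen (S : set R) : is_ideal (ideal_gen S).
Proof.
split=> [I [iI _]|x y Sx Sy I [iI SI]|a x Sx I [iI SI]]; first exact: ideal0.
- by apply: idealD => //; [apply: Sx | apply: Sy].
- by apply: idealMl => //; apply: Sx.
Qed.

Lemma sub_ideal_gen (S : set R) : S `<=` ideal_gen S.
Proof. by move=> x Sx I [_]; apply. Qed.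

Lemma ideal_gen_sub (S I : set R) : is_ideal I -> S `<=` I -> ideal_gen S `<=` I.
Proof. by move=> iI SI x; apply. Qed.

Lemma is_ideal0 : is_ideal [set (0 : R)].
Proof. by split=> [//|x y -> ->|a x ->]; rewrite /= ?addr0 ?mulr0. Qed.

Definition adjoin I b : set R := [set x | exists y, I (x - b * y)].

Lemma is_ideal_adjoin I b : is_ideal I -> is_ideal (adjoin I b).
Proof.
move=> iI; split=> [|x y [u Hu] [v Hv]|a x [u Hu]].
- by exists 0; rewrite mulr0 subr0; apply: ideal0.
- by exists (u + v); rewrite mulrDr opprD addrACA; apply: idealD.
- by exists (a * u); rewrite mulrCA -mulrBr; apply: idealMl.
Qed.

Lemma sub_adjoin I b : is_ideal I -> I `<=` adjoin I b.
Proof. by move=> iI x Ix; exists 0; rewrite mulr0 subr0. Qed.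

Lemma mem_adjoin I b : is_ideal I -> adjoin I b b.
Proof. by move=> iI; exists 1; rewrite mulr1 subrr; apply: ideal0. Qed.

Definition nzd_mod I b := forall x, I (b * x) -> I x.

Lemma is_ideal_radical I : is_ideal I -> is_ideal (radical I).
Proof.
move=> iI; split=> [|x y [n Hn] [p Hp]|a x [n Hn]].
- by exists 1%N; rewrite expr1; apply: ideal0.
- exists (n + p)%N; rewrite exprDn; apply: ideal_sum => // i _.
  rewrite -mulr_natr; apply: idealMr => //.
  case: (leqP p i) => pi; first by rewrite -(subnK pi) exprD mulrA; apply: idealMl.
  apply: idealMr => //.
  have ni : (n <= n + p - i)%N by rewrite -addnBA ?leq_addr // ltnW.
  by rewrite -(subnK ni) exprD; apply: idealMl.
- by exists n; rewrite exprMn; apply: idealMl.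
Qed.

Lemma radical_exp I x n : is_ideal I -> radical I (x ^+ n) -> radical I x.
Proof. by move=> iI [p Hp]; exists (n * p)%N; rewrite exprM. Qed.


Lemma ideal_prod_congr I (A : Type) (r : seq A) (F G : A -> R) :
  is_ideal I -> (forall i, I (F i - G i)) ->
  I (\prod_(i <- r) F i - \prod_(i <- r) G i).
Proof.
move=> iI H; elim: r => [|i r IH]; first by rewrite !big_nil subrr; apply: ideal0.
rewrite !big_cons.
have -> : F i * \prod_(j <- r) F j - G i * \prod_(j <- r) G j =
  (F i - G i) * \prod_(j <- r) F j +
  G i * (\prod_(j <- r) F j - \prod_(j <- r) G j) by ring.
by apply: idealD => //; [apply: idealMr | apply: idealMl].
Qed.

Lemma ideal_det_congr I p (A B : 'M[R]_p) :
  is_ideal I -> (forall i j, I (A i j - B i j)) -> I (\det A - \det B).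
Proof.
move=> iI H; rewrite /determinant -sumrB; apply: ideal_sum => // s _.
by rewrite -mulrBr; apply: idealMl => //; apply: ideal_prod_congr.
Qed.

(* Up to sign and vanishing for a repeated index, the minor is an entry of the adjugate. *)
Lemma ideal_minor I p (A : 'M[R]_p.+1) (f g : 'I_p -> 'I_p.+1) :
  is_ideal I -> (forall i j, I ((\adj A) i j)) -> I (\det (mxsub f g A)).
Proof.
move=> iI H.
case: (boolP (injectiveb f)) => [/injectiveP injf|ninjf]; last first.
  move/injectivePn: ninjf => [a [b nab fab]].
  rewrite (@determinant_alternate _ _ _ a b) //; first exact: ideal0.
  by move=> j; rewrite !mxE fab.
case: (boolP (injectiveb g)) => [/injectiveP injg|ninjg]; last first.
  move/injectivePn: ninjg => [a [b nab gab]].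
  rewrite -det_tr (@determinant_alternate _ _ _ a b) //; first exact: ideal0.
  by move=> j; rewrite !mxE gab.
have lift_fact (h : 'I_p -> 'I_p.+1) : injective h ->
    exists (i0 : 'I_p.+1) (s : 'S_p), forall a, h a = lift i0 (s a).
  move=> injh.
  have [i0 Hi0] : exists i0, i0 \notin codom h.
    apply/existsP; apply: contraT; rewrite negb_exists => /forallP Hall.
    have : (#|'I_p.+1| <= #|codom h|)%N.
      apply/subset_leq_card/fintype.subsetP => i _; exact: negbNE (Hall i).
    by rewrite card_codom // !card_ord ltnn.
  have Hn a : i0 != h a by apply: contraNneq Hi0 => ->; apply: codom_f.
  pose s a := odflt a (unlift i0 (h a)).
  have sE a : h a = lift i0 (s a).
    by rewrite /s; case: unliftP (Hn a) => [j -> //|->]; rewrite eqxx.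
  have injs : injective s.
    by move=> a b eab; apply: injh; rewrite !sE eab.
  by exists i0, (perm injs) => a; rewrite permE.
have [i0 [s fE]] := lift_fact f injf; have [j0 [t gE]] := lift_fact g injg.
have -> : mxsub f g A = row_perm s (col_perm t (row' i0 (col' j0 A))).
  by apply/matrixP => a b; rewrite !mxE fE gE.
rewrite row_permE col_permE !det_mulmx !det_perm.
apply: idealMl => //; apply: idealMr => //.
have := H j0 i0; rewrite mxE /cofactor => /(idealMl ((-1) ^+ (i0 + j0)) iI).
by rewrite mulrA -exprD addnn -mul2n exprM sqrrN expr1n expr1n mul1r.
Qed.
End Ideals.

(** * The acyclicity lemma for the complex *)

Section Acyclicity.
Variables (T : comNzRingType) (m : nat) (X : 'M[T]_m).
Implicit Types I : set T.
Local Notation M := 'M[T]_m.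

Definition inM I (N : M) := forall i j, I (N i j).
Definition inMT I (p : M * T^o) := inM I p.1 /\ I p.2.
Definition inMM I (p : M * M) := inM I p.1 /\ inM I p.2.

Lemma inM0E A : inM [set 0] A <-> A = 0.
Proof.
by split=> [H|-> i j]; [apply/matrixP => i j|]; rewrite mxE // H.
Qed.
Lemma inMT0 p : inMT [set 0] p <-> p = 0.
Proof.
case: p => N r; split=> [[/= /inM0E -> -> //]|[-> ->]].
by split=> //; apply/inM0E.
Qed.
Lemma inMM0 p : inMM [set 0] p <-> p = 0.
Proof.
by case: p => N r; split=> [[/= /inM0E -> /inM0E -> //]|[-> ->]]; split; apply/inM0E.
Qed.

(** Exactness modulo [I] is stated on lifts in [T], so that the places of the complex can be
    compared for varying [I] without changing the ring. *)
Definition gn_exact1 I := forall z, I (gn1 X z) -> exists y, inMT I (z - gn2 X y).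
Definition gn_exact2 I := forall z, inMT I (gn2 X z) -> exists y, inMM I (z - gn3 X y).
Definition gn_exact3 I := forall z, inMM I (gn3 X z) -> exists y, inMT I (z - gn4 X y).
Definition gn_exact4 I := forall z, inMT I (gn4 X z) -> I z.

(* One descending step of the acyclicity lemma: if [B] is regular modulo [I]
   and annihilates the homology at [G1], then exactness at [G2] modulo
   [I + (B)] gives exactness at [G1] modulo [I]. *)
Lemma exact_step (G0 G1 G2 G3 : lmodType T) (d1 : G1 -> G0)
    (d2 : {linear G2 -> G1}) (d3 : G3 -> G2)
    (P0 : set G0) (P1 P1' : set G1) (P2 P2' : set G2) (B : T) :
  (forall x, d2 (d3 x) = 0) ->
  (forall x y, P1 x -> P1 y -> P1 (x + y)) ->
  (forall x, P1 x -> P1 (- x)) ->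
  (forall x, P1 x -> P1' x) ->
  (forall x, P1' (B *: x)) ->
  (forall x y, P1' x -> P1' y -> P1' (x + y)) ->
  (forall x, P1 (B *: x) -> P1 x) ->
  (forall x, P2 x -> P1 (d2 x)) ->
  (forall x, P2' x -> exists y, P2 (x - B *: y)) ->
  (forall z, P0 (d1 z) -> exists y, P1 (B *: z - d2 y)) ->
  (forall z, P1' (d2 z) -> exists y, P2' (z - d3 y)) ->
  forall z, P0 (d1 z) -> exists y, P1 (z - d2 y).
Proof.
move=> d23 P1D P1N sP1 BP1 P1'D reg d2P P2A kill ex z dz.
have [y Hy] := kill z dz.
have : P1' (d2 y).
  rewrite -(subKr (B *: z) (d2 y)); apply: P1'D => //.
  by apply: sP1; apply: P1N.
case/ex => w /P2A [y' Hy']; exists y'; apply: reg.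
have -> : B *: (z - d2 y') = (B *: z - d2 y) + d2 (y - d3 w - B *: y').
  have -> : d2 (y - d3 w - B *: y') = d2 y - B *: d2 y'.
    by rewrite 2!linearB d23 subr0 linearZ.
  by rewrite scalerBr addrA subrK.
by apply: P1D => //; apply: d2P.
Qed.

(** The homotopies kill the homology by squares of minors. Passing to the squares keeps the radical
    of the ideal of minors, and the leading form argument depends on the radical alone. *)
Definition sqminors : set T := ideal_gen [set x | exists k l, x = (\adj X) k l ^+ 2].

Lemma is_ideal_sqminors : is_ideal sqminors. Proof. exact: is_ideal_gen. Qed.

Lemma mem_sqminors k l : sqminors ((\adj X) k l ^+ 2).
Proof. by move=> I [_ SI]; apply: SI; exists k, l. Qed.

Section Fixed.
Variable I : set T.
Hypothesis iI : is_ideal I.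

Lemma inM0 : inM I 0. Proof. by move=> i j; rewrite mxE; apply: ideal0. Qed.
Lemma inMD A B : inM I A -> inM I B -> inM I (A + B).
Proof. by move=> HA HB i j; rewrite mxE; apply: idealD. Qed.
Lemma inMN A : inM I A -> inM I (- A).
Proof. by move=> HA i j; rewrite mxE; apply: idealN. Qed.
Lemma inMZ a A : inM I A -> inM I (a *: A).
Proof. by move=> HA i j; rewrite mxE; apply: idealMl. Qed.
Lemma inMM_l A B : inM I B -> inM I (A *m B).
Proof. by move=> HB i j; rewrite mxE; apply: ideal_sum => // k _; apply: idealMl. Qed.
Lemma inMM_r A B : inM I A -> inM I (A *m B).
Proof. by move=> HB i j; rewrite mxE; apply: ideal_sum => // k _; apply: idealMr. Qed.
Lemma inM_scal a : I a -> inM I (a%:M).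
Proof.
by move=> Ia i j; rewrite mxE -mulr_natr; apply: idealMr.
Qed.
Lemma inM_tr A : inM I A -> I (\tr A).
Proof. by move=> HA; apply: ideal_sum => // i _. Qed.
Lemma inM_scale_l a (A : M) : I a -> inM I (a *: A).
Proof. by move=> Ia i j; rewrite mxE; apply: idealMr. Qed.

Lemma inMTD p q : inMT I p -> inMT I q -> inMT I (p + q).
Proof. by case=> ? ? [? ?]; split; [apply: inMD | apply: idealD]. Qed.
Lemma inMTN p : inMT I p -> inMT I (- p).
Proof. by case=> ? ?; split; [apply: inMN | apply: idealN]. Qed.
Lemma inMMD p q : inMM I p -> inMM I q -> inMM I (p + q).
Proof. by case=> ? ? [? ?]; split; apply: inMD. Qed.
Lemma inMMN p : inMM I p -> inMM I (- p).
Proof. by case=> ? ?; split; apply: inMN. Qed.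

Lemma gn2_in p : inMM I p -> inMT I (gn2 X p).
Proof.
case=> H1 H2; split; last by apply: idealB => //; apply: inM_tr.
by apply: inMD; [apply: inMM_r | apply: inMN; apply: inMM_l].
Qed.

Lemma gn3_in p : inMT I p -> inMM I (gn3 X p).
Proof.
case=> H1 H2; split; apply: inMD; try exact: inM_scal; first exact: inMM_l.
exact: inMM_r.
Qed.

Lemma gn4_in s : I s -> inMT I (gn4 X s).
Proof.
move=> Is; split; first exact: inM_scale_l.
by apply: idealN => //; apply: idealMr.
Qed.

End Fixed.

Section Fixed2.
Variable I : set T.
Hypothesis iI : is_ideal I.

(** The multipliers that make [z] a boundary modulo [I] form an ideal. It contains [I] and the
    squares of all minors, hence every [B] congruent modulo [I] to an element of [sqminors X]. *)
Lemma gn_kill (G0 G1 G2 : lmodType T) (d1 : G1 -> G0) (d2 : {linear G2 -> G1})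
    (P1 : set G1) z B :
  P1 0 -> (forall x y, P1 x -> P1 y -> P1 (x + y)) ->
  (forall a x, P1 x -> P1 (a *: x)) ->
  (forall a, I a -> P1 (a *: z)) ->
  (forall k l, exists y, P1 ((\adj X) k l ^+ 2 *: z - d2 y)) ->
  (exists2 B', sqminors B' & I (B - B')) ->
  exists y, P1 (B *: z - d2 y).
Proof.
move=> P10 P1D P1Z IP1 H [B' HB' IB].
set K := [set B : T | exists y, P1 (B *: z - d2 y)].
have iK : is_ideal K.
  split=> [|x y [u Hu] [v Hv]|a x [u Hu]].
  - by exists 0; rewrite scale0r linear0 subr0.
  - exists (u + v); rewrite scalerDl linearD opprD addrACA.
    exact: P1D.
  - exists (a *: u); rewrite -scalerA [d2 _]linearZ /= -scalerBr.
    exact: P1Z.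
have KI a : I a -> K a by move=> Ia; exists 0; rewrite linear0 subr0; apply: IP1.
apply: (@ideal_subr _ K B B') => //; first exact: KI.
apply: HB'; split=> // x [k [l ->]]; exact: H.
Qed.

Section Step.
Variable B : T.
Hypothesis kB : exists2 B', sqminors B' & I (B - B').
Hypothesis regB : nzd_mod I B.

Lemma inM_adjoin A : inM (adjoin I B) A -> exists A', inM I (A - B *: A').
Proof.
move=> H; pose g i j := projT1 (cid (H i j)).
exists (\matrix_(i, j) g i j) => i j; rewrite !mxE /g.
exact: (projT2 (cid (H i j))).
Qed.

Lemma inMT_adjoin p : inMT (adjoin I B) p -> exists p', inMT I (p - B *: p').
Proof. by case=> /inM_adjoin [A' HA'] [y Hy]; exists (A', y). Qed.

Lemma inMM_adjoin p : inMM (adjoin I B) p -> exists p', inMM I (p - B *: p').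
Proof. by case=> /inM_adjoin [A' HA'] /inM_adjoin [y Hy]; exists (A', y). Qed.

Lemma inM_reg A : inM I (B *: A) -> inM I A.
Proof. by move=> H i j; apply: regB; have := H i j; rewrite mxE. Qed.

(** Injectivity of the last map modulo [I] costs one regular element. Each earlier place costs one
    more, since its step assumes the next place modulo the larger ideal [adjoin I B]; hence four
    elements in all. *)
Lemma gn_step4 : gn_exact4 I.
Proof.
move=> s ds; apply: regB; case: kB => B' HB' IB.
have ID k l : I ((\adj X) k l ^+ 2 * s).
  rewrite (gn_homotopy4 X k l); apply: idealMl => //; apply: inM_tr => //.
  by apply: inMM_r => //; case: ds.
have iK : is_ideal [set b | I (b * s)].
  split=> [|x y Hx Hy|a x Hx] /=; first by rewrite mul0r; apply: ideal0.
    by rewrite mulrDl; apply: idealD.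
  by rewrite -mulrA; apply: idealMl.
apply: (@ideal_subr _ _ B B' iK); first exact: idealMr.
by apply: HB'; split=> // x [k [l ->]]; exact: ID.
Qed.

Let iI' := is_ideal_adjoin B iI.
Let sI' := @sub_adjoin _ I B iI.
Let mB : adjoin I B B := mem_adjoin B iI.

Lemma gn_step3 : gn_exact4 (adjoin I B) -> gn_exact3 I.
Proof.
move=> ex z dz.
(* Beyond [gn4] the complex continues with zero, so the incoming map is [fun=> 0]. *)
apply: (@exact_step (M * M)%type _ _ T^o (gn3 X) (gn4 X) (fun=> 0) (inMM I)
  (inMT I) (inMT (adjoin I B)) I (adjoin I B) B) => //.
- by move=> ?; rewrite linear0.
- exact: inMTD.
- exact: inMTN.
- by move=> x [Hx Hx']; split; [move=> i j|]; apply: sI'.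
- by move=> x; split; [exact: inM_scale_l|exact: idealMr].
- by move=> x y [? ?] [? ?]; split; [exact: inMD|exact: idealD].
- by move=> x [? ?]; split; [exact: inM_reg|exact: regB].
- exact: gn4_in.
- move=> z' dz'; apply: (@gn_kill (M * M)%type _ _ (gn3 X)) => //.
  + by split; [exact: inM0 | exact: ideal0].
  + exact: inMTD.
  + by move=> a x [? ?]; split; [exact: inMZ|exact: idealMl].
  + by move=> a Ia; split; [exact: inM_scale_l|exact: idealMr].
  move=> k l; exists (gh3 X k l z'); rewrite gn_homotopy3 addrC addKr.
  have [H1 H2] := dz'; split=> /=.
    apply: (inMD iI); last first.
      by apply/(inMN iI)/(inM_scale_l iI)/(inM_tr iI)/(inMM_r iI)/(inMM_l iI).
    by apply: (inMD iI);
      [exact/(inMZ iI)/(inMM_l iI) | exact/(inMM_r iI)/(inMM_l iI)].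
  by apply: idealMl => //; exact/(inM_tr iI)/(inMM_r iI)/(inMM_l iI).
- by move=> x /ex Hx; exists 0; rewrite subr0.
Qed.

Lemma gn_step2 : gn_exact3 (adjoin I B) -> gn_exact2 I.
Proof.
move=> ex z dz.
apply: (@exact_step (M * T^o)%type _ _ _ (gn2 X) (gn3 X) (gn4 X) (inMT I)
  (inMM I) (inMM (adjoin I B)) (inMT I) (inMT (adjoin I B)) B) => //.
- exact: gn34.
- exact: inMMD.
- exact: inMMN.
- by move=> x [Hx Hx']; split=> i j; apply: sI'.
- by move=> x; split; exact: inM_scale_l.
- by move=> x y [? ?] [? ?]; split; exact: inMD.
- by move=> x [? ?]; split; exact: inM_reg.
- exact: gn3_in.
- exact: inMT_adjoin.
- move=> z' dz'; apply: (@gn_kill (M * T^o)%type _ _ (gn2 X)) => //.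
  + by split; exact: inM0.
  + exact: inMMD.
  + by move=> a x [? ?]; split; exact: inMZ.
  + by move=> a Ia; split; exact: inM_scale_l.
  move=> k l; exists (gh2 X k l z'); rewrite gn_homotopy2 addrC addKr.
  have [H1 H2] := dz'; split=> /=; first exact/(inMM_r iI)/(inMM_l iI).
  apply: (inMD iI); first exact/(inMN iI)/(inMZ iI)/(inMM_l iI).
  apply: (inM_scale_l iI); apply: idealB => //; last exact: idealMl.
  exact/(inM_tr iI)/(inMM_l iI).
Qed.

Lemma gn_step1 : gn_exact2 (adjoin I B) -> gn_exact1 I.
Proof.
move=> ex z dz.
apply: (@exact_step T^o _ _ _ (gn1 X) (gn2 X) (gn3 X) I
  (inMT I) (inMT (adjoin I B)) (inMM I) (inMM (adjoin I B)) B) => //.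
- exact: gn23.
- exact: inMTD.
- exact: inMTN.
- by move=> x [Hx Hx']; split; [move=> i j|]; apply: sI'.
- by move=> x; split; [exact: inM_scale_l|exact: idealMr].
- by move=> x y [? ?] [? ?]; split; [exact: inMD|exact: idealD].
- by move=> x [? ?]; split; [exact: inM_reg|exact: regB].
- exact: gn2_in.
- exact: inMM_adjoin.
- move=> z' dz'; apply: (@gn_kill T^o _ _ (gn1 X)) => //.
  + by split; [exact: inM0 | exact: ideal0].
  + exact: inMTD.
  + by move=> a x [? ?]; split; [exact: inMZ|exact: idealMl].
  + by move=> a Ia; split; [exact: inM_scale_l|exact: idealMr].
  move=> k l; exists (gh1 X k l z'); rewrite (gn_homotopy1 X k l) addrC addKr.
  by split=> /=; [apply/(inM_scale_l iI)/(idealMl _ iI) | exact: ideal0].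
Qed.
End Step.
End Fixed2.
End Acyclicity.

Section TopForms.
Variables (n : nat) (T : comNzRingType).
Local Notation W := {mpoly T[n]}.
Implicit Types (p q : W) (I J : set W).

Definition comp (d : nat) (p : W) : W := pihomog mdeg d p.
(** The bound is strict, so that [dlt 0] characterizes zero and inductions on the degree end there;
    degree at most [d] is [dlt d.+1]. *)
Definition dlt (d : nat) (p : W) := forall m, m \in msupp p -> (mdeg m < d)%N.

Lemma mcoeff_comp d p m : (comp d p)@_m = if mdeg m == d then p@_m else 0.
Proof.
rewrite /comp pihomogE raddf_sum /= -big_filter.
transitivity (\sum_(m0 <- [seq i <- msupp p | mdeg i == d]) p@_m0 * (m0 == m)%:R).
  by apply: eq_bigr => m0 _; rewrite mcoeffZ mcoeffX.
rewrite big_filter big_mkcond /=; case: (boolP (m \in msupp p)) => mp.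
  rewrite (bigD1_seq m) //= eqxx mulr1 big1 ?addr0 // => m0 /negPf ->.
  by rewrite mulr0 if_same.
rewrite (memN_msupp_eq0 mp) if_same big_seq big1 // => m0 m0p.
case: eqP => [_|//]; case: eqP => [e|_]; last by rewrite mulr0.
by move: mp; rewrite -e m0p.
Qed.

Lemma compB d p q : comp d (p - q) = comp d p - comp d q.
Proof. exact: pihomogB. Qed.
Lemma compD d p q : comp d (p + q) = comp d p + comp d q.
Proof. exact: pihomogD. Qed.
Lemma comp0 d : comp d 0 = 0.
Proof. exact: pihomog0. Qed.
Lemma comp_homog d p : comp d p \is d.-homog.
Proof. exact: pihomogP. Qed.
Lemma homog_comp d p : p \is d.-homog -> comp d p = p.
Proof. exact: pihomog_dE. Qed.

Lemma dltP d p : dlt d p <-> forall m, (d <= mdeg m)%N -> p@_m = 0.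
Proof.
split=> H m; last by rewrite mcoeff_msupp; apply: contraNltn => /H ->.
by move=> dm; apply/memN_msupp_eq0; apply: contraTN dm => /H; rewrite ltnNge.
Qed.

Lemma dlt_exists p : exists d, dlt d p.
Proof. by exists (msize p) => m; apply: msize_mdeg_lt. Qed.
Lemma dlt_leq d e p : (d <= e)%N -> dlt d p -> dlt e p.
Proof. by move=> de H m /H /leq_trans; apply. Qed.
Lemma dlt0 p : dlt 0 p -> p = 0.
Proof. by move=> /dltP H; apply/mpolyP => m; rewrite H // mcoeff0. Qed.
Lemma dltD d p q : dlt d p -> dlt d q -> dlt d (p + q).
Proof. by move=> /dltP Hp /dltP Hq; apply/dltP => m dm; rewrite mcoeffD Hp ?Hq ?addr0. Qed.
Lemma dltN d p : dlt d p -> dlt d (- p).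
Proof. by move=> /dltP Hp; apply/dltP => m dm; rewrite mcoeffN Hp ?oppr0. Qed.
Lemma dltB d p q : dlt d p -> dlt d q -> dlt d (p - q).
Proof. by move=> Hp Hq; apply: dltD => //; apply: dltN. Qed.
Lemma dlt_top d p : dlt d.+1 p -> comp d p = 0 -> dlt d p.
Proof.
move=> /dltP Hp e; apply/dltP => m; rewrite leq_eqVlt => /orP[/eqP dm|]; last exact: Hp.
by have := mcoeff_comp d p m; rewrite e mcoeff0 -dm eqxx.
Qed.
Lemma dlt_sub d p q : dlt d.+1 p -> dlt d.+1 q -> comp d p = comp d q -> dlt d (p - q).
Proof. by move=> Hp Hq e; apply: dlt_top; [exact: dltB | rewrite compB e subrr]. Qed.
Lemma dlt_homog d p : p \is d.-homog -> dlt d.+1 p.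
Proof. by move=> /dhomogP H m /H ->. Qed.
Lemma dlt_comp d e p : dlt d p -> (d <= e)%N -> comp e p = 0.
Proof.
move=> /dltP H de; apply/mpolyP => m; rewrite mcoeff_comp mcoeff0.
by case: eqP => // dm; rewrite H // dm.
Qed.
Lemma dltM d e p q : dlt d.+1 p -> dlt e.+1 q -> dlt (d + e).+1 (p * q).
Proof.
move=> Hp Hq m /msuppM_le /allpairsP [[m1 m2] /= [H1 H2 ->]].
by rewrite mdegD ltnS leq_add // -ltnS; [apply: Hp | apply: Hq].
Qed.
Lemma dltM' d e p q : dlt d.+1 p -> dlt e q -> dlt (d + e) (p * q).
Proof.
move=> Hp Hq m /msuppM_le /allpairsP [[m1 m2] /= [H1 H2 ->]].
by rewrite mdegD -addnS leq_add //; [rewrite -ltnS; apply: Hp | apply: Hq].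
Qed.

Lemma comp_homogM d e p q : p \is d.-homog -> comp (d + e) (p * q) = p * comp e q.
Proof.
move=> Hp; have [N] := dlt_exists q; elim: N q => [|N IH] q Hq.
  by rewrite (dlt0 Hq) mulr0 !comp0 mulr0.
have H1 : dlt N (q - comp N q).
  apply: dlt_sub => //; first exact/dlt_homog/comp_homog.
  by rewrite (homog_comp (comp_homog _ _)).
rewrite -[q in LHS](subrK (comp N q)) mulrDr compD IH // compB mulrBr.
case: (eqVneq N e) => [->|ne].
  rewrite [X in _ + X]homog_comp ?(homog_comp (comp_homog e q)) ?subrK //.
  by apply: dhomogM => //; apply: comp_homog.
rewrite [X in _ - X + _](_ : _ = 0).
  rewrite subr0 [X in _ + X](_ : _ = 0) ?addr0 //.
  apply: (@pihomog_ne0 _ _ _ (d + N)); first by rewrite eqn_add2l.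
  by apply: dhomogM => //; apply: comp_homog.
by rewrite (_ : comp e _ = 0) ?mulr0 //; apply: (pihomog_ne0 ne); exact: comp_homog.
Qed.

Lemma comp_homogM0 d e p q : p \is d.-homog -> (e < d)%N -> comp e (p * q) = 0.
Proof.
move=> Hp ed; apply/mpolyP => m; rewrite mcoeff_comp mcoeff0; case: eqP => // me.
apply/memN_msupp_eq0; apply/negP => /msuppM_le /allpairsP [[m1 m2] /= [H1 H2 E]].
move: me; rewrite E mdegD (dhomogP _ _ _ Hp _ H1) => e1.
by move: ed; rewrite -e1 ltnNge leq_addr.
Qed.

Lemma compM d e p q : dlt d.+1 p -> dlt e.+1 q ->
  comp (d + e) (p * q) = comp d p * comp e q.
Proof.
move=> Hp Hq; have <- := comp_homogM e q (comp_homog d p).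
rewrite -[p in LHS](subrK (comp d p)) mulrDl compD.
rewrite [X in X + _](dlt_comp (d := d + e)) ?add0r //.
rewrite mulrC addnC; apply: dltM' => //; apply: dlt_sub => //.
  exact/dlt_homog/comp_homog.
by rewrite (homog_comp (comp_homog _ _)).
Qed.

(* [J] is the ideal of leading forms, for the degree, of the elements of [I]. *)
Definition initial I J :=
  [/\ forall d x, J x -> J (comp d x),
      forall d x, I x -> dlt d.+1 x -> J (comp d x) &
      forall d x, J x -> x \is d.-homog -> exists u, [/\ I u, dlt d.+1 u & comp d u = x]].

Lemma initial0 : initial [set 0] [set 0].
Proof.
split=> [d x -> /=|d x -> /=|d x -> _ /=]; rewrite ?comp0 //.
by exists 0; split=> //; rewrite ?comp0 // => m; rewrite msupp0.
Qed.

Section Step.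
Variables (I J : set W) (b tau : W) (e : nat).
Hypotheses (iI : is_ideal I) (iJ : is_ideal J) (IJ : initial I J).
Hypotheses (be : dlt e.+1 b) (btau : comp e b = tau) (regtau : nzd_mod J tau).

Lemma top_homog : tau \is e.-homog. Proof. by rewrite -btau; apply: comp_homog. Qed.

(** The leading form of [b * g] is [tau] times that of [g], so the latter lies in [J]; subtracting
    from [g] an element of [I] with the same leading form lowers the degree. *)
Lemma initial_reg : nzd_mod I b.
Proof.
move=> g; have [N] := dlt_exists g; elim: N g => [|N IH] g Hg Ibg.
  by rewrite (dlt0 Hg); apply: ideal0.
have [J1 J2 J3] := IJ.
have : J (comp N g).
  apply: regtau; rewrite -btau -compM //; apply: J2 => //; rewrite -addnS.
  exact: dltM'.
case/(J3 N) => [|u [Iu du eu]]; first exact: comp_homog.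
apply: (@ideal_subr _ I g u) => //; apply: IH; first exact: dlt_sub.
by rewrite mulrBr; apply: idealB => //; apply: idealMl.
Qed.

(** Writing an element as [b * g] modulo [I] may involve a [g] of too large a degree. Then [tau]
    times the top of [g] lies in [J], so the top itself does by regularity, and an element of [I]
    removes it. *)
Lemma initial_step : initial (adjoin I b) (adjoin J tau).
Proof.
have [J1 J2 J3] := IJ.
have comp_tau D y : exists y', comp D (tau * y) = tau * y'.
  case: (leqP e D) => eD; last by exists 0; rewrite mulr0 (comp_homogM0 _ top_homog).
  by exists (comp (D - e) y); rewrite -(@comp_homogM e _ _ y top_homog) subnKC.
split=> [D x [y Hy]|D x [g Hg] dx|D x [y Hy] hx].
- have [y' Ey] := comp_tau D y; exists y'.
  by rewrite -Ey -compB; apply: J1.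
- have [N] := dlt_exists g; elim: N g Hg => [|N IH] g Hg dg.
    exists 0; rewrite mulr0 subr0; apply: J2 => //.
    by move: Hg; rewrite (dlt0 dg) mulr0 subr0.
  case: (leqP (e + N) D) => eND.
    have dbg : dlt D.+1 (b * g).
      by apply: (@dlt_leq (e + N.+1)); [rewrite addnS | apply: dltM'].
    have := J2 D _ Hg (dltB dx dbg); rewrite compB.
    case: (eqVneq (e + N)%N D) => [<-|ne]; first by rewrite compM // btau => ?; exists (comp N g).
    rewrite (@dlt_comp (e + N.+1) D (b * g)); last by rewrite addnS ltn_neqAle ne eND.
      by rewrite subr0 => ?; exists 0; rewrite mulr0 subr0.
    exact: dltM'.
  have ds : dlt (e + N).+1 (x - b * g).
    by apply: dltB; [apply: (@dlt_leq D.+1) => //; exact: ltnW | rewrite -addnS; apply: dltM'].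
  have := J2 _ _ Hg ds; rewrite compB (dlt_comp dx) // sub0r compM // btau.
  move/(idealN iJ); rewrite opprK => /regtau /(J3 N) [|u [Iu du eu]].
    exact: comp_homog.
  apply: (IH (g - u)); last exact: dlt_sub.
  rewrite (_ : x - b * (g - u) = x - b * g + b * u); last by ring.
  by apply: idealD => //; apply: idealMl.
- have := J1 D _ Hy; rewrite compB (homog_comp hx).
  case: (leqP e D) => eD; last first.
    rewrite (comp_homogM0 _ top_homog) // subr0 => /J3 /(_ hx) [u [Iu du eu]].
    by exists u; split=> //; apply: sub_adjoin.
  rewrite -{1}(subnKC eD) comp_homogM; last exact: top_homog.
  have hy := comp_homog (D - e) y; move: (comp _ y) hy => y' hy'.
  have hty : tau * y' \is D.-homog.
    by rewrite -[D](subnKC eD); apply: dhomogM => //; apply: top_homog.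
  case/(J3 D) => [|u [Iu du eu]]; first exact: rpredB.
  have dy := dlt_homog hy'.
  exists (u + b * y'); split.
  + by exists y'; rewrite addrK.
  + by apply: dltD => //; rewrite -[D](subnKC eD); apply: dltM.
  + rewrite compD eu -[X in comp X (b * y')](subnKC eD) compM // btau.
    by rewrite (homog_comp hy') subrK.
Qed.
End Step.
End TopForms.

(** * Ideals generated by powers of variables *)

Section Monomials.
Variables (n : nat) (T : comNzRingType).
Local Notation W := {mpoly T[n]}.
Implicit Types (p q x y : W) (L : seq ('I_n * nat)) (m : 'X_{1..n}).

(** The ideal generated by the powers ['X_i ^+ e] with [(i, e)] in [L], described through supports:
    membership is checked monomial by monomial, which makes the regularity of a further variable
    visible. *)
Definition mon_ideal L : set W :=
  [set x | forall m, m \in msupp x -> has (fun ie => (ie.2 <= m ie.1)%N) L].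

Lemma is_ideal_mon L : is_ideal (mon_ideal L).
Proof.
split=> [m|x y Hx Hy m|a x Hx m]; first by rewrite msupp0.
  by move=> /msuppD_le; rewrite mem_cat => /orP[/Hx|/Hy].
move=> /msuppM_le /allpairsP [[m1 m2] /= [H1 /Hx /hasP[ie ieL le] ->]].
by apply/hasP; exists ie => //; rewrite mnmDE (leq_trans le) ?leq_addl.
Qed.

Lemma mon_ideal_nil : mon_ideal [::] = [set 0].
Proof.
apply/seteqP; split=> x /=; last by move=> -> m; rewrite msupp0.
move=> H; apply/eqP; rewrite -msupp_eq0; case e: (msupp x) => [|m s] //.
by have := H m; rewrite e mem_head => /(_ isT).
Qed.

Lemma mcoeff_Xpow i (E : nat) y m : (E <= m i)%N ->
  ('X_i ^+ E * y)@_m = y@_(m - U_(i) *+ E).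
Proof.
move=> Em; have e : m = (U_(i) *+ E + (m - U_(i) *+ E))%MM.
  apply/mnmP => j; rewrite mnmDE mnmBE mulmnE mnm1E.
  by case: eqP => [<-|]; rewrite ?mul1n ?subnKC ?mul0n ?add0n ?subn0.
by rewrite {1}e mulrC mpolyXn mcoeffMX.
Qed.

Lemma mcoeff_Xpow0 i (E : nat) y m : ~~ (E <= m i)%N -> ('X_i ^+ E * y)@_m = 0.
Proof.
move=> Em; apply/memN_msupp_eq0; apply: contra Em => /msuppM_le.
case/allpairsP => [[m1 m2] /= [H1 H2 ->]].
move: H1; rewrite mpolyXn msuppX inE => /eqP ->.
by rewrite mnmDE mulmnE mnm1E eqxx mul1n leq_addr.
Qed.

Lemma mon_adjoin L i E : adjoin (mon_ideal L) ('X_i ^+ E) = mon_ideal ((i, E) :: L).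
Proof.
apply/seteqP; split=> x.
  case=> y Hy m mx /=; case: (boolP (E <= m i)%N) => //= Em; apply: Hy.
  by rewrite mcoeff_msupp mcoeffB mcoeff_Xpow0 // subr0 -mcoeff_msupp.
move=> H; pose y := \sum_(m <- msupp x | (E <= m i)%N) x@_m *: 'X_[m - U_(i) *+ E].
exists y; have -> : x - 'X_i ^+ E * y = \sum_(m <- msupp x | ~~ (E <= m i)%N) x@_m *: 'X_[m].
  apply/eqP; rewrite subr_eq [x in X in X == _]mpolyE (bigID (fun m : 'X_{1..n} => (E <= m i)%N)) /= addrC.
  apply/eqP; congr (_ + _); rewrite mulr_sumr; apply: eq_bigr => m Em.
  rewrite -scalerAr mpolyXn -mpolyXD; congr (_ *: 'X_[_]).
  apply/mnmP => j; rewrite mnmDE mnmBE mulmnE mnm1E.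
  by case: eqP => [<-|]; rewrite ?mul1n ?subnKC ?mul0n ?add0n ?subn0.
rewrite big_seq_cond; apply: ideal_sum; first exact: is_ideal_mon.
move=> m /andP[mx /negPf Em] m' /(msuppZ_le) ; rewrite msuppX inE => /eqP ->.
by have := H m mx; rewrite /= Em.
Qed.

Lemma mon_reg L i E : i \notin [seq ie.1 | ie <- L] -> nzd_mod (mon_ideal L) ('X_i ^+ E).
Proof.
move=> iL x H m mx.
have := H (U_(i) *+ E + m)%MM; rewrite mcoeff_msupp mcoeff_Xpow; last first.
  by rewrite mnmDE mulmnE mnm1E eqxx mul1n leq_addr.
rewrite addmC addmK -mcoeff_msupp => /(_ mx) /hasP[ie ieL le].
apply/hasP; exists ie => //; move: le; rewrite mnmDE mulmnE mnm1E.
case: eqP => [e|_]; last by rewrite mul0n addn0.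
by case/negP: iL; rewrite e; apply: map_f.
Qed.
End Monomials.

Lemma adjE (R : comNzRingType) p (A : 'M[R]_p) i j : (\adj A) i j = cofactor A j i.
Proof. by rewrite mxE. Qed.

(** * Leading forms of determinants and adjugates *)

Section TopDet.
Variables (n : nat) (T : comNzRingType).
Local Notation W := {mpoly T[n]}.

Lemma dlt_sum (A : Type) (r : seq A) (P : pred A) d (F : A -> W) :
  (forall i, P i -> dlt d (F i)) -> dlt d (\sum_(i <- r | P i) F i).
Proof. by move=> H; elim/big_ind: _ => //; [move=> m; rewrite msupp0 | apply: dltD]. Qed.

Lemma top_prod p (F G : 'I_p -> W) :
  (forall i, dlt 2 (F i)) -> (forall i, comp 1 (F i) = G i) ->
  dlt p.+1 (\prod_i F i) /\ comp p (\prod_i F i) = \prod_i G i.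
Proof.
move=> HF HG; elim: p F G HF HG => [|p IH] F G HF HG.
  rewrite !big_ord0; split; first by move=> m; rewrite msupp1 inE => /eqP ->; rewrite mdeg0.
  by apply: homog_comp; apply: dhomog1.
rewrite !big_ord_recr /=.
have [H1 H2] := IH (fun i => F (widen_ord (leqnSn p) i)) (fun i => G (widen_ord (leqnSn p) i))
  (fun i => HF _) (fun i => HG _).
have := compM H1 (HF ord_max); have := dltM H1 (HF ord_max).
by rewrite addn1 H2 HG.
Qed.

Lemma sgn_homog (b : nat) : ((-1) ^+ b : W) \is 0.-homog.
Proof.
by rewrite -signr_odd; case: odd; rewrite /= ?expr0 ?expr1 ?rpredN; exact: dhomog1.
Qed.

Lemma top_sgn (b d : nat) (x y : W) : dlt d.+1 x -> comp d x = y ->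
  dlt d.+1 ((-1) ^+ b * x) /\ comp d ((-1) ^+ b * x) = (-1) ^+ b * y.
Proof.
move=> dx cx; split; last by rewrite -[d]add0n (comp_homogM _ _ (sgn_homog b)) cx.
by rewrite -[d]add0n; apply: dltM => //; apply: dlt_homog; apply: sgn_homog.
Qed.

Lemma top_det p (A B : 'M[W]_p) :
  (forall i j, dlt 2 (A i j)) -> (forall i j, comp 1 (A i j) = B i j) ->
  dlt p.+1 (\det A) /\ comp p (\det A) = \det B.
Proof.
move=> HA HB.
have H (s : {perm 'I_p}) := @top_prod p (fun i => A i (s i)) (fun i => B i (s i))
  (fun i => HA _ _) (fun i => HB _ _).
have H' (s : {perm 'I_p}) := top_sgn s (H s).1 (H s).2.
split; first by apply: dlt_sum => s _; case: (H' s).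
by rewrite /comp raddf_sum; apply: eq_bigr => s _; have [_ <-] := H' s.
Qed.

Lemma top_adj p (A B : 'M[W]_p.+1) :
  (forall i j, dlt 2 (A i j)) -> (forall i j, comp 1 (A i j) = B i j) ->
  forall i j, dlt p.+1 ((\adj A) i j) /\ comp p ((\adj A) i j) = (\adj B) i j.
Proof.
move=> HA HB i j.
have [H1 H2] : dlt p.+1 (\det (row' j (col' i A))) /\
    comp p (\det (row' j (col' i A))) = \det (row' j (col' i B)).
  by apply: top_det => a b; rewrite mxE [col' _ _ _ _]mxE; [exact: HA | rewrite HB !mxE].
have := top_sgn (j + i) H1 H2.
rewrite -/(cofactor A j i).
rewrite -/(cofactor B j i).
rewrite -(adjE A).
rewrite -(adjE B).
by [].
Qed.

(** The condition bears on every homogeneous component, zero components included, so that the set is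
    a homogeneous ideal for any ideal [I]; [initial] compares two ideals that are already given. *)
Definition leading (I : set W) : set W :=
  [set x | forall d, exists u, [/\ I u, dlt d.+1 u & comp d u = comp d x]].

Lemma is_ideal_leading I : is_ideal I -> is_ideal (leading I).
Proof.
move=> iI; have z : leading I 0.
  by move=> d; exists 0; split=> //; [exact: ideal0 | move=> m; rewrite msupp0].
have D x y : leading I x -> leading I y -> leading I (x + y).
  move=> Hx Hy d; have [u [Iu du eu]] := Hx d; have [v [Iv dv ev]] := Hy d.
  by exists (u + v); split; [exact: idealD | exact: dltD | rewrite !compD eu ev].
split=> // a x Hx; have [N] := dlt_exists a; elim: N a => [|N IH] a Ha.
  by rewrite (dlt0 Ha) mul0r.
have hN := comp_homog N a.
rewrite -(subrK (comp N a) a) mulrDl; apply: D.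
  apply: IH; apply: dlt_sub => //; first exact: dlt_homog.
  by rewrite (homog_comp hN).
move: (comp N a) hN => b hb d; case: (leqP N d) => Nd; last first.
  exists 0; split; [exact: ideal0 | by move=> m; rewrite msupp0 |].
  by rewrite (comp_homogM0 _ hb) // comp0.
have [u [Iu du eu]] := Hx (d - N)%N; exists (b * u); split.
- exact: idealMl.
- by rewrite -(subnKC Nd); apply: dltM => //; apply: dlt_homog.
- by rewrite -[X in comp X](subnKC Nd) !comp_homogM // eu.
Qed.

Lemma leading_homog I x d : leading I x -> x \is d.-homog ->
  exists u, [/\ I u, dlt d.+1 u & comp d u = x].
Proof. by move=> H hx; have [u [? ? e]] := H d; exists u; split=> //; rewrite e homog_comp. Qed.

Lemma sub_leading I (u : W) d : is_ideal I -> I u -> dlt d.+1 u -> leading I (comp d u).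
Proof.
move=> iI Iu du e; case: (eqVneq e d) => [->|ne].
  by exists u; rewrite (homog_comp (comp_homog _ _)).
exists 0; split; [exact: ideal0 | by move=> m; rewrite msupp0 |].
by rewrite comp0; apply/esym/(pihomog_ne0 (d := d)); [rewrite eq_sym | exact: comp_homog].
Qed.
End TopDet.

(** * A band matrix whose minors make four variables nilpotent *)

Section Band.
Variables (T : comNzRingType) (n : nat).
Local Notation W := {mpoly T[5]}.
Local Notation zu := ('X_(@Ordinal 5 0 isT) : W).
Local Notation zv := ('X_(@Ordinal 5 1 isT) : W).
Local Notation zs := ('X_(@Ordinal 5 2 isT) : W).
Local Notation zt := ('X_(@Ordinal 5 3 isT) : W).
Local Notation zw := ('X_(@Ordinal 5 4 isT) : W).

(** The entries [zs + zt *+ i] of the main diagonal differ by integer multiples of [zt], which lets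
    the principal minors force both [zs] and [zt] into the radical. The second superdiagonal [zw],
    switched on by [lam], becomes the diagonal of the block of the first [n] rows and columns in the
    original order of columns. *)
Definition band (lam : bool) (i p : nat) : W :=
  if p == i then zs + zt *+ i
  else if p == i.+1 then zv
  else if p.+1 == i then zu
  else if p == i.+2 then zw *+ lam
  else 0.

(* A cyclic shift of the columns moves the last two columns to the front; in
   the new position the matrix is banded, and its two last diagonal entries
   of the old position lie on a common diagonal of the band. *)
Definition colpos (j : nat) := if (j < n)%N then j.+2 else (j - n)%N.
Definition poscol (p : nat) : 'I_n.+2 := inord (if (p < 2)%N then n + p else p - 2)%N.

Lemma colposK p : (p < n.+2)%N -> colpos (poscol p) = p.
Proof.
move=> pn; rewrite /poscol /colpos inordK; last by case: ifP; lia.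
by case: (ltnP p 2) => p2; case: ifP; lia.
Qed.

Definition band_mx lam : 'M[W]_n.+2 := \matrix_(i, j) band lam i (colpos j).

(** For [n] positive the two positions lie off the main diagonal, whose entries vary. This equality
    makes the translation of [GC] by the band respect the repeated variable. *)
Lemma band_diag lam : (0 < n)%N -> band lam n (colpos n) = band lam n.+1 (colpos n.+1).
Proof.
move=> n0; rewrite /band /colpos !ltnn ltnNge leqnSn /= subnn subSnn.
by case: n n0 => [//|[|n']].
Qed.

Lemma band_homog lam i p : band lam i p \is 1.-homog.
Proof.
have X1 k : ('X_k : W) \is 1.-homog by rewrite dhomogX /= mdeg1.
rewrite /band; do !case: ifP => _ //; rewrite ?rpredD ?rpredMn //.
exact: rpred0.
Qed.

Hypothesis natU : forall a, exists b : T, a.+1%:R * b = 1.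

Section Radical.
Variables (Q : set W) (lam : bool).
Hypotheses (iQ : is_ideal Q) (radQ : forall x a, Q (x ^+ a) -> Q x).
Hypotheses (QA : forall i j, Q ((\adj (band_mx lam)) i j)) (Qw : Q (zw *+ lam)).

Lemma band_minor (f g : 'I_n.+1 -> nat) (B : 'M[W]_n.+1) :
  (forall i, (f i < n.+2)%N) -> (forall i, (g i < n.+2)%N) ->
  (forall i j, Q (band lam (f i) (g j) - B i j)) -> Q (\det B).
Proof.
move=> Hf Hg H.
have := @ideal_minor _ Q _ (band_mx lam) (fun i => inord (f i)) (fun j => poscol (g j)) iQ QA.
apply: ideal_subl => //; apply: ideal_det_congr => // i j.
by rewrite !mxE inordK // colposK.
Qed.

(** Deleting the last row and, in the shifted order, the first column leaves [zv] on the diagonal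
    and above it only [zw *+ lam], which lies in [Q]. *)
Lemma band_zv : Q zv.
Proof.
apply: (@radQ _ n.+1).
have := @band_minor (fun i => i) (fun j => j.+1)
  (\matrix_(i, j) band false i j.+1).
have -> : \det (\matrix_(i < n.+1, j < n.+1) band false i j.+1) = zv ^+ n.+1.
  rewrite det_trig; last first.
    apply/is_trig_mxP => i j ij; rewrite mxE /band /=.
    by do !case: eqP => //; lia.
  under eq_bigr => i _ do rewrite mxE /band eqxx (gtn_eqF (ltnSn _)).
  by rewrite prodr_const card_ord.
apply=> [i|i|i j]; [exact: leqW (ltn_ord i)|exact: (ltn_ord i)|].
rewrite mxE /band; do !case: ifP => _; rewrite ?subrr ?mulr0n ?subr0 //; exact: ideal0.
Qed.

Lemma band_zu : Q zu.
Proof.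
apply: (@radQ _ n.+1).
have := @band_minor (fun i => i.+1) (fun j => j)
  (\matrix_(i, j) band lam i.+1 j).
have -> : \det (\matrix_(i < n.+1, j < n.+1) band lam i.+1 j) = zu ^+ n.+1.
  rewrite -det_tr det_trig; last first.
    apply/is_trig_mxP => i j ij; rewrite !mxE /band /=.
    by do !case: eqP => //; lia.
  under eq_bigr => i _ do rewrite !mxE /band eqxx (ltn_eqF (ltnSn _)) (ltn_eqF (leqW (ltnSn _))).
  by rewrite prodr_const card_ord.
apply=> [i|i|i j]; [exact: (ltn_ord i)|exact: leqW (ltn_ord i)|].
rewrite mxE subrr; exact: ideal0.
Qed.

Lemma band_diag_minor (a : 'I_n.+2) : Q (\prod_(i < n.+1) (zs + zt *+ (lift a i))).
Proof.
have := @band_minor (fun i => lift a i) (fun j => lift a j)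
  (diag_mx (\row_i (zs + zt *+ (lift a i)))).
rewrite det_diag; under eq_bigr => i _ do rewrite mxE.
apply=> [i|i|i j]; [exact: ltn_ord|exact: ltn_ord|].
rewrite !mxE /band; case: (eqVneq i j) => [<-|ne].
  by rewrite eqxx mulr1n subrr; apply: ideal0.
rewrite mulr0n subr0; case: ifP => [/eqP/val_inj/lift_inj e|_]; first by rewrite e eqxx in ne.
case: ifP => _; first exact: band_zv.
case: ifP => _; first exact: band_zu.
case: ifP => _ //; exact: ideal0.
Qed.

Let d (l : nat) : W := zs + zt *+ l.
Let tail (a : nat) : W := \prod_(a <= l < n.+2) d l.

Lemma band_tail (a : nat) : (a < n.+2)%N ->
  Q ((\prod_(0 <= l < a) d l) * tail a.+1).
Proof.
move=> an; have := band_diag_minor (Ordinal an).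
rewrite -(big_mkord xpredT (fun i => zs + zt *+ bump a i)) /=.
rewrite (big_cat_nat (n := a)) //= /tail big_add1 /=.
rewrite (@eq_big_nat _ _ _ 0 a _ d) => [|l /andP[_ la]]; last first.
  by rewrite /d /bump leqNgt la.
rewrite (@eq_big_nat _ _ _ a n.+1 _ (fun l => d l.+1)) // => l /andP[la _].
by rewrite /d /bump la.
Qed.

Lemma unit_nat_ideal (I : set W) (a : nat) x : is_ideal I ->
  I (a.+1%:R * x) -> I x.
Proof.
move=> iI; have [b Hb] := natU a => /(idealMl b%:MP iI).
by rewrite mulrA -mpolyC_nat -mpolyCM mulrC -mulrC [b * _]mulrC Hb mpolyC1 mul1r.
Qed.

(** Factors are removed from [tail] one at a time. Modulo the elements that multiply
    [zt * tail a.+1] into [Q], the factor [d a] vanishes, so [d l] becomes an invertible multiple of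
    [zt] for every [l < a]. The principal minor omitting [a] then puts a power of [zt] in that
    ideal, and radicality of [Q] absorbs the exponent. *)
Lemma band_zt : Q zt.
Proof.
suff H a : (1 <= a)%N -> (a <= n.+2)%N -> Q (zt * tail a).
  by have := H n.+2 isT (leqnn _); rewrite /tail big_geq // mulr1.
elim: a => // a IH _ an.
have [-> |a0] := posnP a.
  by have := @band_tail 0 isT; rewrite big_geq // mul1r => /(idealMl zt iQ).
have {IH} Hd := IH a0 (ltnW an).
set y := zt * tail a.+1.
pose I := [set x | Q (x * y)].
have iI : is_ideal I.
  split=> [|u v Hu Hv|c u Hu]; rewrite /I /= ?mul0r ?mulrDl -?mulrA.
  - exact: ideal0.
  - exact: idealD.
  - exact: idealMl.
have Ida : I (d a).
  by move: Hd; rewrite /tail big_ltn // /I /= /y mulrCA.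
have Ip : I (\prod_(0 <= l < a) d l).
  by rewrite /I /= /y mulrCA; apply: idealMl => //; apply: band_tail.
have {Ip} Ip : I (\prod_(0 <= l < a) (- zt * (a - l)%:R)).
  apply: ideal_subl Ip => //; rewrite !big_mkord; apply: ideal_prod_congr => // l.
  have -> : d l - - zt * (a - l)%:R = d a.
    by rewrite /d mulNr opprK mulr_natr -addrA -mulrnDr subnKC // ltnW.
  by [].
have Iz : I ((- zt) ^+ a).
  move: Ip; rewrite big_split /= prodr_const_nat subn0 mulrC.
  have : all (fun l => l < a)%N (index_iota 0 a).
    by apply/allP => l; rewrite mem_index_iota.
  elim: (index_iota _ _) => [_|l r IHr /= /andP[la ra]]; first by rewrite big_nil mul1r.
  rewrite big_cons -mulrA -[(a - l)%N]prednK ?subn_gt0 //.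
  by move=> /(unit_nat_ideal iI); apply: IHr.
apply: (@radQ _ a.+1); rewrite exprS /y exprMn.
have e2 : (-1) ^+ a * (-1) ^+ a = 1 :> W by rewrite -exprMn mulN1r opprK expr1n.
have -> : zt * tail a.+1 * (zt ^+ a * tail a.+1 ^+ a)
  = ((-1) ^+ a * tail a.+1 ^+ a) * ((- zt) ^+ a * (zt * tail a.+1)).
  rewrite [(- zt) ^+ a]exprNn; move: e2; move: ((-1) ^+ a) (zt ^+ a) => e Z e2.
  move: (tail _) (tail _ ^+ a) => tl P.
  by rewrite -[LHS]mul1r -e2; ring.
exact: idealMl.
Qed.

Lemma band_zs : Q zs.
Proof.
apply: (@radQ _ n.+1); have := band_diag_minor ord0.
apply: ideal_subl => //.
have -> : zs ^+ n.+1 = \prod_(i < n.+1) zs by rewrite prodr_const card_ord.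
apply: ideal_prod_congr => // i; rewrite addrC addKr -mulr_natr.
by apply: idealMr => //; apply: band_zt.
Qed.
End Radical.
End Band.

(** * Exactness after the deformation by the band *)

Section Deformation.
Variables (T : comNzRingType) (n : nat) (X : 'M[T]_n.+2).
Hypothesis natU : forall a, exists b : T, a.+1%:R * b = 1.
Local Notation W := {mpoly T[5]}.
Local Notation v0 := (@Ordinal 5 0 isT).
Local Notation v1 := (@Ordinal 5 1 isT).
Local Notation v2 := (@Ordinal 5 2 isT).
Local Notation v3 := (@Ordinal 5 3 isT).
Local Notation v4 := (@Ordinal 5 4 isT).

Definition deform (lam : bool) : 'M[W]_n.+2 :=
  map_mx (@mpolyC 5 T) X + band_mx T n lam.

Definition corner_minor (R : comNzRingType) (A : 'M[R]_n.+2) : R :=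
  \det (mxsub (widen_ord (leq_addl 2 n)) (widen_ord (leq_addl 2 n)) A).

Lemma top_sqr d (x y : W) : dlt d.+1 x -> comp d x = y ->
  dlt (d + d).+1 (x ^+ 2) /\ comp (d + d) (x ^+ 2) = y ^+ 2.
Proof. by move=> dx <-; rewrite !expr2; split; [apply: dltM | apply: compM]. Qed.

Lemma deform_dlt lam i j : dlt 2 (deform lam i j).
Proof.
rewrite !mxE; apply: dltD; last exact/dlt_homog/band_homog.
by move=> m; rewrite msuppC; case: ifP => // _; rewrite inE => /eqP ->; rewrite mdeg0.
Qed.

Lemma deform_comp lam i j : comp 1 (deform lam i j) = band_mx T n lam i j.
Proof.
rewrite !mxE compD (homog_comp (band_homog _ _ _ _)) (_ : comp 1 _ = 0) ?add0r //.
apply/mpolyP => m; rewrite mcoeff_comp mcoeff0 mcoeffC; case: eqP => // e.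
by case: eqP => [e0|_]; [rewrite e0 mdeg0 in e | rewrite mulr0].
Qed.

Lemma corner_top : dlt n.+1 (corner_minor (deform true)) /\
  comp n (corner_minor (deform true)) = 'X_v4 ^+ n.
Proof.
have -> : 'X_v4 ^+ n = corner_minor (band_mx T n true).
  rewrite /corner_minor det_trig.
    rewrite (eq_bigr (fun=> 'X_v4)) ?prodr_const ?card_ord // => i _.
    rewrite !mxE /band /colpos /= ltn_ord eqxx mulr1n.
    by do !case: eqP => //; lia.
  apply/is_trig_mxP => i j ij; rewrite !mxE /band /colpos /= ltn_ord.
  by do !case: eqP => //; lia.
apply: top_det => i j; rewrite mxE; first exact: deform_dlt.
by rewrite deform_comp [RHS]mxE.
Qed.

Section Chain.
Variables (lam : bool) (I0 : set W) (L : seq ('I_5 * nat)).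
Hypotheses (iI0 : is_ideal I0) (IJ : initial I0 (@mon_ideal 5 T L)).
Hypothesis Lv : all (fun ie => ie.1 == v4) L.
Hypothesis Hw : lam -> exists c, [/\ I0 c, dlt n.+1 c & comp n c = 'X_v4 ^+ n].
Let XW := deform lam.

Let K : set W := [set x | exists2 x', sqminors XW x' & I0 (x - x')].
Let iK : is_ideal K.
Proof.
have iS := is_ideal_sqminors XW.
split=> [|x y [x' Sx Ix] [y' Sy Iy]|a x [x' Sx Ix]].
- by exists 0; [exact: (ideal0 iS) | rewrite subr0; exact: ideal0].
- by exists (x' + y'); [exact: (idealD iS) | rewrite opprD addrACA; exact: idealD].
- by exists (a * x'); [exact: (idealMl _ iS) | rewrite -mulrBr; exact: idealMl].
Qed.

Lemma sub_IK : I0 `<=` K.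
Proof.
by move=> x Ix; exists 0; [exact: (ideal0 (is_ideal_sqminors XW)) | rewrite subr0].
Qed.

(** The minors of the band matrix are the parts of top degree of those of [XW], so the radical of
    [leading K] contains whatever the minors of the band force into a radical ideal. When [lam]
    holds, [zw] comes from the element of [I0] in [Hw]. *)
Lemma power_leading : exists E0 E1 E2 E3 : nat,
  [/\ leading K ('X_v0 ^+ E0), leading K ('X_v1 ^+ E1),
      leading K ('X_v2 ^+ E2) & leading K ('X_v3 ^+ E3)].
Proof.
have iL := is_ideal_leading iK.
have iQ := is_ideal_radical iL.
have QA i j : radical (leading K) ((\adj (band_mx T n lam)) i j).
  have [d1 c1] := top_adj (@deform_dlt lam) (@deform_comp lam) i j.
  have [d2 c2] := top_sqr d1 c1; exists 2%N; rewrite -c2; apply: sub_leading => //.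
  exists ((\adj XW) i j ^+ 2); last by rewrite subrr; apply: ideal0.
  exact: mem_sqminors.
have Qw : radical (leading K) ('X_v4 *+ lam).
  case: (lam) Hw => [/(_ isT) [c [Ic dc cc]]|_]; last first.
    by rewrite mulr0n; apply: ideal0.
  rewrite mulr1n; exists n; rewrite -cc; apply: sub_leading => //; exact: sub_IK.
have radQ x a := @radical_exp _ _ x a iL.
have [E0 H0] := band_zu iQ radQ QA.
have [E1 H1] := band_zv iQ radQ QA Qw.
have [E2 H2] := band_zs natU iQ radQ QA Qw.
have [E3 H3] := band_zt natU iQ radQ QA Qw.
by exists E0, E1, E2, E3.
Qed.

Lemma chain_exact :
  [/\ gn_exact1 XW I0, gn_exact2 XW I0, gn_exact3 XW I0 & gn_exact4 XW I0].
Proof.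
have [E0 [E1 [E2 [E3 [H0 H1 H2 H3]]]]] := power_leading.
have hX i E : ('X_i ^+ E : W) \is E.-homog.
  by rewrite mpolyXn dhomogX /= mdegMn mdeg1 mul1n.
have [b0 [K0 d0 t0]] := leading_homog H0 (hX _ _).
have [b1 [K1 d1 t1]] := leading_homog H1 (hX _ _).
have [b2 [K2 d2 t2]] := leading_homog H2 (hX _ _).
have [b3 [K3 d3 t3]] := leading_homog H3 (hX _ _).
have notL v : v != v4 -> v \notin [seq ie.1 | ie <- L].
  by move=> nv; apply/negP => /mapP[ie /(allP Lv) /eqP -> e]; rewrite e eqxx in nv.
have iM := @is_ideal_mon 5 T.
have step I L' b v E : is_ideal I -> initial I (@mon_ideal 5 T L') ->
    dlt E.+1 b -> comp E b = 'X_v ^+ E -> v \notin [seq ie.1 | ie <- L'] ->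
    [/\ is_ideal (adjoin I b), nzd_mod I b & initial (adjoin I b) (@mon_ideal 5 T ((v, E) :: L'))].
  move=> iI IJ' db cb nv; have reg := @mon_reg 5 T L' v E nv.
  split; [exact: is_ideal_adjoin | exact: (initial_reg iI IJ' db cb reg) |].
  rewrite -mon_adjoin; exact: (initial_step iI (iM _) IJ' db cb reg).
have [iI1 r0 J1] := step _ _ _ _ _ iI0 IJ d0 t0 (notL v0 isT).
have [|iI2 r1 J2] := step _ _ _ _ _ iI1 J1 d1 t1; first by rewrite inE negb_or; apply/andP; split=> //; exact: notL.
have [|iI3 r2 J3] := step _ _ _ _ _ iI2 J2 d2 t2; first by rewrite !inE !negb_or; do !(apply/andP; split=> //); exact: notL.
have [|iI4 r3 _] := step _ _ _ _ _ iI3 J3 d3 t3; first by rewrite !inE !negb_or; do !(apply/andP; split=> //); exact: notL.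
have kill I b : I0 `<=` I -> K b -> exists2 B', sqminors XW B' & I (b - B').
  by move=> sI [B' SB IB]; exists B' => //; apply: sI.
have s1 : I0 `<=` adjoin I0 b0 by apply: sub_adjoin.
have s2 : I0 `<=` adjoin (adjoin I0 b0) b1.
  by apply: (subset_trans s1); apply: sub_adjoin.
have s3 : I0 `<=` adjoin (adjoin (adjoin I0 b0) b1) b2.
  by apply: (subset_trans s2); apply: sub_adjoin.
have k0 := kill _ _ (@subset_refl _ _) K0; have k1 := kill _ _ s1 K1.
have k2 := kill _ _ s2 K2; have k3 := kill _ _ s3 K3.
(* In these names the first digit is the place in the complex and the second the number of elements
   adjoined; a place is deduced from the next place with one more element. *)
have e43 := gn_step4 iI3 k3 r3; have e42 := gn_step4 iI2 k2 r2.
have e41 := gn_step4 iI1 k1 r1; have e40 := gn_step4 iI0 k0 r0.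
have e32 := gn_step3 iI2 k2 r2 e43; have e31 := gn_step3 iI1 k1 r1 e42.
have e30 := gn_step3 iI0 k0 r0 e41.
have e21 := gn_step2 iI1 k1 r1 e32; have e20 := gn_step2 iI0 k0 r0 e31.
by split=> //; exact: (gn_step1 iI0 k0 r0 e21).
Qed.
End Chain.

Lemma deform_exact : let XW := deform false in
  [/\ gn_exact1 XW [set 0], gn_exact2 XW [set 0], gn_exact3 XW [set 0]
    & gn_exact4 XW [set 0]].
Proof.
apply: (@chain_exact false [set 0] [::]) => //; first exact: is_ideal0.
by rewrite mon_ideal_nil; apply: initial0.
Qed.

(** The leading form of the corner minor is a power of [zw]. Adjoining it leaves powers of the other
    four variables regular in succession, so the chain argument can be repeated modulo this
    minor. *)
Lemma deform_corner : let XW := deform true in let c := corner_minor XW in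
  nzd_mod [set 0] c /\ gn_exact1 XW (adjoin [set 0] c).
Proof.
move=> XW c; have [dc tc] := corner_top.
have i0 := is_ideal0 {mpoly T[5]}.
have reg := @mon_reg 5 T [::] v4 n isT.
have J0 : initial [set 0] (@mon_ideal 5 T [::]) by rewrite mon_ideal_nil; apply: initial0.
have iM := @is_ideal_mon 5 T [::].
split; first exact: (initial_reg i0 J0 dc tc reg).
have [] // := @chain_exact true (adjoin [set 0] c) [:: (v4, n)].
- exact: (is_ideal_adjoin c i0).
- by rewrite -mon_adjoin; exact: (initial_step i0 iM J0 dc tc reg).
- by move=> _; exists c; split=> //; apply: mem_adjoin.
Qed.

(** With [c] the corner minor and [c * a = gn1 z], exactness modulo [c] gives [z = gn2 y + c *: w];
    then [c] is cancelled from [c * a = c * gn1 w]. *)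
Lemma deform_nzd a : let XW := deform true in
  (exists z, corner_minor XW * a = gn1 XW z) -> exists z, a = gn1 XW z.
Proof.
move=> XW [z Hz]; have [reg ex] := deform_corner.
have {ex} ex : adjoin [set 0] (corner_minor XW) (gn1 XW z) ->
  exists y, inMT (adjoin [set 0] (corner_minor XW)) (z - gn2 XW y) by exact: ex.
case: ex => [|y Hy]; first by exists a; rewrite /= -Hz subrr.
have [w Hw] := inMT_adjoin Hy.
exists w; apply/eqP; rewrite -subr_eq0; apply/eqP/reg; rewrite mulrBr Hz.
have e : z - gn2 XW y = corner_minor XW *: w.
  apply/eqP; rewrite -subr_eq0; case: Hw; case: (_ - _ - _) => N r /= HN Hr.
  apply/eqP; congr pair => //; apply/matrixP => i j; rewrite mxE; exact: HN.
rewrite -[z](subrK (gn2 XW y)) e linearD /= gn12 addr0 linearZ /=.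
by rewrite subrr.
Qed.
End Deformation.

(** * Evaluation at matrices and descent to the undeformed ring *)

Lemma mmap_unique (k : comNzRingType) (T : comNzRingType) (n : nat)
    (f g : {rmorphism {mpoly k[n]} -> T}) :
  (forall a, f a%:MP = g a%:MP) -> (forall i, f 'X_i = g 'X_i) -> f =1 g.
Proof.
move=> HC HX p; rewrite [p]mpolyE !rmorph_sum; apply: eq_bigr => m _.
rewrite -mul_mpolyC !rmorphM HC mpolyXE_id !rmorph_prod; congr (_ * _).
by apply: eq_bigr => i _; rewrite !rmorphXn HX.
Qed.

Section Evaluation.
Variables (k : fieldType) (m : nat) (hm : (3 <= m)%N).
Local Notation R := {mpoly k[#|gc_var hm|]}.
Local Notation S := {mpoly k[#|{: 'I_m * 'I_m}|]}.
Local Notation pp := (ord_penult hm).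
Local Notation ll := (ord_last hm).
Local Notation X := (GC k hm).
Local Notation Y := (generic_mx k m).

Lemma penult_neq_last : pp != ll.
Proof. by apply/eqP => /(congr1 val) /=; have := hm; lia. Qed.

Section Eval.
Variables (T : comNzRingType) (i : {rmorphism k -> T}) (Z : 'M[T]_m).

Definition gc_eval : R -> T :=
  mmap i (fun a => let u := val (enum_val a : gc_var hm) in Z u.1 u.2).
HB.instance Definition _ := GRing.RMorphism.copy gc_eval
  (mmap i (fun a => let u := val (enum_val a : gc_var hm) in Z u.1 u.2)).

Lemma gc_eval_pvar u : gc_eval (pvar k u) = Z (val u).1 (val u).2.
Proof. by rewrite /gc_eval /pvar mmapX mmap1U enum_rankK. Qed.

Lemma gc_evalC a : gc_eval a%:MP = i a.
Proof. by rewrite /gc_eval mmapC. Qed.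

Lemma gc_eval_GC : Z pp pp = Z ll ll -> map_mx gc_eval X = Z.
Proof.
move=> e; apply/matrixP => a b; rewrite !mxE gc_eval_pvar val_insubd.
by case: ifP => [_ //|/negbFE/eqP [-> ->]] /=; rewrite e.
Qed.

Definition gen_eval : S -> T :=
  mmap i (fun a => let u := (enum_val a : 'I_m * 'I_m) in Z u.1 u.2).
HB.instance Definition _ := GRing.RMorphism.copy gen_eval
  (mmap i (fun a => let u := (enum_val a : 'I_m * 'I_m) in Z u.1 u.2)).

Lemma gen_eval_pvar u : gen_eval (pvar k u) = Z u.1 u.2.
Proof. by rewrite /gen_eval /pvar mmapX mmap1U enum_rankK. Qed.

Lemma gen_evalC a : gen_eval a%:MP = i a.
Proof. by rewrite /gen_eval mmapC. Qed.

Lemma gen_eval_generic : map_mx gen_eval Y = Z.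
Proof. by apply/matrixP => a b; rewrite !mxE gen_eval_pvar. Qed.
End Eval.

Lemma GC_pvar (u : gc_var hm) : X (val u).1 (val u).2 = pvar k u.
Proof.
rewrite mxE; congr (pvar k _); apply: val_inj; rewrite val_insubd.
by case: u => [[a b] H] /=; rewrite H.
Qed.

Lemma GC_diag : X pp pp = X ll ll.
Proof.
rewrite !mxE; congr (pvar k _); apply: val_inj; rewrite !val_insubd /= eqxx /=.
by case: ifP.
Qed.

Lemma gc_eval_unique (T : comNzRingType) (f g : {rmorphism R -> T}) :
  (forall a, f a%:MP = g a%:MP) -> map_mx f X = map_mx g X -> f =1 g.
Proof.
move=> HC HX; apply: mmap_unique => // a.
have := congr1 (fun A : 'M_m => A (val (enum_val a)).1 (val (enum_val a)).2) HX.
by rewrite [LHS]mxE [RHS]mxE !GC_pvar /pvar enum_valK.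
Qed.

Lemma gen_eval_unique (T : comNzRingType) (f g : {rmorphism S -> T}) :
  (forall a, f a%:MP = g a%:MP) -> map_mx f Y = map_mx g Y -> f =1 g.
Proof.
move=> HC HX; apply: mmap_unique => // a.
have := congr1 (fun A : 'M_m => A (enum_val a).1 (enum_val a).2) HX.
by rewrite !mxE /pvar -surjective_pairing enum_valK.
Qed.
End Evaluation.

Section GNMorphism.
Variables (R T : comNzRingType) (f : {rmorphism R -> T}) (m : nat) (X : 'M[R]_m).

Lemma gn1_map (z : 'M[R]_m * R^o) :
  f (gn1 X z) = gn1 (map_mx f X) (map_mx f z.1, f z.2 : T^o).
Proof.
by rewrite /gn1 /= rmorphB rmorphM -trace_map_mx map_mxM map_mx_adj det_map_mx.
Qed.

Lemma gn2_map (z : 'M[R]_m * 'M[R]_m) :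
  (map_mx f (gn2 X z).1, f (gn2 X z).2 : T^o) = gn2 (map_mx f X) (map_mx f z.1, map_mx f z.2).
Proof.
by rewrite /gn2 /= map_mxB !map_mxM rmorphB !trace_map_mx.
Qed.

Lemma gn3_map (z : 'M[R]_m * R^o) :
  (map_mx f (gn3 X z).1, map_mx f (gn3 X z).2) = gn3 (map_mx f X) (map_mx f z.1, f z.2 : T^o).
Proof.
by rewrite /gn3 /= !map_mxD !map_mxM map_scalar_mx.
Qed.

Lemma gn4_map (z : R^o) :
  (map_mx f (gn4 X z).1, f (gn4 X z).2 : T^o) = gn4 (map_mx f X) (f z : T^o).
Proof.
by rewrite /gn4 /= map_mxZ map_mx_adj rmorphN rmorphM det_map_mx.
Qed.
End GNMorphism.

Section GNRetract.
Variables (R T : comNzRingType) (f : {rmorphism R -> T}) (g : {rmorphism T -> R}).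
Variables (m : nat) (X : 'M[R]_m) (Y : 'M[T]_m).
Hypotheses (fX : map_mx f X = Y) (gY : map_mx g Y = X) (fK : cancel f g).

Let fKmx (A : 'M_m) : map_mx g (map_mx f A) = A.
Proof. by apply/matrixP => i j; rewrite !mxE fK. Qed.

Lemma gn1_retract (z : 'M[R]_m * R^o) a : a = gn1 X z ->
  f a = gn1 Y (map_mx f z.1, f z.2 : T^o).
Proof. by move=> ->; rewrite gn1_map fX. Qed.

Lemma gn1_image a : (exists z, f a = gn1 Y z) -> exists z, a = gn1 X z.
Proof.
case=> z Hz; exists (map_mx g z.1, g z.2 : R^o).
by rewrite -gY -(gn1_map g Y z) -Hz fK.
Qed.

(** A cycle is pushed along [f], bounded over [T], and the bounding chain is brought back by [g],
    which undoes [f]. *)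
Lemma gn_exact_retract :
  [/\ gn_exact1 Y [set 0], gn_exact2 Y [set 0], gn_exact3 Y [set 0]
    & gn_exact4 Y [set 0]] ->
  [/\ forall z, gn1 X z = 0 -> exists y, z = gn2 X y,
      forall z, gn2 X z = 0 -> exists y, z = gn3 X y,
      forall z, gn3 X z = 0 -> exists y, z = gn4 X y &
      forall z, gn4 X z = 0 -> z = 0].
Proof.
move=> [e1 e2 e3 e4]; split.
- move=> [N r] H; have E := gn1_map f X (N, r); rewrite H rmorph0 fX in E.
  have [y /inMT0/subr0_eq Ey] := e1 _ (esym E).
  have Ey' := gn2_map g Y y; rewrite gY -Ey /= fKmx fK in Ey'.
  by eexists; exact: Ey'.
- move=> [U V] H; have E := gn2_map f X (U, V); rewrite H /= map_mx0 rmorph0 fX in E.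
  have [y /inMM0/subr0_eq Ey] := e2 _ ((inMT0 _).2 (esym E)).
  have Ey' := gn3_map g Y y; rewrite gY -Ey /= !fKmx in Ey'.
  by eexists; exact: Ey'.
- move=> [N r] H; have E := gn3_map f X (N, r); rewrite H /= map_mx0 fX in E.
  have [y /inMT0/subr0_eq Ey] := e3 _ ((inMM0 _).2 (esym E)).
  have Ey' := gn4_map g Y y; rewrite gY -Ey /= fKmx fK in Ey'.
  by eexists; exact: Ey'.
- move=> s H; have E := gn4_map f X s; rewrite H /= map_mx0 rmorph0 fX in E.
  have /(congr1 g) := e4 _ ((inMT0 _).2 (esym E)).
  by rewrite fK rmorph0.
Qed.
End GNRetract.

Lemma pchar0_natr (k : fieldType) : [pchar k] =i pred0 ->
  forall a, a.+1%:R != 0 :> k.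
Proof.
move=> hk a; apply/eqP => /eqP e.
have [p] := natf0_pchar (n := a.+1) isT e; by rewrite hk.
Qed.

Lemma pchar0_mpoly (k : fieldType) (N : nat) : [pchar k] =i pred0 ->
  forall a, exists b : {mpoly k[N]}, a.+1%:R * b = 1.
Proof.
move=> hk a; exists (a.+1%:R^-1)%:MP.
by rewrite -mpolyC_nat -mpolyCM divff ?mpolyC1 // pchar0_natr.
Qed.

Section Descent.
Variables (k : fieldType) (hk : [pchar k] =i pred0) (n : nat) (hm : (3 <= n.+2)%N).
Local Notation m := n.+2.
Local Notation R := {mpoly k[#|gc_var hm|]}.
Local Notation W := {mpoly R[5]}.
Local Notation X := (GC k hm).
Variable lam : bool.
Let XW : 'M[W]_m := deform X lam.

Let iota : k -> W := @mpolyC 5 R \o @mpolyC _ k.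
HB.instance Definition _ := GRing.RMorphism.copy iota (@mpolyC 5 R \o @mpolyC _ k).

Let XW_diag : XW (ord_penult hm) (ord_penult hm) = XW (ord_last hm) (ord_last hm).
Proof.
rewrite mxE [RHS]mxE [X in X + _ = _]mxE [X in _ = X + _]mxE GC_diag.
congr (_ + _); rewrite [LHS]mxE [RHS]mxE.
by apply: (band_diag R lam (n := n)); move: hm; rewrite !ltnS.
Qed.

(** Translation of the coordinates by the entries of the band; it carries [GC] to [XW] because of
    [XW_diag]. *)
Definition gc_translate : R -> W := gc_eval iota XW.
HB.instance Definition _ := GRing.RMorphism.on gc_translate.

Lemma gc_translate_GC : map_mx gc_translate X = XW.
Proof. exact: gc_eval_GC. Qed.

Definition gc_center : W -> R := meval (fun=> 0).
HB.instance Definition _ := GRing.RMorphism.on gc_center.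

Lemma gc_center_deform : map_mx gc_center XW = X.
Proof.
apply/matrixP => i j; rewrite [LHS]mxE [XW i j]mxE [map_mx _ _ i j]mxE [band_mx _ _ _ i j]mxE.
rewrite rmorphD /= /gc_center mevalC [X in _ + X](_ : _ = 0) ?addr0 //.
by rewrite /band; do !case: ifP => _;
  rewrite ?(mevalD, mevalMn, mevalXU, meval0, mul0rn, addr0).
Qed.

Lemma gc_translateK : cancel gc_translate gc_center.
Proof.
move=> a; apply: (@gc_eval_unique k m hm R (gc_center \o gc_translate) idfun) => [b|].
  by rewrite /= /gc_translate gc_evalC /gc_center mevalC.
by rewrite map_mx_comp gc_translate_GC gc_center_deform map_mx_id.
Qed.
End Descent.

Section GCExact.
Variables (k : fieldType) (hk : [pchar k] =i pred0) (m : nat) (hm : (3 <= m)%N).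
Local Notation R := {mpoly k[#|gc_var hm|]}.
Local Notation X := (GC k hm).

Lemma gc_exact :
  [/\ forall z, gn1 X z = 0 -> exists y, z = gn2 X y,
      forall z, gn2 X z = 0 -> exists y, z = gn3 X y,
      forall z, gn3 X z = 0 -> exists y, z = gn4 X y &
      forall z, gn4 X z = 0 -> z = 0].
Proof.
have [n en] : exists n, m = n.+2 by exists m.-2; have := hm; lia.
subst m; have ex := deform_exact X (pchar0_mpoly _ hk).
have e1 := @gc_translate_GC k n hm false.
have e2 := @gc_center_deform k n hm false.
have e3 := @gc_translateK k n hm false.
exact: (gn_exact_retract e1 e2 e3 ex).
Qed.

(** The index map [h] is abstract so that block matrices of size [n + 2] can use the result, whereas
    the deformation is carried out in size [n.+2]. *)
Lemma gc_corner_nzd (n : nat) (h : 'I_n -> 'I_m) a : m = n.+2 ->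
  (forall i, h i = i :> nat) ->
  (exists z, \det (mxsub h h X) * a = gn1 X z) -> exists z, a = gn1 X z.
Proof.
move=> en hh [z Hz]; subst m.
have eh : h = widen_ord (leq_addl 2 n) by apply/funext => i; apply: val_inj; exact: hh.
have e1 := @gc_translate_GC k n hm true.
have e2 := @gc_center_deform k n hm true.
have e3 := @gc_translateK k n hm true.
apply: (gn1_image e2 e3); apply: deform_nzd; first exact: pchar0_mpoly.
exists (map_mx (@gc_translate k n hm true) z.1, @gc_translate k n hm true z.2).
rewrite -(gn1_retract e1 Hz) rmorphM; congr (_ * _).
by rewrite /corner_minor -e1 -map_mxsub det_map_mx eh.
Qed.
End GCExact.

(** * Injective modules: Baer's criterion and coinduced modules *)

Section Baer.
Variable K : comNzRingType.

Definition linear_graph (N M : lmodType K) (G : set (N * M)) :=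
  G 0 /\ forall a p q, G p -> G q -> G (a *: p + q).

(* Injectivity, with a partial linear map given by its graph. *)
Definition inj_ext (M : lmodType K) := forall (N : lmodType K) (G : set (N * M)),
  linear_graph G -> (forall y, G (0, y) -> y = 0) ->
  exists h : {linear N -> M}, forall x y, G (x, y) -> h x = y.

Definition baer (M : lmodType K) := forall (I : set K) (g : K -> M),
  is_ideal I -> (forall a b, I a -> I b -> g (a + b) = g a + g b) ->
  (forall a b, I b -> g (a * b) = a *: g b) ->
  exists e, forall a, I a -> g a = a *: e.

Lemma inj_ext_injective (M : lmodType K) : inj_ext M -> injective_module M.
Proof.
move=> HM N N' i g inji.
have [||h Hh] := HM N' [set p | exists x, p = (i x, g x)].
- split; first by exists 0; rewrite !linear0.
  by move=> a _ _ [x ->] [y ->]; exists (a *: x + y); rewrite !linearP.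
- by move=> y [x [/esym]]; rewrite -(linear0 i) => /inji -> ->; rewrite linear0.
by exists h => x; apply: Hh; exists x.
Qed.

Section Extension.
Variables (N M : lmodType K) (G : set (N * M)).
Hypotheses (bM : baer M) (linG : linear_graph G) (funG : forall y, G (0, y) -> y = 0).

Let good (A : set (N * M)) :=
  [/\ linear_graph A, forall y, A (0, y) -> y = 0 & G `<=` A].

Lemma linear_graphB (A : set (N * M)) p q :
  linear_graph A -> A p -> A q -> A (p - q).
Proof. by move=> [_ H] Ap Aq; rewrite addrC -scaleN1r; apply: H. Qed.

Lemma linear_graphZ (A : set (N * M)) a p : linear_graph A -> A p -> A (a *: p).
Proof. by move=> [H0 H] Ap; rewrite -[_ *: _]addr0; apply: H. Qed.

Lemma linear_graphD (A : set (N * M)) p q :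
  linear_graph A -> A p -> A q -> A (p + q).
Proof. by move=> [_ H] Ap Aq; rewrite -[p]scale1r; apply: H. Qed.

Lemma graph_functional (A : set (N * M)) x y z : good A ->
  A (x, y) -> A (x, z) -> y = z.
Proof.
case=> linA funA _ H1 H2; apply/eqP; rewrite -subr_eq0; apply/eqP/funA.
by have := linear_graphB linA H1 H2; rewrite /= -[(x, y) - _]/(x - x, y - z) subrr.
Qed.

Lemma good_max : exists A, good A /\ forall B, A `<` B -> ~ good B.
Proof.
have goodG : good G by split.
have chain (F : set (set (N * M))) : F `<=` [set A | A = set0 \/ good A] ->
    total_on F subset -> [set A | A = set0 \/ good A] (\bigcup_(X in F) X).
  move=> FP Ftot.
  have [[A FA gA]|nF] := pselect (exists2 A, F A & good A); last first.
    left; apply/seteqP; split=> // x [A FA Ax]; case: (FP A FA) => [A0|gA].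
      by rewrite A0 in Ax.
    by apply: nF; exists A.
  have Fgood B x : F B -> B x -> good B.
    by move=> FB Bx; case: (FP B FB) => // B0; rewrite B0 in Bx.
  right; split.
  - split; first by exists A => //; case: gA => -[].
    move=> a p q [B FB Bp] [C FC Cq].
    have gB := Fgood B p FB Bp; have gC := Fgood C q FC Cq.
    have [BC|CB] := Ftot B C FB FC.
      by exists C => //; case: gC => -[_ H] _ _; apply: H => //; apply: BC.
    by exists B => //; case: gB => -[_ H] _ _; apply: H => //; apply: CB.
  - by move=> y [B FB By]; have [_ H _] := Fgood B _ FB By; apply: H.
  - by move=> x Gx; exists A => //; case: gA => _ _; apply.
have [A [[A0|gA] mA]] := Zorn_bigcup chain; last first.
  by exists A; split=> // B AB gB; apply: (mA B AB); right.
case: (mA G); last by right.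
rewrite A0; split; first exact: sub0set.
by move=> /(_ 0 linG.1).
Qed.

Lemma graph_extension : exists h : {linear N -> M}, forall x y, G (x, y) -> h x = y.
Proof.
have [A [gA mA]] := good_max; have [linA funA GA] := gA.
have Atot x : exists y, A (x, y).
  apply: contrapT => nx.
  (* The scalars that bring [x] into the domain of the graph form an ideal, and Baer's condition for
     this ideal supplies a value at [x]. *)
  pose I := [set a | exists y, A (a *: x, y)].
  have iI : is_ideal I.
    split=> [|a b [y Hy] [z Hz]|a b [y Hy]].
    - by exists 0; rewrite scale0r; exact: linA.1.
    - by exists (y + z); rewrite scalerDl; exact: (linear_graphD linA Hy Hz).
    - by exists (a *: y); rewrite -scalerA; exact: (linear_graphZ a linA Hy).
  pose g a : M := if pselect (I a) is left H then projT1 (cid H) else 0.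
  have gP a : I a -> A (a *: x, g a).
    by move=> Ia; rewrite /g; case: pselect => // H; exact: (projT2 (cid H)).
  have [a b Ia Ib|a b Ib|e He] := @bM I g iI.
  - apply: (graph_functional gA (gP _ (idealD iI Ia Ib))).
    by rewrite scalerDl; exact: (linear_graphD linA (gP _ Ia) (gP _ Ib)).
  - apply: (graph_functional gA (gP _ (idealMl a iI Ib))).
    by rewrite -scalerA; exact: (linear_graphZ a linA (gP _ Ib)).
  pose B := [set p | exists q a, A q /\ p = q + (a *: x, a *: e)].
  case: (mA B).
    split; first by move=> q Aq; exists q, 0; rewrite !scale0r addr0.
    move=> BA; apply: nx; exists e; apply: BA; exists 0, 1.
    by rewrite !scale1r add0r; split=> //; exact: linA.1.
  split.
  - split; first by exists 0, 0; rewrite !scale0r addr0; split=> //; exact: linA.1.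
    move=> c _ _ [p [a [Ap ->]]] [q [b [Aq ->]]].
    exists (c *: p + q), (c * a + b); split; first by case: linA => _; apply.
    rewrite scalerDr addrACA; congr (_ + _).
    by rewrite /= !scalerDl -!scalerA.
  - move=> y [[p q] [a [Ap [Ep Eq]]]].
    have Aax : A (a *: x, - q).
      have := linear_graphZ (-1) linA Ap; rewrite scaleN1r.
      by rewrite -[- (p, q)]/(- p, - q) -(addr0_eq (esym Ep)).
    have Ia : I a by exists (- q).
    by rewrite -(He a Ia) -(graph_functional gA Aax (gP a Ia)) subrr in Eq.
  - by move=> p Gp; exists p, 0; rewrite !scale0r addr0; split=> //; exact: GA.
pose h x := projT1 (cid (Atot x)).
have hP x : A (x, h x) by exact: (projT2 (cid (Atot x))).
have hlin : linear h.
  by move=> a x y; exact: (graph_functional gA (hP _) (linA.2 a _ _ (hP x) (hP y))).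
pose hl := GRing.isLinear.Build K N M _ h hlin.
pose H : {linear N -> M} := HB.pack h hl.
exists H => x y Gxy; exact: (graph_functional gA (hP x) (GA _ Gxy)).
Qed.
End Extension.

Lemma baer_inj_ext (M : lmodType K) : baer M -> inj_ext M.
Proof. by move=> bM N G linG funG; exact: graph_extension. Qed.
End Baer.

Section Restriction.
Variables (K B : comNzRingType) (i : {rmorphism K -> B}).

(** The morphism is a phantom argument, so that the module structure depending on it can be attached
    to the type. *)
Definition restr of {rmorphism K -> B} := fun M : lmodType B => M : Type.

Variable M : lmodType B.
HB.instance Definition _ := GRing.Zmodule.on (restr i M).

Definition restr_scale (a : K) (x : restr i M) : restr i M := i a *: (x : M).

Lemma restr_scaleA a b x : restr_scale a (restr_scale b x) = restr_scale (a * b) x.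
Proof. by rewrite /restr_scale scalerA rmorphM. Qed.
Lemma restr_scale1 : left_id 1 restr_scale.
Proof. by move=> x; rewrite /restr_scale rmorph1 scale1r. Qed.
Lemma restr_scaleDr : right_distributive restr_scale +%R.
Proof. by move=> a x y; rewrite /restr_scale scalerDr. Qed.
Lemma restr_scaleDl x : {morph restr_scale^~ x : a b / a + b}.
Proof. by move=> a b; rewrite /restr_scale rmorphD scalerDl. Qed.

HB.instance Definition _ := GRing.Zmodule_isLmodule.Build K (restr i M)
  restr_scaleA restr_scale1 restr_scaleDr restr_scaleDl.
End Restriction.

Lemma field_baer (k : fieldType) (M : lmodType k) : baer M.
Proof.
move=> I g iI gD gZ; have [[a Ia a0]|nI] := pselect (exists2 a, I a & a != 0).
  have I1 : I 1 by rewrite -(mulVf a0); apply: idealMl.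
  by exists (g 1) => b Ib; rewrite -{1}[b]mulr1 gZ.
exists 0 => b Ib; have [-> |b0] := eqVneq b 0; last by case: nI; exists b.
have := gD 0 0 (ideal0 iI) (ideal0 iI).
by rewrite addr0 scaler0 => /eqP; rewrite -subr_eq0 opprD addrA subrr sub0r oppr_eq0 => /eqP.
Qed.

Section Coinduced.
Variables (k : fieldType) (B : comNzRingType) (i : {rmorphism k -> B}).
Variable M : lmodType B.

Definition klinear (f : B -> M) :=
  (forall a b, f (a + b) = f a + f b) /\ (forall c b, f (i c * b) = i c *: f b).

Record khom := KHom { khom_fun :> B -> M; khomP : klinear khom_fun }.

Lemma khom_eq (f g : khom) : f =1 g -> f = g.
Proof.
case: f g => [f Hf] [g Hg] /= /funext e; subst g.
by congr KHom; apply: Prop_irrelevance.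
Qed.

HB.instance Definition _ := gen_eqMixin khom.
HB.instance Definition _ := gen_choiceMixin khom.

Lemma khom_zero_subproof : klinear (fun=> 0).
Proof. by split=> *; rewrite ?addr0 ?scaler0. Qed.
Lemma khom_add_subproof (f g : khom) : klinear (fun b => f b + g b).
Proof.
case: f g => [f [fD fZ]] [g [gD gZ]]; split=> /= *; first by rewrite fD gD addrACA.
by rewrite fZ gZ scalerDr.
Qed.
Lemma khom_opp_subproof (f : khom) : klinear (fun b => - f b).
Proof.
case: f => [f [fD fZ]]; split=> /= *; first by rewrite fD opprD.
by rewrite fZ scalerN.
Qed.
Definition khom_zero := KHom khom_zero_subproof.
Definition khom_add f g := KHom (khom_add_subproof f g).
Definition khom_opp f := KHom (khom_opp_subproof f).

Lemma khom_addA : associative khom_add.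
Proof. by move=> f g h; apply: khom_eq => b /=; rewrite addrA. Qed.
Lemma khom_addC : commutative khom_add.
Proof. by move=> f g; apply: khom_eq => b /=; rewrite addrC. Qed.
Lemma khom_add0 : left_id khom_zero khom_add.
Proof. by move=> f; apply: khom_eq => b /=; rewrite add0r. Qed.
Lemma khom_addN : left_inverse khom_zero khom_opp khom_add.
Proof. by move=> f; apply: khom_eq => b /=; rewrite addNr. Qed.
HB.instance Definition _ :=
  GRing.isZmodule.Build khom khom_addA khom_addC khom_add0 khom_addN.

Lemma khomD (f : khom) a b : f (a + b) = f a + f b. Proof. by case: f => ? []. Qed.
Lemma khomZ (f : khom) c b : f (i c * b) = i c *: f b. Proof. by case: f => ? []. Qed.
Lemma khom0 (f : khom) : f 0 = 0.
Proof. by rewrite -[0](mul0r 0) -(rmorph0 i) khomZ rmorph0 scale0r. Qed.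
Lemma khom_addE (f g : khom) b : (f + g) b = f b + g b. Proof. by []. Qed.
Lemma khom_oppE (f : khom) b : (- f) b = - f b. Proof. by []. Qed.

Lemma coind_scale_subproof (a : B) (f : khom) : klinear (fun b => f (a * b)).
Proof. by split=> [b c|c b]; rewrite ?mulrDr ?khomD // mulrCA khomZ. Qed.
Definition coind_scale a f := KHom (coind_scale_subproof a f).

Lemma coind_scaleA a b f : coind_scale a (coind_scale b f) = coind_scale (a * b) f.
Proof. by apply: khom_eq => c /=; rewrite mulrA [b * a]mulrC. Qed.
Lemma coind_scale1 : left_id 1 coind_scale.
Proof. by move=> f; apply: khom_eq => c /=; rewrite mul1r. Qed.
Lemma coind_scaleDr : right_distributive coind_scale +%R.
Proof. by move=> a f g; apply: khom_eq. Qed.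
Lemma coind_scaleDl f : {morph coind_scale^~ f : a b / a + b}.
Proof. by move=> a b; apply: khom_eq => c /=; rewrite mulrDl khomD. Qed.

HB.instance Definition _ := GRing.Zmodule_isLmodule.Build B khom
  coind_scaleA coind_scale1 coind_scaleDr coind_scaleDl.

Lemma coind_scaleE a (f : khom) b : (a *: f) b = f (a * b). Proof. by []. Qed.

(** Evaluation at 1 turns maps into [khom] over [B] into maps into [M] over [k], and the latter
    extend since [k] is a field. *)
Lemma coind_inj_ext : inj_ext khom.
Proof.
move=> N G [G0 GP] funG.
pose Gk : set (restr i N * restr i M) := [set p | exists f, G (p.1, f) /\ p.2 = f 1].
have [||h Hh] := baer_inj_ext (@field_baer k (restr i M)) (G := Gk).
- split; first by exists 0.
  move=> a [x y] [x' y'] [f [Gf /= ->]] [f' [Gf' /= ->]].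
  exists (i a *: f + f'); split; first exact: (GP (i a) _ _ Gf Gf').
  by rewrite /= /GRing.scale /= /restr_scale mulr1 -[i a in RHS]mulr1 khomZ.
- by move=> y [f [/funG -> /= ->]].
have GZ a x f : G (x, f) -> G (a *: x, a *: f).
  by move=> Gf; have := GP a _ _ Gf G0; rewrite addr0.
have lin x : klinear (fun b => h (b *: x) : M).
  split=> [a b|c b]; first by rewrite scalerDl; exact: (linearD h).
  by rewrite -scalerA; exact: (linearZ_LR h).
pose H x := KHom (lin x).
have Hlin : linear H.
  move=> a x y; apply: khom_eq => b /=.
  rewrite scalerDr scalerA mulrC; exact: (linearD h).
pose Hp : {linear N -> khom} := HB.pack H (GRing.isLinear.Build B N khom _ H Hlin).
exists Hp => x f Gf; apply: khom_eq => b /=.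
apply: Hh; exists (b *: f); split; first exact: GZ.
by rewrite /= mulr1.
Qed.

Lemma unit_coind_subproof (x : M) : klinear (fun b => b *: x).
Proof. by split=> *; rewrite ?scalerDl ?scalerA. Qed.
Definition unit_coind x := KHom (unit_coind_subproof x).
Lemma unit_coind_linear : linear unit_coind.
Proof. by move=> a x y; apply: khom_eq => b /=; rewrite scalerDr !scalerA mulrC. Qed.
HB.instance Definition _ := GRing.isLinear.Build B M khom _ unit_coind unit_coind_linear.

Lemma unit_coind_inj : injective unit_coind.
Proof. by move=> x y /(congr1 (fun f : khom => f 1)) /=; rewrite !scale1r. Qed.

(* The cokernel of [unit_coind] is realized on the maps vanishing at [1]. *)
Record cokhom := CoKHom { cokhom_val :> khom; cokhomP : cokhom_val 1 = 0 }.

Lemma cokhom_eq (f g : cokhom) : (forall b, f b = g b) -> f = g.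
Proof.
case: f g => [f Hf] [g Hg] /= /khom_eq e; subst g.
by congr CoKHom; apply: Prop_irrelevance.
Qed.

HB.instance Definition _ := gen_eqMixin cokhom.
HB.instance Definition _ := gen_choiceMixin cokhom.

Lemma cokhom_zero_subproof : (0 : khom) 1 = 0. Proof. by []. Qed.
Lemma cokhom_add_subproof (f g : cokhom) : ((f : khom) + (g : khom)) 1 = 0.
Proof. by rewrite khom_addE !cokhomP addr0. Qed.
Lemma cokhom_opp_subproof (f : cokhom) : (- (f : khom)) 1 = 0.
Proof. by rewrite khom_oppE cokhomP oppr0. Qed.
Definition cokhom_zero := CoKHom cokhom_zero_subproof.
Definition cokhom_add f g := CoKHom (cokhom_add_subproof f g).
Definition cokhom_opp f := CoKHom (cokhom_opp_subproof f).
Lemma cokhom_addA : associative cokhom_add.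
Proof. by move=> f g h; apply: cokhom_eq => b /=; rewrite addrA. Qed.
Lemma cokhom_addC : commutative cokhom_add.
Proof. by move=> f g; apply: cokhom_eq => b /=; rewrite addrC. Qed.
Lemma cokhom_add0 : left_id cokhom_zero cokhom_add.
Proof. by move=> f; apply: cokhom_eq => b /=; rewrite add0r. Qed.
Lemma cokhom_addN : left_inverse cokhom_zero cokhom_opp cokhom_add.
Proof. by move=> f; apply: cokhom_eq => b /=; rewrite addNr. Qed.
HB.instance Definition _ :=
  GRing.isZmodule.Build cokhom cokhom_addA cokhom_addC cokhom_add0 cokhom_addN.

Lemma cokhom_addE (f g : cokhom) b : (f + g) b = f b + g b. Proof. by []. Qed.

Lemma coproj_subproof (f : khom) : (f - unit_coind (f 1)) 1 = 0.
Proof. by rewrite khom_addE khom_oppE /= scale1r subrr. Qed.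
Definition coproj (f : khom) := CoKHom (coproj_subproof f).

Lemma coprojE f b : coproj f b = f b - b *: f 1. Proof. by []. Qed.

(** The action of the quotient, transported to representatives vanishing at 1: [a *: f] takes the
    value [f a] at 1 and has to be projected back. *)
Definition cokhom_scale (a : B) (f : cokhom) := coproj (a *: (f : khom)).
Lemma cokhom_scaleE a (f : cokhom) b : cokhom_scale a f b = f (a * b) - b *: f a.
Proof. by rewrite coprojE !coind_scaleE mulr1. Qed.

Lemma cokhom_scaleA a b f : cokhom_scale a (cokhom_scale b f) = cokhom_scale (a * b) f.
Proof.
apply: cokhom_eq => c; rewrite !cokhom_scaleE scalerBr scalerA mulrA (mulrC b a) (mulrC c a).
by rewrite opprB addrA subrK.
Qed.
Lemma cokhom_scale1 : left_id 1 cokhom_scale.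
Proof. by move=> f; apply: cokhom_eq => c; rewrite cokhom_scaleE mul1r cokhomP scaler0 subr0. Qed.
Lemma cokhom_scaleDr : right_distributive cokhom_scale +%R.
Proof.
move=> a f g; apply: cokhom_eq => c.
by rewrite cokhom_addE !cokhom_scaleE !cokhom_addE scalerDr opprD addrACA.
Qed.
Lemma cokhom_scaleDl f : {morph cokhom_scale^~ f : a b / a + b}.
Proof.
move=> a b; apply: cokhom_eq => c.
by rewrite cokhom_addE !cokhom_scaleE mulrDl !khomD scalerDr opprD addrACA.
Qed.
HB.instance Definition _ := GRing.Zmodule_isLmodule.Build B cokhom
  cokhom_scaleA cokhom_scale1 cokhom_scaleDr cokhom_scaleDl.

Lemma coproj_linear : linear coproj.
Proof.
move=> a f g; apply: cokhom_eq => b.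
rewrite cokhom_addE [(a *: coproj f) b]cokhom_scaleE !coprojE !khom_addE.
rewrite !coind_scaleE mulr1 scalerDr opprD addrACA; congr (_ + _).
by rewrite !scalerBr !scalerA mulrC opprB addrA subrK.
Qed.
HB.instance Definition _ := GRing.isLinear.Build B khom cokhom _ coproj coproj_linear.

Lemma coproj_ker f : coproj f = 0 <-> exists x, unit_coind x = f.
Proof.
split=> [H|[x <-]]; last by apply: cokhom_eq => b /=; rewrite scale1r subrr.
exists (f 1); apply: khom_eq => b /=; apply/esym/eqP.
by rewrite -subr_eq0 -coprojE H.
Qed.

Lemma coproj_surj g : exists f, coproj f = g.
Proof. by exists g; apply: cokhom_eq => b; rewrite coprojE cokhomP scaler0 subr0. Qed.
End Coinduced.

(** * Resolutions by matrices and vanishing of Ext *)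

Section Action.
Variables (B : comNzRingType) (M : lmodType B).

Definition mxact p q (A : 'M[B]_(p, q)) (e : 'I_q -> M) (a : 'I_p) : M :=
  \sum_b A a b *: e b.

Lemma mxactB p q (A : 'M_(p, q)) e f a :
  mxact A (fun b => e b - f b) a = mxact A e a - mxact A f a.
Proof. by rewrite -sumrB; apply: eq_bigr => b _; rewrite scalerBr. Qed.
Lemma mxact_mul p q r (A : 'M_(p, q)) (A' : 'M_(q, r)) e a :
  mxact (A *m A') e a = mxact A (mxact A' e) a.
Proof.
rewrite /mxact; under [RHS]eq_bigr do rewrite scaler_sumr.
rewrite exchange_big; apply: eq_bigr => c _ /=.
by rewrite mxE scaler_suml; apply: eq_bigr => b _; rewrite scalerA.
Qed.
Lemma eq_mxact p q (A : 'M_(p, q)) e f : e =1 f -> mxact A e =1 mxact A f.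
Proof. by move=> H a; apply: eq_bigr => b _; rewrite H. Qed.
End Action.

Lemma mxact_linear (B : comNzRingType) (M N : lmodType B) (h : {linear M -> N}) p q
    (A : 'M_(p, q)) e a : h (mxact A e a) = mxact A (fun b => h (e b)) a.
Proof. by rewrite linear_sum; apply: eq_bigr => b _; rewrite linearZ. Qed.

(** Free complexes as bare matrices: [dmx i] maps row vectors of degree [i + 1] to degree [i].
    Dually, a cochain with values in a module is a family of elements, and [mxact] is its
    coboundary. *)
Record resolution (B : comNzRingType) :=
  Resolution { rk : nat -> nat; dmx : forall i, 'M[B]_(rk i.+1, rk i) }.

Definition shift B (X : resolution B) : resolution B :=
  Resolution (fun i => dmx X i.+1).

(** Exactness over the quotient by [b], written in [B]. The equality on the right is not modulo [b],
    so the rows of [dmx X i.+1] also span all vectors with entries in [b]. *)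
Definition exact_mod (B : comNzRingType) (b : set B) (X : resolution B) :=
  forall i (v : 'rV_(rk X i.+1)),
    (forall j, b ((v *m dmx X i) 0 j)) <-> exists w, v = w *m dmx X i.+1.

Definition submodule (B : comNzRingType) (M : lmodType B) (S : set M) :=
  [/\ S 0, forall x y, S x -> S y -> S (x + y) & forall a x, S x -> S (a *: x)].

Section Submodule.
Variables (B : comNzRingType) (M : lmodType B) (S : set M).
Hypothesis sS : submodule S.
Lemma submodB x y : S x -> S y -> S (x - y).
Proof. by case: sS => _ D Z Sx Sy; apply: D => //; rewrite -scaleN1r; apply: Z. Qed.
Lemma submod_mxact p q (A : 'M_(p, q)) e a : (forall b, S (e b)) -> S (mxact A e a).
Proof.
by case: sS => S0 D Z He; rewrite /mxact; elim/big_ind: _ => // b _; apply: Z.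
Qed.
End Submodule.

Section ExtVanishing.
Variables (B : comNzRingType) (b : set B) (C : set (resolution B)).
Hypothesis ib : is_ideal b.
Hypothesis Cex : forall X, C X -> exact_mod b X.
Hypothesis Csh : forall X, C X -> C (shift X).

(* For every resolution [F] in the class [C], the cohomology of
   [Hom(F, S)] in degree [j + 1] vanishes. *)
Definition ext_van (j : nat) (M : lmodType B) (S : set M) :=
  forall X, C X -> forall e : 'I_(rk X j.+1) -> M,
    (forall a, S (e a)) -> (forall a, mxact (dmx X j.+1) e a = 0) ->
    exists e', (forall a, S (e' a)) /\ forall a, e a = mxact (dmx X j) e' a.

Definition torsion (M : lmodType B) (S : set M) :=
  forall a x, b a -> S x -> a *: x = 0.

Lemma ext_vanS j (M : lmodType B) (S : set M) : ext_van j S -> ext_van j.+1 S.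
Proof. by move=> H X CX e; exact: (H (shift X) (Csh CX)). Qed.

Lemma ext_van_leq i j (M : lmodType B) (S : set M) : (i <= j)%N -> ext_van i S -> ext_van j S.
Proof.
move=> ij H; rewrite -(subnK ij); elim: (j - i)%N => [//|d IH].
exact: ext_vanS.
Qed.

Lemma dmx_comp X i a c : C X -> b ((dmx X i.+1 *m dmx X i) a c).
Proof.
move=> CX; have [_ H] := Cex CX (delta_mx 0 a *m dmx X i.+1).
have := H (ex_intro _ _ erefl) c.
by rewrite -mulmxA -rowE [X in b X -> _]mxE.
Qed.

Lemma mxact_comp X i (M : lmodType B) (S : set M) e a : C X -> torsion S -> (forall a, S (e a)) ->
  mxact (dmx X i.+1) (mxact (dmx X i) e) a = 0.
Proof.
move=> CX tS Se; rewrite -mxact_mul /mxact big1 // => c _; apply: tS => //.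
exact: dmx_comp.
Qed.

Section ShortExact.
Variables (K H H' : lmodType B) (SK : set K) (SH : set H) (SH' : set H').
Variables (f : {linear K -> H}) (p : {linear H -> H'}).
Hypotheses (sH : submodule SH) (sK : submodule SK) (sH' : submodule SH').
Hypotheses (tH : torsion SH).
Hypotheses (finj : forall x, SK x -> f x = 0 -> x = 0) (fS : forall x, SK x -> SH (f x)).
Hypotheses (pf : forall x, SK x -> p (f x) = 0).
Hypothesis exf : forall y, SH y -> p y = 0 -> exists x, SK x /\ f x = y.
Hypotheses (pS : forall y, SH y -> SH' (p y)).
Hypothesis psurj : forall z, SH' z -> exists y, SH y /\ p y = z.

Lemma fun_choice (I : Type) (T : Type) (P : I -> T -> Prop) :
  (forall i, exists x, P i x) -> exists g, forall i, P i (g i).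
Proof. by move=> h; exists (fun i => projT1 (cid (h i))) => i; exact: (projT2 (cid (h i))). Qed.

(** A segment of the long cohomology sequence of [0 -> SK -> SH -> SH' -> 0]. Subsets of modules are
    used because the sequences met later consist of the elements killed by an ideal. *)
Lemma ext_van_ker j : ext_van j.+1 SH -> ext_van j SH' -> ext_van j.+1 SK.
Proof.
move=> EH EH' X CX e Se de.
have [a|a|h [Sh fe]] := EH X CX (fun a => f (e a)).
- exact: (fS (Se a)).
- by rewrite -mxact_linear de linear0.
have [a|a|g [Sg pg]] := EH' X CX (fun a => p (h a)).
- exact: (pS (Sh a)).
- by rewrite -mxact_linear -fe pf.
have [g' Hg'] := fun_choice (fun a => psurj (Sg a)).
have Sk a : SH (h a - mxact (dmx X j) g' a).
  by apply: (submodB sH) => //; apply: (submod_mxact sH) => // c; case: (Hg' c).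
have pk a : p (h a - mxact (dmx X j) g' a) = 0.
  rewrite linearB mxact_linear pg; apply/eqP; rewrite subr_eq0; apply/eqP.
  by apply: eq_mxact => c; case: (Hg' c).
have [k Hk] := fun_choice (fun a => exf (Sk a) (pk a)).
exists k; split=> a; first by case: (Hk a).
apply/eqP; rewrite -subr_eq0; apply/eqP/finj.
  by apply: (submodB sK) => //; apply: (submod_mxact sK) => // c; case: (Hk c).
rewrite linearB fe mxact_linear.
have Sg' c : SH (g' c) by case: (Hg' c).
by rewrite (eq_mxact _ (fun c => (Hk c).2)) mxactB (mxact_comp _ CX tH Sg') subr0 subrr.
Qed.

Lemma ext_van_coker j : ext_van j SH -> ext_van j.+1 SK -> ext_van j SH'.
Proof.
move=> EH EK X CX e Se de.
have [e' He'] := fun_choice (fun a => psurj (Se a)).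
have Se' a : SH (e' a) by case: (He' a).
have Sk a : SH (mxact (dmx X j.+1) e' a) by exact: (submod_mxact sH).
have pk a : p (mxact (dmx X j.+1) e' a) = 0.
  by rewrite mxact_linear (eq_mxact _ (fun c => (He' c).2)).
have [k Hk] := fun_choice (fun a => exf (Sk a) (pk a)).
have [a|a|k' [Sk' kk']] := EK X CX k.
- by case: (Hk a).
- apply: finj; first by apply: (submod_mxact sK) => // c; case: (Hk c).
  by rewrite mxact_linear (eq_mxact _ (fun c => (Hk c).2)) (mxact_comp _ CX tH Se').
have [a|a|g [Sg gg]] := EH X CX (fun a => e' a - f (k' a)).
- by apply: (submodB sH) => //; apply: fS.
- by rewrite mxactB -mxact_linear -kk' (Hk a).2 subrr.
exists (fun a => p (g a)); split=> a; first exact: pS.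
by rewrite -mxact_linear -gg linearB pf // subr0 (He' a).2.
Qed.
End ShortExact.

(** The partial map to be extended also sends the vectors with entries in [b] to 0. It is single
    valued by exactness modulo [b], and its extension takes values killed by [b] on the basis
    vectors. *)
Lemma inj_ext_van (M : lmodType B) : inj_ext M ->
  ext_van 0 [set x : M | forall a, b a -> a *: x = 0].
Proof.
move=> IM X CX e Se de; have exX := Cex CX.
pose comb (v : 'rV[B]_(rk X 1)) := \sum_a v 0 a *: e a.
pose G : set ('rV[B]_(rk X 0) * M) :=
  [set p | exists (v : 'rV_(rk X 1)) (q : 'rV_(rk X 0)), [/\ forall j, b (q 0 j), p.1 = v *m dmx X 0 + q & p.2 = comb v]].
have combP c v w : comb (c *: v + w) = c *: comb v + comb w.
  rewrite /comb scaler_sumr -big_split; apply: eq_bigr => a _ /=.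
  by rewrite !mxE scalerDl scalerA.
have [||h Hh] := IM _ G.
- split.
    exists 0, 0; split; first by move=> j; rewrite mxE; apply: ideal0.
      by rewrite mul0mx addr0.
    by rewrite /comb big1 // => a _; rewrite mxE scale0r.
  move=> c [x y] [x' y'] [v [q [bq /= -> ->]]] [v' [q' [bq' /= -> ->]]].
  exists (c *: v + v'), (c *: q + q'); split.
  + by move=> j; rewrite !mxE; apply: idealD => //; apply: idealMl.
  + by rewrite /= mulmxDl -scalemxAl scalerDr addrACA.
  + by rewrite combP.
- move=> y [v [q [bq /= /esym/eqP Ev ->]]].
  have [w ->] : exists w, v = w *m dmx X 1.
    apply/exX => j; move: Ev; rewrite addr_eq0 => /eqP ->.
    by rewrite mxE; apply: idealN.
  rewrite /comb; transitivity (\sum_c w 0 c *: mxact (dmx X 1) e c).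
    under [RHS]eq_bigr do rewrite scaler_sumr.
    rewrite exchange_big; apply: eq_bigr => a _ /=.
    by rewrite mxE scaler_suml; apply: eq_bigr => c _; rewrite scalerA.
  by rewrite big1 // => c _; rewrite de scaler0.
exists (fun j => h (delta_mx 0 j)); split=> a.
  move=> c bc; rewrite -linearZ; apply: Hh; exists 0, (c *: delta_mx 0 a); split=> //=.
  - by move=> j; rewrite mxE; apply: idealMr.
  - by rewrite mul0mx add0r.
  - by rewrite /comb big1 // => i _; rewrite mxE scale0r.
have -> : e a = h (row a (dmx X 0)).
  apply/esym/Hh; exists (delta_mx 0 a), 0; split=> /=.
  - by move=> j; rewrite mxE; apply: ideal0.
  - by rewrite addr0 rowE.
  - rewrite /comb (bigD1 a) //= mxE !eqxx scale1r big1 ?addr0 // => i ia.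
    by rewrite mxE (negPf ia) andbF scale0r.
rewrite [row a _]row_sum_delta linear_sum; apply: eq_bigr => j _.
by rewrite linearZ mxE.
Qed.
End ExtVanishing.


(** * Injective dimension by dimension shifting *)

Section Coresolution.
Variables (k : fieldType) (B : comNzRingType) (i : {rmorphism k -> B}).
Variable C : set (resolution B).
Hypothesis Cex : forall X, C X -> exact_mod [set 0] X.
Hypothesis Csh : forall X, C X -> C (shift X).

Let i0 := is_ideal0 B.
Let tT (M : lmodType B) : torsion [set 0] [set: M].
Proof. by move=> a x -> _; rewrite scale0r. Qed.

Lemma ext_van_khom (M : lmodType B) j : ext_van C j [set: khom i M].
Proof.
apply: (@ext_van_leq _ _ Csh 0) => //.
have <- : [set x : khom i M | forall a, [set 0] a -> a *: x = 0] = setT.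
  by apply/seteqP; split=> // x _ a ->; rewrite scale0r.
exact: (inj_ext_van i0 Cex (@coind_inj_ext k B i M)).
Qed.

Lemma ext_van_cokhom (M : lmodType B) j :
  ext_van C j.+1 [set: M] -> ext_van C j [set: cokhom i M].
Proof.
move=> EM; apply: (@ext_van_coker _ _ C Cex M (khom i M) (cokhom i M)
  setT setT setT (@unit_coind k B i M) (@coproj k B i M)) => //.
- by move=> x _; rewrite -(linear0 (@unit_coind k B i M)) => /unit_coind_inj.
- by move=> x _; apply/coproj_ker; exists x.
- by move=> y _ /coproj_ker [x <-]; exists x.
- by move=> z _; have [y <-] := coproj_surj z; exists y.
- exact: ext_van_khom.
Qed.

Definition ideal_resolutions := forall I : set B, is_ideal I -> exists2 X, C X &
  rk X 0 = 1 /\ forall b, I b <-> exists v, b = \sum_a \sum_c v a * dmx X 0 a c.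

Hypothesis Cgen : ideal_resolutions.

(** The values of [g] on the generators listed in [dmx X 0] form a cocycle; as [rk X 0] is 1, being
    a coboundary means being multiplication by one element. *)
Lemma ext_van_baer (M : lmodType B) : ext_van C 0 [set: M] -> baer M.
Proof.
move=> EM I g iI gD gZ; have [X CX [r1 HX]] := Cgen iI.
have [c0 Hc0] : exists c0 : 'I_(rk X 0), forall c, c = c0.
  have c0 : 'I_(rk X 0) by rewrite r1; exact: ord0.
  exists c0 => c; apply: val_inj => /=; have := ltn_ord c; have := ltn_ord c0.
  by lia.
have sumc (N : zmodType) (F : 'I_(rk X 0) -> N) : \sum_c F c = F c0.
  by rewrite (bigD1 c0) //= big1 ?addr0 // => c; rewrite (Hc0 c) eqxx.
have g0 : g 0 = 0 by rewrite -[0](mul0r 0) gZ ?scale0r //; exact: ideal0.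
have gsum (J : Type) (r : seq J) (F : J -> B) : (forall j, I (F j)) ->
    I (\sum_(j <- r) F j) /\ g (\sum_(j <- r) F j) = \sum_(j <- r) g (F j).
  move=> HF; elim: r => [|j r [IH1 IH2]]; first by rewrite !big_nil; split; [exact: ideal0|].
  by rewrite !big_cons gD // IH2; split=> //; apply: idealD.
pose u a := dmx X 0 a c0.
have Iu a : I (u a).
  apply/HX; exists (fun a' => (a' == a)%:R).
  rewrite (bigD1 a) //= [X in _ + X]big1 ?addr0 ?sumc ?eqxx ?mul1r //.
  by move=> a' /negPf na; rewrite big1 // => c _; rewrite na mul0r.
have [a|a|e [_ He]] := EM X CX (fun a => g (u a)) => //.
  rewrite /mxact; under eq_bigr do rewrite -gZ //.
  have [_ E] := gsum _ (index_enum _) (fun b => dmx X 1 a b * u b)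
    (fun b => idealMl (dmx X 1 a b) iI (Iu b)).
  rewrite -{}E.
  have := @dmx_comp _ _ C Cex X 0 a c0 CX; rewrite mxE /= => ->; exact: g0.
exists (e c0) => b /HX [v ->].
under eq_bigr do rewrite sumc.
have [_ ->] := gsum _ (index_enum _) (fun a => v a * u a)
  (fun a => idealMl (v a) iI (Iu a)).
rewrite scaler_suml; apply: eq_bigr => a _; rewrite gZ // He.
by rewrite /mxact sumc scalerA.
Qed.

Lemma ext_van_injdim (M : lmodType B) n : ext_van C n [set: M] -> injdim_le n M.
Proof.
elim: n M => [|n IH] M EM.
  by apply: inj_ext_injective; apply: baer_inj_ext; apply: ext_van_baer.
exists (khom i M), (cokhom i M), (@unit_coind k B i M), (@coproj k B i M); split.
- by apply: inj_ext_injective; exact: coind_inj_ext.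
- exact: unit_coind_inj.
- exact: coproj_ker.
- exact: coproj_surj.
- by apply: IH; apply: ext_van_cokhom.
Qed.

Fixpoint cosyzygy n (M : lmodType B) : lmodType B :=
  if n is n'.+1 then cosyzygy n' (cokhom i M) else M.

Lemma cosyzygy_inj n (M : lmodType B) : ext_van C n [set: M] -> inj_ext (cosyzygy n M).
Proof.
elim: n M => [|n IH] M EM /=; first by apply: baer_inj_ext; apply: ext_van_baer.
by apply: IH; apply: ext_van_cokhom.
Qed.
End Coresolution.

(** * Finite injective dimension of the polynomial ring *)

Section PolynomialRing.
Variables (k : fieldType) (N : nat).
Local Notation R := {mpoly k[N]}.
Variable C : set (resolution R).
Hypothesis Cex : forall X, C X -> exact_mod [set 0] X.
Hypothesis Csh : forall X, C X -> C (shift X).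

Let H := khom (@mpolyC N k) (R^o : lmodType R).

Let tH (S : set H) : torsion [set 0] S.
Proof. by move=> a x -> _; rewrite scale0r. Qed.

(* The maps commuting with the first [j] variables; from one [j] to the next
   they form the kernel of a surjective endomorphism, so that the polynomial
   ring has injective dimension at most the number of variables. *)
Definition commuting (j : nat) : set H :=
  [set f : H | forall i : 'I_N, (i < j)%N -> forall b, f ('X_i * b) = 'X_i * f b].

Lemma commuting_submod j : submodule (commuting j).
Proof.
split=> [i _ b|f g Hf Hg i ij b|a f Hf i ij b]; first by rewrite mulr0.
  by rewrite !khom_addE Hf // Hg // mulrDr.
by rewrite !coind_scaleE mulrCA Hf.
Qed.

Section Defect.
Variable v : 'I_N.

Lemma defect_subproof (f : H) :
  klinear (@mpolyC N k) (M := R^o) (fun b => 'X_v * f b - f ('X_v * b)).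
Proof.
split=> [a b|c b]; first by rewrite mulrDr !khomD mulrDr opprD addrACA.
rewrite mulrCA !khomZ /GRing.scale /=; ring.
Qed.
Definition defect f : H := KHom (defect_subproof f).
Lemma defect_linear : linear defect.
Proof.
move=> a f g; apply: khom_eq => b /=.
by rewrite mulrDr opprD addrACA [a * (_ * b)]mulrCA.
Qed.
HB.instance Definition _ := GRing.isLinear.Build R H H _ defect defect_linear.

Lemma defect_commuting f : commuting v f -> commuting v (defect f).
Proof.
move=> Hf i iv b /=; rewrite [X in _ - f X]mulrCA !(Hf i iv).
have E (x y s t : R) : x * (y * s) - y * t = y * (x * s - t) by ring.
exact: E.
Qed.

Lemma defect_ker f : commuting v f -> (defect f = 0 <-> commuting v.+1 f).
Proof.
move=> Hf; split=> [d0 i|Hf1].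
  rewrite ltnS leq_eqVlt => /orP[/eqP/val_inj -> b|/Hf //].
  by have /(congr1 (fun f : H => f b)) /= /eqP := d0; rewrite subr_eq0 => /eqP.
by apply: khom_eq => b /=; rewrite Hf1 // subrr.
Qed.

Section Surjective.
Variable g : H.
Hypothesis Hg : commuting v g.

(** With [F] the map sought, the recursion [F ('X_v * x) = 'X_v * F x - g x] on monomials is solved
    explicitly, starting from 0 on the monomials free of ['X_v]. *)
Let prim_mon (m : 'X_{1..N}) : R :=
  - \sum_(a < m v) 'X_v ^+ (m v - a.+1) * g 'X_[m - U_(v) *+ (m v - a)].
Let prim (b : R) : R := \sum_(m <- msupp b) b@_m *: prim_mon m.

Let primE (s : seq 'X_{1..N}) (b : R) : uniq s -> {subset msupp b <= s} ->
  prim b = \sum_(m <- s) b@_m *: prim_mon m.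
Proof.
move=> us sub; rewrite /prim [RHS](bigID (fun m => m \in msupp b)) /= [X in _ + X]big1 => [|m nm].
  rewrite addr0 -[RHS]big_filter; apply: perm_big; apply: uniq_perm.
  - exact: msupp_uniq.
  - exact: filter_uniq.
  - by move=> m; rewrite mem_filter; case: (boolP (m \in msupp b)) => // /sub ->.
by rewrite memN_msupp_eq0 ?scale0r.
Qed.

Let prim_lin c a b : prim (c *: a + b) = c *: prim a + prim b.
Proof.
set s := undup (msupp a ++ msupp b).
have us : uniq s by apply: undup_uniq.
rewrite !(@primE s) //; last 3 first.
- by move=> m mb; rewrite mem_undup mem_cat mb orbT.
- by move=> m ma; rewrite mem_undup mem_cat ma.
- move=> m /msuppD_le; rewrite mem_undup !mem_cat => /orP[/msuppZ_le ->|->] //.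
  by rewrite orbT.
rewrite scaler_sumr -big_split; apply: eq_bigr => m _.
by rewrite mcoeffD mcoeffZ scalerDl scalerA.
Qed.

Let prim_klin : klinear (@mpolyC N k) (M := R^o) prim.
Proof.
split=> [a b|c b]; first by have := prim_lin 1 a b; rewrite !scale1r.
have p0 : prim 0 = 0 by rewrite /prim msupp0 big_nil.
have E : prim (c *: b) = c *: prim b by rewrite -[c *: b]addr0 prim_lin p0 addr0.
by rewrite mul_mpolyC E -mul_mpolyC.
Qed.
Let P : H := KHom prim_klin.

Let primX m : prim 'X_[m] = prim_mon m.
Proof. by rewrite /prim msuppX big_seq1 mcoeffX eqxx scale1r. Qed.

Lemma khom_mon_ext (f h : H) : (forall m, f 'X_[m] = h 'X_[m]) -> f = h.
Proof.
move=> E; apply: khom_eq => b; rewrite [b]mpolyE.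
elim: (msupp b) => [|m s IH]; first by rewrite big_nil !khom0.
by rewrite big_cons !khomD IH -!mul_mpolyC !khomZ E.
Qed.

Lemma defect_surj : exists f, commuting v f /\ defect f = g.
Proof.
exists P; split.
  move=> i iv; suff E : forall m, P ('X_i * 'X_[m]) = 'X_i * P 'X_[m].
    pose fi : H := KHom (@coind_scale_subproof k R _ R^o 'X_i P).
    have lin : klinear (@mpolyC N k) (M := R^o) (fun b => 'X_i * P b).
      split=> [a b|c b]; first by rewrite khomD mulrDr.
      by rewrite khomZ /GRing.scale /= mulrCA.
    have := @khom_mon_ext fi (KHom lin) E.
    by move=> + b => /(congr1 (fun f : H => f b)).
  move=> m; rewrite -mpolyXD /= !primX /prim_mon mulrN mulr_sumr.
  have niv : (i == v) = false by apply/negbTE; rewrite neq_ltn iv.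
  have -> : (U_(i) + m)%MM v = m v by rewrite mnmDE mnm1E niv.
  congr (- _); apply: eq_bigr => a _; rewrite mulrCA; congr (_ * _).
  rewrite -Hg // -mpolyXD; congr (g 'X_[_]); apply/mnmP => j.
  rewrite !(mnmDE, mnmBE, mulmnE, mnm1E).
  case: (eqVneq v j) => [<-|_]; last by rewrite mul0n !subn0.
  by rewrite niv.
apply: khom_mon_ext => m /=; rewrite -mpolyXD !primX /prim_mon.
have -> : (U_(v) + m)%MM v = (m v).+1 by rewrite mnmDE mnm1E eqxx.
rewrite big_ord_recr /= subnn expr0 mul1r.
have -> : (U_(v) + m - U_(v) *+ ((m v).+1 - m v))%MM = m.
  by rewrite subSnn mulm1n addmC addmK.
have E (x S G : R) : x * - S - - (x * S + G) = G by ring.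
rewrite -[RHS](E 'X_v (\sum_(a < m v) 'X_v ^+ (m v - a.+1) * g 'X_[m - U_(v) *+ (m v - a)])).
congr (_ - - (_ + _)); rewrite mulr_sumr; apply: eq_bigr => a _.
rewrite mulrA -exprS; congr (_ ^+ _ * g 'X_[_]).
  by have := ltn_ord a; lia.
apply/mnmP => j; rewrite !(mnmDE, mnmBE, mulmnE, mnm1E).
have := ltn_ord a; case: (eqVneq v j) => [<-|_]; lia.
Qed.
End Surjective.
End Defect.

(** [defect] maps [commuting j] onto itself with kernel [commuting j.+1], so each variable raises
    the degree of vanishing by one. *)
Lemma ext_van_commuting j : (j <= N)%N -> ext_van C j (commuting j).
Proof.
elim: j => [|j IH] jN.
  have -> : commuting 0 = setT by apply/seteqP; split.
  exact: ext_van_khom.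
have {IH} EV := IH (ltnW jN); pose v := Ordinal jN.
have sub f : commuting j.+1 f -> commuting j f.
  by move=> Hf i ij; apply: Hf; apply: leqW.
apply: (@ext_van_ker _ _ C Cex H H H (commuting j.+1) (commuting j) (commuting j)
  idfun (defect v)) => //.
- exact: commuting_submod.
- exact: commuting_submod.
- by move=> f Hf; apply/(@defect_ker v); [exact: sub | exact: Hf].
- by move=> f Hf d0; exists f; split=> //; apply/(@defect_ker v).
- by move=> f Hf; exact: (@defect_commuting v f Hf).
- by move=> f Hf; have [h [Hh <-]] := @defect_surj v f Hf; exists h.
- exact: (ext_vanS Csh EV).
Qed.

Lemma ext_van_mpoly : ext_van C N [set: (R^o : lmodType R)].
Proof.
have EV := ext_van_commuting (leqnn N).
(* A map commuting with all variables is multiplication by its value at 1, which identifies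
   [commuting N] with the ring. *)
have comm1 f : commuting N f -> forall b, f b = b * f 1.
  move=> Hf b; rewrite [b]mpolyE.
  elim: (msupp b) => [|m s IH]; first by rewrite big_nil khom0 mul0r.
  rewrite big_cons mulrDl khomD IH; congr (_ + _).
  rewrite -mul_mpolyC khomZ /GRing.scale /= -mulrA; congr (_ * _).
  rewrite mpolyXE_id; elim: (index_enum _) => [|i r IHr]; first by rewrite big_nil mul1r.
  rewrite big_cons -mulrA -{}IHr; move: (\prod_(_ <- r) _) => c.
  elim: (m i) => [|d IHd]; first by rewrite expr0 !mul1r.
  by rewrite exprS -!mulrA Hf // IHd.
move=> X CX e _ de; pose u (x : R^o) : H := unit_coind _ x.
have uP x : commuting N (u x) by move=> i _ b; rewrite /= /GRing.scale /= mulrA.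
have [a|a|e' [Ce' He']] := EV X CX (fun a => u (e a)) => //.
  by rewrite -(@mxact_linear _ _ _ (@unit_coind k R _ R^o)) de linear0.
exists (fun a => e' a 1); split=> // a.
have /(congr1 (fun f : H => f 1)) := He' a.
rewrite /= scale1r => ->; rewrite /mxact.
elim: (index_enum _) => [|c r IH]; first by rewrite !big_nil.
by rewrite !big_cons khom_addE IH coind_scaleE mulr1 (comm1 (e' c)).
Qed.
End PolynomialRing.

(** * Cohomology of Hom complexes and connecting homomorphisms *)

Section LinearMaps.
Variable R : comNzRingType.

Lemma linear_ex (G M : lmodType R) (f : G -> M) : linear f ->
  exists h : {linear G -> M}, h =1 f.
Proof.
by move=> Hf; exists (HB.pack_for {linear G -> M} f (GRing.isLinear.Build R G M _ f Hf)).
Qed.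

Definition lifting (G : lmodType R) := forall (I M : lmodType R) (p : {linear I -> M})
  (l : {linear G -> M}), (forall y, exists x, p x = y) ->
  exists l' : {linear G -> I}, forall z, p (l' z) = l z.

Lemma lifting_regular : lifting R^o.
Proof.
move=> I M p l ps; have [x px] := ps (l 1).
have [|h Hh] := @linear_ex R^o I (fun a => a *: x).
  by move=> a b c; rewrite scalerDl scalerA.
by exists h => z; rewrite Hh linearZ px -linearZ /GRing.scale /= mulr1.
Qed.

Lemma lifting_prod (G H : lmodType R) : lifting G -> lifting H -> lifting (G * H)%type.
Proof.
move=> lG lH I M p l ps.
have [|a Ha] := @linear_ex G M (fun x => l (x, 0)).
  move=> c x y; rewrite -linearP.
  by have -> : (c *: x + y, 0) = c *: (x, 0 : H) + (y, 0) by congr pair; rewrite /= scaler0 addr0.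
have [|b Hb] := @linear_ex H M (fun x => l (0, x)).
  move=> c x y; rewrite -linearP.
  by have -> : (0, c *: x + y) = c *: (0 : G, x) + (0, y) by congr pair; rewrite /= scaler0 addr0.
have [a' Ha'] := lG I M p a ps; have [b' Hb'] := lH I M p b ps.
have [|h Hh] := @linear_ex (G * H)%type I (fun z => a' z.1 + b' z.2).
  by move=> c x y /=; rewrite !linearP scalerDr addrACA.
exists h => -[x y]; rewrite Hh linearD Ha' Hb' Ha Hb -linearD; congr (l (_, _)).
  by rewrite addr0.
by rewrite add0r.
Qed.

Lemma lifting_mx p q : lifting 'M[R]_(p, q).
Proof.
move=> I M f l fs.
have [g Hg] := fun_choice (fun ij : 'I_p * 'I_q => fs (l (delta_mx ij.1 ij.2))).
have [|h Hh] := @linear_ex 'M[R]_(p, q) I (fun A => \sum_i \sum_j A i j *: g (i, j)).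
  move=> c A B; rewrite scaler_sumr -big_split; apply: eq_bigr => i _ /=.
  rewrite scaler_sumr -big_split; apply: eq_bigr => j _ /=.
  by rewrite !mxE scalerDl scalerA.
exists h => A; rewrite Hh {2}[A]matrix_sum_delta !linear_sum; apply: eq_bigr => i _ /=.
by rewrite !linear_sum; apply: eq_bigr => j _ /=; rewrite !linearZ /= Hg.
Qed.

Definition cohom_van (G2 G1 G0 : lmodType R) (d' : G2 -> G1) (d : G1 -> G0)
    (M : lmodType R) :=
  forall l : {linear G1 -> M}, (forall y, l (d' y) = 0) ->
  exists u : {linear G0 -> M}, forall z, l z = u (d z).

Lemma inj_cohom_van (G2 G1 G0 : lmodType R) (d' : G2 -> G1) (d : {linear G1 -> G0})
    (M : lmodType R) :
  (forall z, d z = 0 -> exists y, z = d' y) -> inj_ext M -> cohom_van d' d M.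
Proof.
move=> ex IM l ld; have [||h Hh] := IM G0 [set p | exists z, p = (d z, l z)].
- split; first by exists 0; rewrite !linear0.
  by move=> a _ _ [x ->] [y ->]; exists (a *: x + y); rewrite !linearP.
- by move=> y [z [/esym/ex [t ->] ->]].
by exists h => z; apply/esym/Hh; exists z.
Qed.
End LinearMaps.

Section Shift.
Variables (R : comNzRingType) (C I D : lmodType R).
Variables (inj : {linear C -> I}) (pr : {linear I -> D}).
Hypotheses (injP : injective inj) (prK : forall e, pr e = 0 <-> exists x, inj x = e).
Hypothesis prS : forall y, exists x, pr x = y.
Hypothesis II : inj_ext I.

Lemma corestrict (G : lmodType R) (l : {linear G -> I}) : (forall z, pr (l z) = 0) ->
  exists k : {linear G -> C}, forall z, inj (k z) = l z.
Proof.
move=> H; have [g Hg] := fun_choice (fun z => (prK _).1 (H z)).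
have [|h Hh] := @linear_ex R G C g.
  by move=> a x y; apply: injP; rewrite linearP !Hg linearP.
by exists h => z; rewrite Hh Hg.
Qed.

Lemma pr_inj x : pr (inj x) = 0. Proof. by apply/prK; exists x. Qed.

(** The graph of the connecting homomorphism of [0 -> C -> I -> D -> 0]: a lift [t] of the cocycle
    [l] composed with [d] takes its values in [C]. As a relation it is independent of a choice of
    lifts and closed under linear combinations. *)
Definition connected (G2 G1 : lmodType R) (d : G2 -> G1)
    (l : {linear G1 -> D}) (k : {linear G2 -> C}) :=
  exists t : {linear G1 -> I}, (forall z, pr (t z) = l z) /\ forall z, inj (k z) = t (d z).

Variables (G3 G2 G1 G0 : lmodType R).
Variables (d3 : {linear G3 -> G2}) (d2 : {linear G2 -> G1}) (d1 : {linear G1 -> G0}).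
Hypotheses (lG1 : lifting G1) (lG0 : lifting G0).
Hypotheses (d23 : forall z, d2 (d3 z) = 0) (d12 : forall z, d1 (d2 z) = 0).

Lemma connected_down (l : {linear G1 -> D}) : (forall z, l (d2 z) = 0) ->
  exists k : {linear G2 -> C}, connected d2 l k /\ forall z, k (d3 z) = 0.
Proof.
move=> ld; have [t Ht] := lG1 l prS.
have [|s Hs] := @linear_ex R G2 I (fun z => t (d2 z)).
  by move=> a x y; rewrite !linearP.
have [z|k Hk] := corestrict (l := s); first by rewrite Hs Ht ld.
exists k; split; first by exists t; split=> // z; rewrite Hk Hs.
by move=> z; apply: injP; rewrite Hk Hs d23 !linear0.
Qed.

Lemma connected_up (k : {linear G2 -> C}) : (forall z, k (d3 z) = 0) ->
  cohom_van d3 d2 I ->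
  exists l : {linear G1 -> D}, connected d2 l k /\ forall z, l (d2 z) = 0.
Proof.
move=> kd ev; have [|s Hs] := @linear_ex R G2 I (fun z => inj (k z)).
  by move=> a x y; rewrite !linearP.
have [z|t Ht] := ev s; first by rewrite Hs kd linear0.
have [|l Hl] := @linear_ex R G1 D (fun z => pr (t z)).
  by move=> a x y; rewrite !linearP.
exists l; split; first by exists t; split=> z; rewrite ?Hl // -Ht Hs.
by move=> z; rewrite Hl -Ht Hs pr_inj.
Qed.

(** From left to right this is well-definedness on classes, from right to left injectivity, which
    comes from the vanishing for [I]. *)
Lemma connected_bound (l : {linear G1 -> D}) (k : {linear G2 -> C}) :
  connected d2 l k -> cohom_van d2 d1 I ->
  (exists u : {linear G0 -> D}, forall z, l z = u (d1 z)) <->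
  (exists v : {linear G1 -> C}, forall z, k z = v (d2 z)).
Proof.
move=> [t [Ht Hk]] ev; split=> [[u Hu]|[v Hv]].
  have [u' Hu'] := lG0 u prS.
  have [|s Hs] := @linear_ex R G1 I (fun z => t z - u' (d1 z)).
    by move=> a x y; rewrite [t _]linearP [d1 _]linearP [u' _]linearP opprD addrACA scalerBr.
  have [z|v Hv] := corestrict (l := s); first by rewrite Hs linearB Ht Hu' Hu subrr.
  by exists v => z; apply: injP; rewrite Hk Hv Hs d12 linear0 subr0.
have [|s Hs] := @linear_ex R G1 I (fun z => t z - inj (v z)).
  by move=> a x y; rewrite [t _]linearP [v _]linearP [inj _]linearP opprD addrACA scalerBr.
have [z|u' Hu'] := ev s; first by rewrite Hs -Hk Hv subrr.
have [|u Hu] := @linear_ex R G0 D (fun z => pr (u' z)).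
  by move=> a x y; rewrite !linearP.
by exists u => z; rewrite Hu -Hu' Hs linearB pr_inj subr0 Ht.
Qed.

Lemma cohom_van_shift : cohom_van d3 d2 C -> cohom_van d2 d1 I -> cohom_van d2 d1 D.
Proof.
move=> evC evI l ld; have [k [conn kd]] := connected_down ld.
exact: ((connected_bound conn evI).2 (evC k kd)).
Qed.

Lemma connectedP (c : R) (l l' : {linear G1 -> D}) (k k' : {linear G2 -> C})
  (l'' : {linear G1 -> D}) (k'' : {linear G2 -> C}) :
  (forall z, l'' z = c *: l z + l' z) -> (forall z, k'' z = c *: k z + k' z) ->
  connected d2 l k -> connected d2 l' k' -> connected d2 l'' k''.
Proof.
move=> El Ek [t [Ht Hk]] [t' [Ht' Hk']].
have [|s Hs] := @linear_ex R G1 I (fun z => c *: t z + t' z).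
  by move=> a x y; rewrite [t _]linearP [t' _]linearP !scalerDr !scalerA addrACA [c * a]mulrC.
by exists s; split=> z; rewrite Hs ?El ?Ek linearP ?Ht ?Ht' ?Hk ?Hk'.
Qed.
End Shift.

(** * Ext of the quotient by an ideal with a self-dual resolution *)

Section SelfDual.
Variables (k : fieldType) (R : comNzRingType) (i : {rmorphism k -> R}).
Variables (G1 G2 G3 : lmodType R).
Variables (d1 : {linear G1 -> R^o}) (d2 : {linear G2 -> G1}) (d3 : {linear G3 -> G2})
  (d4 : {linear R^o -> G3}).
Hypotheses (lG1 : lifting G1) (lG2 : lifting G2) (lG3 : lifting G3).
Hypotheses (ex1 : forall z, d1 z = 0 -> exists y, z = d2 y)
  (ex2 : forall z, d2 z = 0 -> exists y, z = d3 y)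
  (ex3 : forall z, d3 z = 0 -> exists y, z = d4 y)
  (ex4 : forall z, d4 z = 0 -> z = 0).
Hypotheses (d12 : forall z, d1 (d2 z) = 0) (d23 : forall z, d2 (d3 z) = 0)
  (d34 : forall z, d3 (d4 z) = 0).
Hypotheses (dual1 : cohom_van d2 d1 R^o) (dual2 : cohom_van d3 d2 R^o)
  (dual3 : cohom_van d4 d3 R^o).

Let P : set R := [set a | exists z, a = d1 z].
Hypothesis dual0 : forall y : R, (forall a, P a -> a * y = 0) -> y = 0.
Hypothesis dual4 : forall g : {linear R^o -> R^o},
  (exists v : {linear G3 -> R^o}, forall z, g z = v (d4 z)) <-> P (g 1).

(** The complex is continued by zero, so that degree 4 is treated like the degrees below. *)
Let d5 : {linear R^o -> R^o} := \0.
Let d45 z : d4 (d5 z) = 0. Proof. exact: linear0. Qed.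
Let ex4' z : d4 z = 0 -> exists y, z = d5 y. Proof. by move=> /ex4 ->; exists 0. Qed.

Let lR : lifting R^o := @lifting_regular R.
Local Notation u M := (@unit_coind k R i M).
Local Notation pr M := (@coproj k R i M).
Let uI (M : lmodType R) : injective (u M) := @unit_coind_inj k R i M.
Let prK (M : lmodType R) := @coproj_ker k R i M.
Let prS (M : lmodType R) := @coproj_surj k R i M.
Let II (M : lmodType R) := @coind_inj_ext k R i M.

Let ev1I (M : lmodType R) : cohom_van d2 d1 (khom i M) := inj_cohom_van ex1 (II (M:=M)).
Let ev2I (M : lmodType R) : cohom_van d3 d2 (khom i M) := inj_cohom_van ex2 (II (M:=M)).
Let ev3I (M : lmodType R) : cohom_van d4 d3 (khom i M) := inj_cohom_van ex3 (II (M:=M)).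
Let ev4I (M : lmodType R) : cohom_van d5 d4 (khom i M) := inj_cohom_van ex4' (II (M:=M)).

Let ev1S (M : lmodType R) : cohom_van d3 d2 M -> cohom_van d2 d1 (cokhom i M).
Proof. by move=> ev; apply: (cohom_van_shift (@uI M) (@prK M) (@prS M) lG1 lR d23 d12 ev (@ev1I M)). Qed.
Let ev2S (M : lmodType R) : cohom_van d4 d3 M -> cohom_van d3 d2 (cokhom i M).
Proof. by move=> ev; apply: (cohom_van_shift (@uI M) (@prK M) (@prS M) lG2 lG1 d34 d23 ev (@ev2I M)). Qed.
Let ev3S (M : lmodType R) : cohom_van d5 d4 M -> cohom_van d4 d3 (cokhom i M).
Proof. by move=> ev; apply: (cohom_van_shift (@uI M) (@prK M) (@prS M) lG3 lG2 d45 d34 ev (@ev3I M)). Qed.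
Let ev4S (M : lmodType R) : cohom_van d5 d4 (cokhom i M).
Proof.
move=> l _; have [l' Hl'] := lR l (@prS M).
have [|s Hs] := ev4I (l := l'); first by move=> y; rewrite linear0.
have [|v Hv] := @linear_ex R G3 (cokhom i M) (fun z => pr M (s z)).
  by move=> a x y; rewrite !linearP.
by exists v => z; rewrite Hv -Hs Hl'.
Qed.

Let C1 : lmodType R := cokhom i R^o.
Let C2 : lmodType R := cokhom i C1.
Let C3 : lmodType R := cokhom i C2.
Let C4 : lmodType R := cokhom i C3.

(** Hom from the quotient by [P] into [M], realized inside [M] by evaluation at 1. *)
Let ann (M : lmodType R) : set M := [set x | forall a, P a -> a *: x = 0].
Arguments ann M : clear implicits.

Let P_ideal : is_ideal P.
Proof.
split; first by exists 0; rewrite linear0.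
  by move=> _ _ [x ->] [y ->]; exists (x + y); rewrite linearD.
by move=> a _ [x ->]; exists (a *: x); rewrite linearZ.
Qed.

Lemma ann_submod (M : lmodType R) : submodule (ann M).
Proof.
split; first by move=> a _; rewrite scaler0.
  by move=> x y Hx Hy a Pa; rewrite scalerDr Hx // Hy // addr0.
by move=> a x Hx b Pb; rewrite scalerA mulrC -scalerA Hx // scaler0.
Qed.

Lemma ann_torsion (M : lmodType R) : torsion P (ann M).
Proof. by move=> a x Pa; apply. Qed.

Lemma ann_proj (M : lmodType R) x : ann (khom i M) x -> ann (cokhom i M) (pr M x).
Proof. by move=> Hx a Pa; rewrite -linearZ Hx // linear0. Qed.

Lemma ann_unit (M : lmodType R) x : ann M x -> ann (khom i M) (u M x).
Proof. by move=> Hx a Pa; rewrite -linearZ Hx // linear0. Qed.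

Lemma ann_exact (M : lmodType R) y : ann (khom i M) y -> pr M y = 0 ->
  exists x, ann M x /\ u M x = y.
Proof.
move=> Hy /prK [x Hx]; exists x; split=> // a Pa; apply: (@uI M).
by rewrite linearZ /= Hx Hy // linear0.
Qed.

Lemma ann_point (M : lmodType R) (y : M) : ann M y ->
  exists l : {linear R^o -> M}, l 1 = y /\ forall z, l (d1 z) = 0.
Proof.
move=> Hy; have [|l Hl] := @linear_ex R R^o M (fun a => a *: y).
  by move=> a b c; rewrite scalerDl scalerA.
by exists l; split=> [|z]; rewrite Hl ?scale1r // Hy //; exists z.
Qed.

Lemma point_scale (M : lmodType R) (l : {linear R^o -> M}) a : l a = a *: l 1.
Proof. by rewrite -linearZ /GRing.scale /= mulr1. Qed.

(** The counterpart of [connected_bound] in degree 0, where a cocycle is an element killed by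
    [P]. *)
Lemma ann_lift (M : lmodType R) (l : {linear R^o -> cokhom i M}) (g : {linear G1 -> M}) :
  connected (u M) (pr M) d1 l g ->
  (exists x, ann (khom i M) x /\ pr M x = l 1) <->
  exists v : {linear R^o -> M}, forall z, g z = v (d1 z).
Proof.
move=> [t [Ht Hg]]; split=> [[x [Hx pxy]]|[v Hv]].
  have [|s Hs] := @linear_ex R R^o (khom i M) (fun a => t a - a *: x).
    by move=> a b c; rewrite [t _]linearP scalerDl opprD addrACA scalerBr scalerA.
  have [z|v Hv] := corestrict (@uI M) (@prK M) (l := s).
    by rewrite Hs linearB linearZ /= Ht pxy (point_scale l) subrr.
  exists v => z; apply: (@uI M); rewrite Hv Hs Hg Hx ?subr0 //.
  by exists z.
exists (t 1 - u M (v 1)); split.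
  move=> _ [z ->]; rewrite scalerBr -(point_scale t) -Hg Hv (point_scale v).
  by apply/eqP; rewrite subr_eq0; apply/eqP; exact: (linearZ_LR (u M)).
by rewrite linearB Ht; move: (pr_inj (@prK M) (v 1)) => /= ->; rewrite subr0.
Qed.

Lemma ann_surj (M : lmodType R) : cohom_van d2 d1 M ->
  forall y, ann (cokhom i M) y -> exists x, ann (khom i M) x /\ pr M x = y.
Proof.
move=> ev y Hy; have [l [<- ld]] := ann_point Hy.
have [g [conn gd]] := connected_down (@uI M) (@prK M) (@prS M) lR d12 ld.
by apply/(ann_lift conn); exact: ev.
Qed.

(* The composite of the connecting isomorphisms from degree 0 to degree 4. *)
Definition conn (y : C4) (a : R) :=
  exists (l0 : {linear R^o -> C4}) (l1 : {linear G1 -> C3}) (l2 : {linear G2 -> C2})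
    (l3 : {linear G3 -> C1}) (l4 : {linear R^o -> R^o}),
    [/\ l0 1 = y /\ l4 1 = a, connected (u C3) (pr C3) d1 l0 l1,
      connected (u C2) (pr C2) d2 l1 l2, connected (u C1) (pr C1) d3 l2 l3 &
      connected (u R^o) (pr R^o) d4 l3 l4].

Lemma conn_total y : ann C4 y -> exists a, conn y a.
Proof.
move=> /ann_point [l0 [y0 z0]].
have [l1 [c1 z1]] := connected_down (@uI C3) (@prK C3) (@prS C3) lR d12 z0.
have [l2 [c2 z2]] := connected_down (@uI C2) (@prK C2) (@prS C2) lG1 d23 z1.
have [l3 [c3 z3]] := connected_down (@uI C1) (@prK C1) (@prS C1) lG2 d34 z2.
have [l4 [c4 z4]] := connected_down (@uI R^o) (@prK R^o) (@prS R^o) lG3 d45 z3.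
by exists (l4 1), l0, l1, l2, l3, l4.
Qed.

Lemma conn_onto a : exists y, ann C4 y /\ conn y a.
Proof.
have [|l4 H4] := @linear_ex R R^o R^o (fun x => x * a).
  by move=> c x y; rewrite mulrDl -mulrA.
have z4 z : l4 (d5 z) = 0 by rewrite linear0.
have [l3 [c3 z3]] := connected_up (@prK R^o) z4 (@ev4I R^o).
have [l2 [c2 z2]] := connected_up (@prK C1) z3 (@ev3I C1).
have [l1 [c1 z1]] := connected_up (@prK C2) z2 (@ev2I C2).
have [l0 [c0 z0]] := connected_up (@prK C3) z1 (@ev1I C3).
exists (l0 1); split; first by move=> _ [z ->]; rewrite -point_scale z0.
by exists l0, l1, l2, l3, l4; split=> //; split=> //; rewrite H4 mul1r.
Qed.

(** Thus [ann C4] modulo the image of [ann (khom i C3)] is the fourth Ext of the quotient by [P]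
    with values in [R^o], and [dual4] identifies it with that quotient. *)
Lemma conn_bound y a : conn y a ->
  (exists x, ann (khom i C3) x /\ pr C3 x = y) <-> P a.
Proof.
move=> [l0 [l1 [l2 [l3 [l4 [[<- <-] c0 c1 c2 c3]]]]]]; rewrite -dual4.
rewrite (ann_lift c0) (connected_bound (@uI C2) (@prK C2) (@prS C2) lR d12 c1 (@ev1I C2)).
rewrite (connected_bound (@uI C1) (@prK C1) (@prS C1) lG1 d23 c2 (@ev2I C1)).
by rewrite (connected_bound (@uI R^o) (@prK R^o) (@prS R^o) lG2 d34 c3 (@ev3I R^o)).
Qed.

Lemma conn_linear c y y' a a' : conn y a -> conn y' a' -> conn (c *: y + y') (c * a + a').
Proof.
move=> [l0 [l1 [l2 [l3 [l4 [[<- <-] c0 c1 c2 c3]]]]]].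
move=> [m0 [m1 [m2 [m3 [m4 [[<- <-] e0 e1 e2 e3]]]]]].
have comb (G M : lmodType R) (l m : {linear G -> M}) :
    exists n : {linear G -> M}, forall z, n z = c *: l z + m z.
  have [|n Hn] := @linear_ex R G M (fun z => c *: l z + m z).
    by move=> x s t; rewrite [l _]linearP [m _]linearP !scalerDr !scalerA addrACA [c * x]mulrC.
  by exists n.
have [n0 h0] := comb _ _ l0 m0; have [n1 h1] := comb _ _ l1 m1.
have [n2 h2] := comb _ _ l2 m2; have [n3 h3] := comb _ _ l3 m3.
have [n4 h4] := comb _ _ l4 m4.
exists n0, n1, n2, n3, n4; split; first by rewrite h0 h4.
- exact: (connectedP h0 h1 c0 e0).
- exact: (connectedP h1 h2 c1 e1).
- exact: (connectedP h2 h3 c2 e2).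
- exact: (connectedP h3 h4 c3 e3).
Qed.

Section Conclusion.
Variable C : set (resolution R).
Hypothesis Cex : forall X, C X -> exact_mod P X.
Hypothesis Csh : forall X, C X -> C (shift X).

Lemma ext_van_annI (M : lmodType R) j : ext_van C j (ann (khom i M)).
Proof. by apply: (ext_van_leq Csh (leq0n j)); apply: inj_ext_van. Qed.

Lemma ext_van_image (M : lmodType R) j : (forall j, ext_van C j (ann M)) ->
  ext_van C j (fun y => exists x, ann (khom i M) x /\ pr M x = y).
Proof.
move=> EM; apply: (@ext_van_coker _ _ C Cex M (khom i M) (cokhom i M)
  (ann M) (ann (khom i M)) _ (u M) (pr M)).
- exact: ann_submod.
- exact: ann_submod.
- exact: ann_torsion.
- by move=> x _; rewrite -(linear0 (u M)) => /uI.
- exact: ann_unit.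
- by move=> x _; exact: (pr_inj (@prK M)).
- by move=> y; exact: ann_exact.
- by move=> y Hy; exists y.
- by [].
- exact: ext_van_annI.
- exact: EM.
Qed.

Lemma ext_van_ann_coker (M : lmodType R) : cohom_van d2 d1 M ->
  (forall j, ext_van C j (ann M)) -> forall j, ext_van C j (ann (cokhom i M)).
Proof.
move=> ev EM j; have -> : ann (cokhom i M) = (fun y => exists x, ann (khom i M) x /\ pr M x = y).
  apply/funext => y; apply/propext; split=> [|[x [Hx <-]]]; first exact: ann_surj.
  exact: ann_proj.
exact: ext_van_image.
Qed.

Lemma ann_regular : ann R^o = [set 0].
Proof.
apply/seteqP; split=> [y Hy|_ -> a _]; last by rewrite scaler0.
exact: dual0.
Qed.

Lemma ext_van_ann0 j : ext_van C j (ann R^o).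
Proof.
rewrite ann_regular => X CX e e0 _; exists (fun=> 0); split=> // a.
by rewrite e0 /mxact big1 // => b _; rewrite scaler0.
Qed.

(** The dual complex is exact below degree 4. Taking the elements killed by [P] therefore keeps the
    first three coinduced sequences exact, and they start from [ann R^o], which is zero. *)
Lemma ext_van_ann3 j : ext_van C j (ann C3).
Proof.
apply: ext_van_ann_coker; first exact: ev1S (ev2S dual3).
apply: ext_van_ann_coker; first exact: ev1S dual2.
by apply: ext_van_ann_coker => //; exact: ext_van_ann0.
Qed.

Lemma dual_cosyzygy (M : lmodType R) :
  cohom_van d2 d1 M -> cohom_van d3 d2 M -> cohom_van d4 d3 M -> cohom_van d5 d4 M ->
  forall n, inj_ext (cosyzygy i n M) -> ext_van C n (ann M).
Proof.
move=> e1 e2 e3 e4 n; elim: n M e1 e2 e3 e4 => [|n IH] M e1 e2 e3 e4 /= IM.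
  exact: inj_ext_van.
have {IH} EC := IH _ (ev1S e2) (ev2S e3) (ev3S e4) (@ev4S M) IM.
apply: (@ext_van_ker _ _ C Cex M (khom i M) (cokhom i M)
  (ann M) (ann (khom i M)) (ann (cokhom i M)) (u M) (pr M)).
- exact: ann_submod.
- exact: ann_submod.
- exact: ann_torsion.
- by move=> x _; rewrite -(linear0 (u M)) => /uI.
- exact: ann_unit.
- by move=> x _; exact: (pr_inj (@prK M)).
- by move=> y; exact: ann_exact.
- exact: ann_proj.
- exact: ann_surj.
- exact: ext_van_annI.
- exact: EC.
Qed.

(** The quotient by [P] is [ann C4] modulo an image without higher cohomology, so the vanishing for
    [ann C4], inherited from its injective cosyzygy, passes to the quotient. *)
Lemma ext_van_quotient n : inj_ext (cosyzygy i n C4) ->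
  forall X, C X -> forall j (e : 'I_(rk X j.+1) -> R), (n <= j)%N ->
  (forall a, P (mxact (M := R^o) (dmx X j.+1) e a)) ->
  exists e', forall a, P (e a - mxact (M := R^o) (dmx X j) e' a).
Proof.
move=> In X CX j e nj Pe.
have EV4 : ext_van C j (ann C4).
  apply: ext_van_leq nj _ => //; apply: dual_cosyzygy => //.
  - exact: ev1S (ev2S (ev3S (@ev4S R^o))).
  - exact: ev2S (ev3S (@ev4S C1)).
  - exact: ev3S (@ev4S C2).
  - exact: ev4S.
have EI j0 : ext_van C j0 _ := ext_van_image (M := C3) ext_van_ann3.
have sI : submodule (fun y => exists x, ann (khom i C3) x /\ pr C3 x = y).
  have [S0 SD SZ] := @ann_submod (khom i C3).
  split; first by exists 0; split=> //; exact: (linear0 (pr C3)).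
    by move=> _ _ [x [Hx <-]] [x' [Hx' <-]]; exists (x + x'); split; [exact: SD|exact: (linearD (pr C3))].
  by move=> a _ [x [Hx <-]]; exists (a *: x); split; [exact: SZ|exact: (linearZ_LR (pr C3))].
have Isub y : (exists x, ann (khom i C3) x /\ pr C3 x = y) -> ann C4 y.
  by move=> [x [Hx <-]]; exact: ann_proj.
have conn0 : conn 0 0.
  have [z [_ Hz]] := conn_onto 0.
  by have := conn_linear (-1) Hz Hz; rewrite scaleN1r addNr mulN1r addNr.
have conn_mx p q (A : 'M_(p, q)) y f a : (forall b, conn (y b) (f b)) ->
    conn (mxact A y a) (mxact (M := R^o) A f a).
  move=> H; rewrite /mxact; elim: (index_enum _) => [|b r IH]; first by rewrite !big_nil.
  by rewrite !big_cons; apply: conn_linear.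
have connB y y' a a' : conn y a -> conn y' a' -> conn (y - y') (a - a').
  by move=> H H'; have := conn_linear (-1) H' H; rewrite scaleN1r mulN1r addrC [- a' + a]addrC.
(* The cochain [e] is replaced by a cochain [y] in [ann C4]; by [conn_bound], the coboundary of [e]
   lies in [P] exactly when that of [y] comes from [ann (khom i C3)]. *)
have [y Hy'] := fun_choice (fun a => conn_onto (e a)).
have Hy a : conn (y a) (e a) by case: (Hy' a).
have Hy1 a : ann C4 (y a) by case: (Hy' a).
have Iw a : exists x, ann (khom i C3) x /\ pr C3 x = mxact (dmx X j.+1) y a.
  by apply/(conn_bound (conn_mx _ _ (dmx X j.+1) y e a Hy)).
have [a|y' [Iy' Ey']] := EI j.+1 X CX _ Iw.
  by apply: (@mxact_comp _ P C Cex X j.+1 C4 (ann C4) y a CX (@ann_torsion C4)).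
have [|a|g [Ig Eg]] := EV4 X CX (fun a => y a - y' a).
- by move=> a; apply: (submodB (@ann_submod C4)); [exact: Hy1|exact: Isub].
- by rewrite mxactB Ey' subrr.
have [f Hf] := fun_choice (fun a => conn_total (Ig a)).
have [p Hp] := fun_choice (fun a => conn_total (Isub _ (Iy' a))).
exists f => a; have Pp : P (p a) by apply/(conn_bound (Hp a)).
have H := connB _ _ _ _ (connB _ _ _ _ (Hy a) (Hp a)) (conn_mx _ _ (dmx X j) g f a Hf).
have : P (e a - p a - mxact (M := R^o) (dmx X j) f a).
  apply/(conn_bound H); rewrite Eg subrr; case: sI => S0 _ _; exact: S0.
by move=> /(idealD P_ideal Pp); rewrite addrA [p a + _]addrC subrK.
Qed.
End Conclusion.
End SelfDual.

Lemma cosyzygyS (k : fieldType) (B : comNzRingType) (i : {rmorphism k -> B}) n (M : lmodType B) :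
  cosyzygy i n.+1 M = cosyzygy i n (cokhom i M).
Proof. by []. Qed.

(** * Self-duality under the trace form *)

Section GNDuality.
Variables (T : comNzRingType) (m : nat) (X : 'M[T]_m).
Local Notation M := 'M[T]_m.

Lemma trace_form (l : {linear M -> T^o}) : exists A, forall N, l N = \tr (N *m A).
Proof.
exists (\matrix_(a, b) l (delta_mx b a)) => N.
rewrite {1}[N]matrix_sum_delta linear_sum; apply: eq_bigr => a _ /=.
rewrite linear_sum mxE; apply: eq_bigr => b _ /=.
by rewrite linearZ mxE.
Qed.

Lemma trace_form_pair (l : {linear (M * T^o)%type -> T^o}) :
  exists p : (M * T^o)%type, forall z, l z = \tr (z.1 *m p.1) + z.2 * p.2.
Proof.
have [|h Hh] := @linear_ex T M T^o (fun N => l (N, 0)).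
  move=> a N N'; rewrite -linearP.
  by have -> : (a *: N + N', 0) = a *: (N, 0 : T^o) + (N', 0) by congr pair; rewrite /= scaler0 addr0.
have [A HA] := trace_form h.
exists (A, l (0, 1)) => -[N r] /=; rewrite -HA Hh.
have -> : (N, r) = (N, 0) + r *: (0, 1) :> (M * T^o)%type.
  by congr pair; rewrite /= ?scaler0 ?addr0 // add0r /GRing.scale /= mulr1.
by rewrite linearD linearZ.
Qed.

Lemma trace_form_mx2 (l : {linear (M * M)%type -> T^o}) :
  exists p : (M * M)%type, forall z, l z = \tr (z.1 *m p.1) - \tr (z.2 *m p.2).
Proof.
have [|h Hh] := @linear_ex T M T^o (fun N => l (N, 0)).
  move=> a N N'; rewrite -linearP.
  by have -> : (a *: N + N', 0) = a *: (N, 0 : M) + (N', 0) by congr pair; rewrite /= scaler0 addr0.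
have [|h' Hh'] := @linear_ex T M T^o (fun N => l (0, N)).
  move=> a N N'; rewrite -linearP.
  by have -> : (0, a *: N + N') = a *: (0 : M, N) + (0, N') by congr pair; rewrite /= scaler0 addr0.
have [A HA] := trace_form h; have [B HB] := trace_form h'.
exists (A, - B) => -[U V] /=; rewrite mulmxN raddfN /= opprK -HA Hh -HB Hh'.
by rewrite -linearD; congr (l (_, _)); rewrite /= ?addr0 ?add0r.
Qed.

Lemma trace_nondeg (A : M) : (forall N, \tr (N *m A) = 0) -> A = 0.
Proof.
move=> H; apply/matrixP => a b; rewrite mxE -(H (delta_mx b a)).
rewrite /mxtrace (bigD1 b) //= mxE (bigD1 a) //= mxE !eqxx mul1r.
rewrite !big1 ?addr0 // => [c cb|c ca].
  by rewrite mxE big1 // => d _; rewrite mxE (negPf cb) mul0r.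
by rewrite mxE (negPf ca) andbF mul0r.
Qed.

Hypotheses (ex1 : forall z, gn1 X z = 0 -> exists y, z = gn2 X y)
  (ex2 : forall z, gn2 X z = 0 -> exists y, z = gn3 X y)
  (ex3 : forall z, gn3 X z = 0 -> exists y, z = gn4 X y)
  (ex4 : forall z, gn4 X z = 0 -> z = 0).

(** The pairing on [M * M] takes a minus sign on the second factor. With it [gn2] and [gn3] are
    adjoint; [gn1] and [gn4] are adjoint as well, so the dual of the complex is the complex
    itself. *)
Lemma gn12_pairing U V N r :
  \tr ((gn2 X (U, V)).1 *m N) + (gn2 X (U, V)).2 * r =
  \tr (U *m (gn3 X (N, r)).1) - \tr (V *m (gn3 X (N, r)).2).
Proof.
rewrite /gn2 /gn3 /= mulmxBl !mulmxDr raddfB /= !raddfD /= !mul_mx_scalar !mxtraceZ.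
rewrite -!mulmxA (mxtrace_mulC X) -mulmxA; ring.
Qed.

Lemma gn1_dual : cohom_van (gn2 X) (gn1 X) (T^o : lmodType T).
Proof.
move=> l ld; have [[N r] Hl] := trace_form_pair l.
have [s Hs] : exists s, (N, r) = gn4 X s.
  apply: ex3; have H U V : \tr (U *m (gn3 X (N, r)).1) - \tr (V *m (gn3 X (N, r)).2) = 0.
    by rewrite -gn12_pairing -(Hl (gn2 X (U, V))) ld.
  rewrite [LHS]surjective_pairing; move: (gn3 X _) H => Q H.
  congr pair; apply: trace_nondeg => U.
    have := H U 0; rewrite [0 *m _]mul0mx linear0 subr0; exact.
  by have /eqP := H 0 U; rewrite mul0mx linear0 sub0r oppr_eq0 => /eqP.
have [|u Hu] := @linear_ex T T^o T^o (fun z => s * z).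
  by move=> a x y; rewrite mulrDr mulrCA.
exists u => -[A b]; rewrite Hu Hl; case: Hs => -> -> /=.
rewrite /gn1 /= -scalemxAr mxtraceZ mxtrace_mulC; ring.
Qed.

Lemma gn2_dual : cohom_van (gn3 X) (gn2 X) (T^o : lmodType T).
Proof.
move=> l ld; have [[A B] Hl] := trace_form_mx2 l.
have E N r : l (gn3 X (N, r)) = \tr (N *m (gn2 X (A, B)).1) + r * (gn2 X (A, B)).2.
  rewrite Hl mxtrace_mulC [\tr (_ *m B)]mxtrace_mulC -gn12_pairing mxtrace_mulC; ring.
have [[N r] Hs] : exists s, (A, B) = gn3 X s.
  apply: ex2; rewrite [LHS]surjective_pairing; congr pair.
    apply: trace_nondeg => N; have := ld (N, 0); rewrite E mul0r addr0; exact.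
  by have := ld (0, 1); rewrite E mul0mx linear0 add0r mul1r.
have [|u Hu] := @linear_ex T (M * T^o)%type T^o (fun z => \tr (z.1 *m N) + z.2 * r).
  move=> a [x y] [x' y'] /=; rewrite mulmxDl raddfD /= -scalemxAl mxtraceZ /GRing.scale /=; ring.
by exists u => -[U V]; rewrite Hu; have -> := gn12_pairing U V N r; rewrite -Hs Hl.
Qed.

Lemma gn3_dual : cohom_van (gn4 X) (gn3 X) (T^o : lmodType T).
Proof.
move=> l ld; have [[A b] Hl] := trace_form_pair l.
have [[U V] Hs] : exists s, (A, b) = gn2 X s.
  apply: ex1; have := ld 1; rewrite Hl /gn4 /gn1 /= scale1r mul1r => E; rewrite -[RHS]E; ring.
have [|u Hu] := @linear_ex T (M * M)%type T^o (fun z => \tr (z.1 *m U) - \tr (z.2 *m V)).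
  move=> a [x y] [x' y'] /=; rewrite !mulmxDl !raddfD /= -!scalemxAl !mxtraceZ /GRing.scale /=; ring.
exists u => -[N r]; rewrite Hu mxtrace_mulC [\tr (_ *m V)]mxtrace_mulC -gn12_pairing Hl -Hs /=.
rewrite mxtrace_mulC; ring.
Qed.

Lemma gn4_dual (g : {linear T^o -> T^o}) :
  (exists v : {linear (M * T^o)%type -> T^o}, forall z, g z = v (gn4 X z)) <->
  exists z, g 1 = gn1 X z.
Proof.
split=> [[v Hv]|[[A b] Hg]].
  have [[A b] Hl] := trace_form_pair v; exists (A, b).
  rewrite Hv Hl /gn4 /gn1 /= scale1r; ring.
have [|v Hv] := @linear_ex T (M * T^o)%type T^o (fun z => \tr (z.1 *m A) + z.2 * b).
  move=> a [x y] [x' y'] /=; rewrite mulmxDl raddfD /= -scalemxAl mxtraceZ /GRing.scale /=; ring.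
exists v => z; rewrite Hv.
have -> : g z = z * g 1 by rewrite -[in LHS](mulr1 z); exact: (linearZ_LR g).
rewrite Hg /gn1 /gn4 /= -scalemxAl mxtraceZ; ring.
Qed.

Lemma gn1_faithful (y : T) : (forall a : T, (exists z, a = gn1 X z) -> a * y = 0) -> y = 0.
Proof.
move=> H; apply: ex4; rewrite /gn4; congr pair.
  apply/matrixP => a b; rewrite [LHS]mxE [RHS]mxE mulrC; apply: H.
  exists (delta_mx b a, 0); rewrite /gn1 /= mulr0 subr0.
  have [A HA] : exists A, A = \adj X by exists (\adj X).
  rewrite -HA /mxtrace (bigD1 a) //= mxE (bigD1 b) //= mxE !eqxx mulr1.
  rewrite !big1 ?addr0 // => [c ca|c cb].
    by rewrite mxE big1 // => d _; rewrite mxE (negPf ca) andbF mulr0.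
  by rewrite mxE (negPf cb) mulr0.
apply/eqP; rewrite oppr_eq0 mulrC; apply/eqP; apply: H.
by exists (0, -1); rewrite /gn1 /= mulmx0 linear0 mulrN1 opprK add0r.
Qed.

Lemma gn_ext_van (k : fieldType) (i : {rmorphism k -> T}) (C : set (resolution T)) n :
  (forall Y, C Y -> exact_mod [set a : T | exists z, a = gn1 X z] Y) ->
  (forall Y, C Y -> C (shift Y)) ->
  inj_ext (cosyzygy i n.+4 (T^o : lmodType T)) ->
  forall Y, C Y -> forall j (e : 'I_(rk Y j.+1) -> T), (n <= j)%N ->
  (forall a, exists z, mxact (M := T^o) (dmx Y j.+1) e a = gn1 X z) ->
  exists e', forall a, exists z, e a - mxact (M := T^o) (dmx Y j) e' a = gn1 X z.
Proof.
move=> Cex Csh In Y CY j e nj He.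
have l1 : lifting (M * T^o)%type := lifting_prod (@lifting_mx T m m) (@lifting_regular T).
have l2 : lifting (M * M)%type := lifting_prod (@lifting_mx T m m) (@lifting_mx T m m).
have H := @ext_van_quotient k T i (M * T^o)%type (M * M)%type (M * T^o)%type
  (gn1 X) (gn2 X) (gn3 X) (gn4 X) l1 l2 l1 ex1 ex2 ex3 ex4.
have {}H := H (@gn12 T m X) (@gn23 T m X) (@gn34 T m X).
have {}H := H gn1_dual gn2_dual gn3_dual.
have {}H := H gn1_faithful.
have {}H := H gn4_dual.
have {}H := H C Cex Csh n.
have {}H := H ltac:(move: In; rewrite !cosyzygyS; timeout 20 exact).
exact: (H Y CY j e nj He).
Qed.
End GNDuality.

(** * Hilbert's basis theorem and existence of resolutions *)

Section HilbertBasis.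
Import Order.TTheory.

Lemma dickson N (A : set 'X_{1..N}) :
  exists2 s : seq 'X_{1..N}, (forall b, b \in s -> A b) &
    forall a, A a -> exists2 b, b \in s & (b <= a)%MM.
Proof.
(* Induction on the number [j] of coordinates in which exponents are compared. *)
suff H j : (j <= N)%N -> forall A : set 'X_{1..N}, exists2 s : seq 'X_{1..N}, (forall b, b \in s -> A b) &
    forall a, A a -> exists2 b, b \in s & forall i : 'I_N, (i < j)%N -> (b i <= a i)%N.
  have [s sA Hs] := H N (leqnn N) A; exists s => // a /Hs [b bs Hb].
  by exists b => //; apply/mnm_lepP => i; apply: Hb.
elim: j {A} => [|j IH] jN A.
  have [[a Aa]|nA] := pselect (exists a, A a).
    by exists [:: a] => [b|b _]; [rewrite inE => /eqP ->|exists a; rewrite ?inE].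
  by exists [::] => // a Aa; case: nA; exists a.
pose v := Ordinal jN; have [s sA Hs] := IH (ltnW jN) A.
(* From [top] on, the list [s] is also good in coordinate [v]; below it, each of the finitely many
   values of that coordinate gets its own list. *)
pose top := (\max_(b <- s) b v)%N.
have [t Ht] := fun_choice (fun c : nat => let: ex_intro2 t t1 t2 := IH (ltnW jN) [set a | A a /\ a v = c] in ex_intro _ t (conj t1 t2)).
exists (s ++ flatten [seq t c | c <- iota 0 top]).
  move=> b; rewrite mem_cat => /orP[/sA //|/flatten_mapP [c _ bt]].
  by have [/(_ b bt) [] ] := Ht c.
move=> a Aa; have [atop|atop] := leqP top (a v).
  have [b bs Hb] := Hs a Aa; exists b; first by rewrite mem_cat bs.
  move=> i; rewrite ltnS leq_eqVlt => /orP[/eqP iv|]; last exact: Hb.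
  have -> : i = v by apply: val_inj.
  apply: leq_trans atop; rewrite /top.
  exact: (@leq_bigmax_seq _ s xpredT (fun b : 'X_{1..N} => b v) b bs isT).
have [tA Hta] := Ht (a v); have [|b bt Hb] := Hta a; first by split.
exists b; first by rewrite mem_cat; apply/orP; right; apply/flatten_mapP; exists (a v); rewrite ?mem_iota.
move=> i; rewrite ltnS leq_eqVlt => /orP[/eqP iv|]; last exact: Hb.
have -> : i = v by apply: val_inj.
by have [_ ->] := tA b bt.
Qed.

Definition fin_generated (R : comNzRingType) := forall I : set R, is_ideal I ->
  exists n (g : 'I_n -> R), forall a, I a <-> exists v : 'I_n -> R, a = \sum_i v i * g i.

Lemma mpoly_fin_generated (k : fieldType) N : fin_generated {mpoly k[N]}.
Proof.
move=> I iI.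
have [s sA Hs] := dickson [set m | exists p, [/\ I p, p != 0 & mlead p = m]].
have [g Hg] := fun_choice (fun i : 'I_(size s) => sA (nth 0%MM s i) (mem_nth _ (ltn_ord i))).
exists (size s), g => a; split=> [|[v ->]]; last first.
  by apply: ideal_sum => // i _; apply: idealMl => //; case: (Hg i).
have [l El] : exists l, l = mlead a by exists (mlead a).
elim/mleadrect: a l El => a IH l El Ia.
have [->|a0] := eqVneq a 0; first by exists (fun=> 0); rewrite big1 // => i _; rewrite mul0r.
have [|b bs ba] := Hs l; first by exists a.
have [i Ei] : exists i : 'I_(size s), nth 0%MM s i = b.
  by have H := bs; rewrite -index_mem in H; exists (Ordinal H); rewrite /= nth_index.
have [Ig g0 gb] := Hg i; rewrite Ei in gb.
pose q := (mleadc a / mleadc (g i)) *: ('X_[l - b] * g i).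
have c0 : mleadc a / mleadc (g i) != 0 by rewrite mulf_neq0 ?invr_neq0 ?mleadc_eq0.
have X0 : 'X_[l - b] != 0 :> {mpoly k[N]} by rewrite -mleadc_eq0 mleadXm mcoeffX eqxx oner_eq0.
have lq : mlead q = l.
  rewrite /q mleadZ // mleadM // mleadXm gb submK //.
have cq : q@_l = a@_l.
  rewrite /q mcoeffZ; have := mleadcM 'X_[l - b] (g i).
  rewrite mleadXm gb submK // mcoeffX eqxx mul1r => ->; rewrite El -gb divfK //.
  by rewrite mleadc_eq0.
have qg : q = ((mleadc a / mleadc (g i)) *: 'X_[l - b]) * g i by rewrite -scalerAl.
have Ir : I (a - q) by apply: idealB => //; rewrite qg; apply: idealMl.
have Eq : q = \sum_j (if j == i then (mleadc a / mleadc (g i)) *: 'X_[l - b] else 0) * g j.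
  rewrite (bigD1 i) //= eqxx big1 ?addr0 -?qg //.
  by move=> j /negPf ->; rewrite mul0r.
have [E|r0] := eqVneq (a - q) 0.
  by eexists; apply: etrans Eq; apply/eqP; rewrite -subr_eq0 E.
have lt : (mlead (a - q)%R < l)%O.
  rewrite lt_neqAle; apply/andP; split.
    apply: contra_neq r0 => e; apply/eqP; rewrite -mleadc_eq0 e mcoeffB cq subrr //.
  by apply: le_trans (mleadB_le _ _) _; rewrite -El lq joinxx.
have [v Ev] := IH (a - q) (eq_ind _ (fun t => (_ < t)%O) lt _ El) _ erefl Ir.
exists (fun j => v j + if j == i then (mleadc a / mleadc (g i)) *: 'X_[l - b] else 0).
under eq_bigr do rewrite mulrDl.
by rewrite big_split /= -Eq -Ev subrK.
Qed.

End HilbertBasis.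

Section Resolutions.
Variable R : comNzRingType.
Hypothesis noeth : fin_generated R.

Lemma fin_generated_submod r (S : set 'rV[R]_r) : submodule S ->
  exists n (g : 'M_(n, r)), forall v, S v <-> exists w, v = w *m g.
Proof.
elim: r S => [S [S0 _ _]|r IH].
  exists 0%N, 0 => v; split=> [_|_]; first by exists 0; apply/rowP => -[].
  by have -> : v = 0 by apply/rowP => -[].
rewrite -[r.+1]/(1 + r)%N => S [S0 SD SZ].
have [|n [g Hg]] := noeth (I := [set a | exists2 v : 'rV_(1 + r), S v & v 0 0 = a]).
  split; first by exists 0; rewrite ?mxE.
    by move=> _ _ [v Sv <-] [w Sw <-]; exists (v + w); rewrite ?mxE //; exact: SD.
  by move=> a _ [v Sv <-]; exists (a *: v); rewrite ?mxE //; exact: SZ.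
have gI i : exists v : 'rV[R]_(1 + r), S v /\ v 0 0 = g i.
  have [|v Sv <-] := (Hg (g i)).2; last by exists v.
  by exists (fun j => (j == i)%:R); rewrite (bigD1 i) //= eqxx mul1r big1 ?addr0 // => j /negPf ->; rewrite mul0r.
have [L HL] := fun_choice gI.
have [|q [G HG]] := IH [set u | S (row_mx (0 : 'rV_1) u)].
  split; first by rewrite /= row_mx0.
    move=> x y Sx Sy /=; have := SD _ _ Sx Sy.
    by rewrite add_row_mx addr0.
  by move=> a x Sx /=; have := SZ a _ Sx; rewrite scale_row_mx scaler0.
exists (n + q)%N, (col_mx (\matrix_(i < n) L i) (row_mx (0 : 'M_(q, 1)) G)) => v.
have SM p (w : 'rV_p) (F : 'M_(p, 1 + r)) : (forall i, S (row i F)) -> S (w *m F).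
  move=> SF; rewrite mulmx_sum_row; elim: (index_enum _) => [|b s IHs]; first by rewrite big_nil.
  by rewrite big_cons; apply: SD => //; apply: SZ.
split=> [Sv|[w ->]]; last first.
  rewrite -[w]hsubmxK mul_row_col; apply: SD; apply: SM => i.
    by rewrite rowK; case: (HL i).
  rewrite row_row_mx row0; apply/HG; exists (delta_mx 0 i); exact: rowE.
have [c Hc] := (Hg (v 0 0)).1 (ex_intro2 _ _ v Sv erefl).
pose v1 : 'rV[R]_(1 + r) := v - (\row_i c i) *m (\matrix_(i < n) L i).
have Sv1 : S v1.
  rewrite /v1 -scaleN1r; apply: SD => //; apply: SZ; apply: SM => i.
  by rewrite rowK; case: (HL i).
have Ev1 : v1 = row_mx 0 (rsubmx v1).
  rewrite -{1}[v1]hsubmxK; congr row_mx; apply/rowP => j; rewrite ord1 !mxE /=.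
  have -> : lshift r (0 : 'I_1) = 0 by apply: val_inj.
  rewrite Hc; apply/eqP; rewrite subr_eq0; apply/eqP; apply: eq_bigr => i _.
  by rewrite !mxE (HL i).2.
have [w Hw] : exists w, rsubmx v1 = w *m G by apply/HG; rewrite /= -Ev1.
exists (row_mx (\row_i c i) w); rewrite mul_row_col mul_mx_row mulmx0 -Hw -Ev1.
by rewrite /v1 addrC subrK.
Qed.

Variables (P : set R).
Hypothesis iP : is_ideal P.

Lemma syzygies p r (d : 'M[R]_(p, r)) :
  exists n (g : 'M_(n, p)), forall v : 'rV_p, (forall j, P ((v *m d) 0 j)) <-> exists w, v = w *m g.
Proof.
apply: fin_generated_submod; split=> [j|x y Hx Hy j|a x Hx j].
- by rewrite mul0mx mxE; apply: ideal0.
- by rewrite mulmxDl mxE; apply: idealD.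
- by rewrite -scalemxAl mxE; apply: idealMl.
Qed.

Lemma resolution_exists (I : set R) : is_ideal I ->
  exists X, [/\ exact_mod P X, rk X 0 = 1%N &
    forall b, I b <-> exists v, b = \sum_a \sum_c v a * dmx X 0 a c].
Proof.
move=> iI; have [n [g Hg]] := noeth iI.
(* A stage packs a matrix with both of its sizes, so that the resolution is obtained by plain
   iteration of the choice of syzygies. *)
pose stage := {r : nat & {p & 'M[R]_(p, r)}}.
have next (s : stage) : exists t : {p & 'M[R]_(p, projT1 (projT2 s))},
    forall v : 'rV_(projT1 (projT2 s)), (forall j, P ((v *m projT2 (projT2 s)) 0 j)) <-> exists w, v = w *m projT2 t.
  by have [q [h Hh]] := syzygies (projT2 (projT2 s)); exists (existT _ q h).
pose nxt s : stage := existT _ (projT1 (projT2 s)) (projT1 (cid (next s))).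
pose st i := iter i nxt (existT _ 1%N (existT _ n (\matrix_(i < n, j < 1) g i))).
exists (Resolution (rk := fun i => projT1 (st i)) (fun i => projT2 (projT2 (st i)))); split=> //.
- by move=> i; exact: (projT2 (cid (next (st i)))).
- move=> b; rewrite (Hg b) /=; split=> -[v ->]; exists v; apply: eq_bigr => i _;
    by rewrite big_ord1 mxE.
Qed.
End Resolutions.

(** * Rings of fractions inside a field and the Gorenstein property *)

Section Fractions.
Variables (R : comNzRingType) (F : fieldType) (psi : {rmorphism R -> F}).

Record denominators := Denominators {
  denom :> R -> Prop;
  denom1 : denom 1;
  denomM : forall s t, denom s -> denom t -> denom (s * t);
  denom_neq0 : forall s, denom s -> psi s != 0 }.

Variable D : denominators.

Definition frac_pred : {pred F} :=
  fun b => `[< exists a s, D s /\ b * psi s = psi a >].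

Lemma frac_predP b : reflect (exists a s, D s /\ b * psi s = psi a) (b \in frac_pred).
Proof. exact: asboolP. Qed.

Lemma frac_pred_closed : subring_closed frac_pred.
Proof.
split.
- by apply/frac_predP; exists 1, 1; split; [exact: denom1|rewrite mul1r].
- move=> x y /frac_predP [a [s [Ds Ex]]] /frac_predP [b [t [Dt Ey]]].
  apply/frac_predP; exists (a * t - b * s), (s * t); split; first exact: denomM.
  rewrite rmorphB !rmorphM -Ex -Ey; ring.
- move=> x y /frac_predP [a [s [Ds Ex]]] /frac_predP [b [t [Dt Ey]]].
  apply/frac_predP; exists (a * b), (s * t); split; first exact: denomM.
  by rewrite !rmorphM mulrACA Ex Ey.
Qed.
HB.instance Definition _ := GRing.isSubringClosed.Build F frac_pred frac_pred_closed.

(** With 1 as only denominator this is the image of [psi], that is, the quotient by its kernel; with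
    the elements outside a maximal ideal as denominators it is a localization of that quotient. One
    construction serves for both. *)
Definition frac_ring := {b : F | b \in frac_pred}.
HB.instance Definition _ := SubChoice.on frac_ring.
HB.instance Definition _ := [SubChoice_isSubComNzRing of frac_ring by <:].

Lemma frac_emb_subproof x : psi x \in frac_pred.
Proof. by apply/frac_predP; exists x, 1; split; [exact: denom1|rewrite rmorph1 mulr1]. Qed.
Definition frac_emb (x : R) : frac_ring := Sub (psi x) (frac_emb_subproof x).
Lemma frac_emb_zmod_morphism : zmod_morphism frac_emb.
Proof. by move=> x y; apply: val_inj; rewrite /= rmorphB. Qed.
Lemma frac_emb_monoid_morphism : monoid_morphism frac_emb.
Proof. by split=> [|x y]; apply: val_inj; rewrite /= ?rmorph1 ?rmorphM. Qed.
HB.instance Definition _ := GRing.isZmodMorphism.Build R frac_ring frac_emb frac_emb_zmod_morphism.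
HB.instance Definition _ := GRing.isMonoidMorphism.Build R frac_ring frac_emb frac_emb_monoid_morphism.

Lemma frac_emb_eq0 x : frac_emb x = 0 <-> psi x = 0.
Proof. by split=> [/(congr1 val)|E]; [|apply: val_inj]. Qed.

Lemma frac_embP (b : frac_ring) : exists a s, D s /\ b * frac_emb s = frac_emb a.
Proof.
have [a [s [Ds E]]] := frac_predP _ (valP b).
by exists a, s; split=> //; apply: val_inj.
Qed.

Lemma frac_emb_unit s : D s -> exists b, frac_emb s * b = 1.
Proof.
move=> Ds; have H : (psi s)^-1 \in frac_pred.
  by apply/frac_predP; exists 1, s; split=> //; rewrite rmorph1 mulVf // (denom_neq0 Ds).
by exists (Sub (psi s)^-1 H : frac_ring); apply: val_inj; rewrite /= mulfV // (denom_neq0 Ds).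
Qed.
End Fractions.

Section LocalizedResolutions.
Variables (R B : comNzRingType) (theta : {rmorphism R -> B}) (D P : set R).
Hypotheses (D1 : D 1) (DM : forall s t, D s -> D t -> D (s * t)).
Hypothesis kerP : forall x, theta x = 0 <-> P x.
Hypothesis fracP : forall b, exists a s, D s /\ b * theta s = theta a.
Hypothesis unitD : forall s, D s -> exists b, theta s * b = 1.

Lemma common_denominator (J : finType) (b : J -> B) :
  exists s (a : J -> R), D s /\ forall j, b j * theta s = theta (a j).
Proof.
suff [s Ds Hs] : exists2 s, D s & forall j, j \in enum J -> exists a, b j * theta s = theta a.
  have [a Ha] := fun_choice (fun j => Hs j (mem_enum J j)).
  by exists s, a.
elim: (enum J) => [|j r [s Ds Hs]]; first by exists 1.
have [a [t [Dt Ht]]] := fracP (b j).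
exists (s * t); first exact: DM.
move=> j'; rewrite inE => /orP[/eqP ->|/Hs [a' Ha']].
  by exists (s * a); rewrite !rmorphM mulrCA Ht.
by exists (a' * t); rewrite !rmorphM mulrA Ha'.
Qed.

Definition map_res (X : resolution R) : resolution B :=
  Resolution (fun i => map_mx theta (dmx X i)).

(** The resolutions that come from [R]. Clearing denominators brings their cocycles back to [R], and
    every ideal of the localization is extended from [R], so there are enough of them. *)
Definition loc_class : set (resolution B) :=
  [set Y | exists2 X, exact_mod P X & Y = map_res X].

Lemma map_rV_mulmx p q (v : 'rV[R]_p) (d : 'M_(p, q)) j :
  ((map_mx theta v) *m (map_mx theta d)) 0 j = theta ((v *m d) 0 j).
Proof. by rewrite -map_mxM mxE. Qed.

Lemma loc_class_exact Y : loc_class Y -> exact_mod [set 0] Y.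
Proof.
move=> [X exX ->] i v /=.
have [s [a [Ds Ha]]] := common_denominator (fun j => v 0 j).
have Ev : theta s *: v = map_mx theta (\row_j a j).
  by apply/rowP => j; rewrite !mxE mulrC Ha.
have [u Hu] := unitD Ds; have Evu : v = u *: map_mx theta (\row_j a j).
  by rewrite -Ev scalerA [u * _]mulrC Hu scale1r.
split=> [H|[w ->] j].
  have /exX [w Hw] : forall j, P ((\row_j a j *m dmx X i) 0 j).
    by move=> j; apply/kerP; rewrite -map_rV_mulmx -Ev -scalemxAl mxE H mulr0.
  by exists (u *: map_mx theta w); rewrite Evu Hw map_mxM scalemxAl.
have [s' [a' [Ds' Ha']]] := common_denominator (fun j => w 0 j).
have Ew : theta s' *: w = map_mx theta (\row_j a' j).
  by apply/rowP => c; rewrite !mxE mulrC Ha'.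
have [u' Hu'] := unitD Ds'.
rewrite [_ j]/= -[w]scale1r -Hu' [_ * u']mulrC -scalerA Ew -!scalemxAl mxE -map_mxM.
rewrite map_rV_mulmx.
have -> : theta ((\row_j a' j *m dmx X i.+1 *m dmx X i) 0 j) = 0; last by rewrite mulr0.
by apply/kerP; apply: (exX i _).2; exists (\row_j a' j).
Qed.

Lemma loc_class_shift Y : loc_class Y -> loc_class (shift Y).
Proof. by move=> [X exX ->]; exists (shift X) => // i; exact: (exX i.+1). Qed.

Lemma loc_class_ideal : is_ideal P -> fin_generated R -> ideal_resolutions loc_class.
Proof.
move=> iP noeth I iI.
have iI' : is_ideal [set x | I (theta x)].
  split; first by rewrite /= rmorph0; apply: ideal0.
    by move=> x y Ix Iy; rewrite /= rmorphD; apply: idealD.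
  by move=> a x Ix; rewrite /= rmorphM; apply: idealMl.
have [X [exX r1 HX]] := resolution_exists noeth iP iI'.
exists (map_res X); first by exists X.
split=> // b; split=> [Ib|[v ->]].
  have [a [s [Ds E]]] := fracP b; have [u Hu] := unitD Ds.
  have [v Ev] : exists v, a = \sum_a \sum_c v a * dmx X 0 a c.
    by apply/HX; rewrite /= -E mulrC; apply: idealMl.
  exists (fun j => u * theta (v j)).
  have -> : b = u * theta a by rewrite -E mulrCA [u * _]mulrC Hu mulr1.
  rewrite Ev rmorph_sum mulr_sumr; apply: eq_bigr => j _.
  rewrite rmorph_sum mulr_sumr; apply: eq_bigr => c _.
  by rewrite mxE rmorphM mulrA.
apply: ideal_sum => // j _.
rewrite -mulr_sumr; apply: idealMl => //.
have : I (theta (\sum_c dmx X 0 j c)).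
  apply/HX; exists (fun j' => (j' == j)%:R); rewrite (bigD1 j) //= eqxx.
  rewrite [X in _ + X]big1 ?addr0 => [|j' /negPf ->]; last by rewrite big1 // => c _; rewrite mul0r.
  by apply: eq_bigr => c _; rewrite mul1r.
by rewrite rmorph_sum; congr (I _); apply: eq_bigr => c _; rewrite mxE.
Qed.

Lemma loc_ext_van n :
  (forall X, exact_mod P X -> forall e : 'I_(rk X n.+1) -> R,
     (forall a, P (mxact (M := R^o) (dmx X n.+1) e a)) ->
     exists e', forall a, P (e a - mxact (M := R^o) (dmx X n) e' a)) ->
  ext_van loc_class n [set: (B^o : lmodType B)].
Proof.
move=> EV _ [X exX ->] e _ /= de.
have [s [a [Ds Ha]]] := common_denominator e; have [u Hu] := unitD Ds.
have [b|e' He'] := EV X exX a.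
  apply/kerP; rewrite rmorph_sum.
  have := congr1 (fun x => x * theta s) (de b); rewrite mul0r mulr_suml => E; rewrite -[RHS]E.
  by apply: eq_bigr => c _; rewrite !mxE rmorphM -Ha mulrA.
exists (fun b => u * theta (e' b)); split=> // b.
have -> : e b = u * theta (a b) by rewrite -Ha mulrCA [u * _]mulrC Hu mulr1.
have /kerP/eqP := He' b; rewrite rmorphB subr_eq0 => /eqP ->.
rewrite rmorph_sum mulr_sumr; apply: eq_bigr => c _.
by rewrite mxE rmorphM mulrCA.
Qed.
End LocalizedResolutions.

Section Gorenstein.
Variables (k : fieldType) (N : nat) (F : fieldType).
Local Notation R := {mpoly k[N]}.
Variable psi : {rmorphism R -> F}.
Local Notation P := [set x : R | psi x = 0].

Lemma is_ideal_ker : is_ideal P.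
Proof.
split; first exact: rmorph0.
  by move=> x y /= Hx Hy; rewrite rmorphD Hx Hy addr0.
by move=> a x /= Hx; rewrite rmorphM Hx mulr0.
Qed.

Lemma one_denominators : exists D : denominators psi, forall s, D s <-> s = 1.
Proof.
have H2 (s t : R) : s = 1 -> t = 1 -> s * t = 1 by move=> -> ->; rewrite mulr1.
have H3 (s : R) : s = 1 -> psi s != 0 by move=> ->; rewrite rmorph1 oner_neq0.
by exists (@Denominators _ _ psi (fun s => s = 1) erefl H2 H3).
Qed.

Lemma maximal_prime (A : comNzRingType) (M : set A) x y : maximal_ideal M ->
  M (x * y) -> M x \/ M y.
Proof.
move=> [iM M1 Mmax] Mxy; have [Mx|nMx] := pselect (M x); first by left.
right; have [[z Hz]|n1] := pselect (adjoin M x 1).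
  have : M ((1 - x * z) * y + z * (x * y)) by apply: idealD => //; [apply: idealMr|apply: idealMl].
  by have -> : (1 - x * z) * y + z * (x * y) = y by ring.
case: nMx; rewrite -(Mmax _ (is_ideal_adjoin x iM) n1 (sub_adjoin x iM)).
exact: mem_adjoin.
Qed.

Lemma gorenstein_ker n :
  (forall X, exact_mod P X -> forall e : 'I_(rk X n.+1) -> R,
     (forall a, P (mxact (M := R^o) (dmx X n.+1) e a)) ->
     exists e', forall a, P (e a - mxact (M := R^o) (dmx X n) e' a)) ->
  gorenstein_ideal P.
Proof.
move=> EV; have [D1 HD1] := one_denominators.
have surj (b : frac_ring D1) : exists x, frac_emb D1 x = b.
  have [a [s [/HD1 -> E]]] := frac_embP b.
  by exists a; rewrite -E rmorph1 mulr1.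
exists (frac_ring D1), (frac_emb D1); split=> //; first by move=> x; exact: frac_emb_eq0.
split=> [I iI|M maxM].
  have iI' : is_ideal [set x | I (frac_emb D1 x)].
    split; first by rewrite /= rmorph0; apply: ideal0.
      by move=> x y Ix Iy; rewrite /= rmorphD; apply: idealD.
    by move=> a x Ix; rewrite /= rmorphM; apply: idealMl.
  have [p [g Hg]] := @mpoly_fin_generated k N _ iI'.
  exists [seq frac_emb D1 (g i) | i <- enum 'I_p]; apply/seteqP; split=> [b|].
    have [x <-] := surj b; move=> /Hg [v ->]; rewrite rmorph_sum.
    apply: ideal_sum; first exact: is_ideal_gen.
    move=> i _; rewrite rmorphM; apply: (idealMl _ (is_ideal_gen _)).
    by apply: sub_ideal_gen; apply/mapP; exists i; rewrite ?mem_enum.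
  apply: ideal_gen_sub => // _ /mapP [i _ ->].
  apply/(Hg (g i)); exists (fun j => (j == i)%:R).
  by rewrite (bigD1 i) //= eqxx mul1r big1 ?addr0 // => j /negPf ->; rewrite mul0r.
have [iM M1 _] := maxM.
have [D HD] : exists D : denominators psi, forall s, D s <-> ~ M (frac_emb D1 s).
  have H1 : ~ M (frac_emb D1 1) by rewrite rmorph1.
  have H2 (s t : R) : ~ M (frac_emb D1 s) -> ~ M (frac_emb D1 t) -> ~ M (frac_emb D1 (s * t)).
    by move=> Hs Ht; rewrite rmorphM => /(maximal_prime maxM) [].
  have H3 (s : R) : ~ M (frac_emb D1 s) -> psi s != 0.
    by move=> Hs; apply: contra_notN Hs => /eqP /frac_emb_eq0 ->; exact: ideal0.
  by exists (@Denominators _ _ psi (fun s => ~ M (frac_emb D1 s)) H1 H2 H3).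
have sub (b : frac_ring D1) : val b \in frac_pred D.
  have [x <-] := surj b; apply/frac_predP; exists x, 1.
  by split; [exact: denom1|rewrite rmorph1 mulr1].
(* Both rings lie in [F], and the localization map is the inclusion. *)
have [phi Hphi] : exists phi : {rmorphism frac_ring D1 -> frac_ring D}, 
    forall x, phi (frac_emb D1 x) = frac_emb D x.
  pose f (b : frac_ring D1) : frac_ring D := Sub (val b) (sub b).
  have fB : zmod_morphism f by move=> x y; apply: val_inj.
  have fM : monoid_morphism f by split=> [|x y]; apply: val_inj.
  exists (HB.pack_for {rmorphism frac_ring D1 -> frac_ring D} f
    (GRing.isZmodMorphism.Build _ _ f fB) (GRing.isMonoidMorphism.Build _ _ f fM)).
  by move=> x; apply: val_inj.
exists (frac_ring D), phi; split.
  split.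
  - by move=> s; have [x <-] := surj s => Hx; rewrite Hphi; apply: frac_emb_unit; apply/HD.
  - move=> b; have [a [s [Ds E]]] := frac_embP b.
    exists (frac_emb D1 a), (frac_emb D1 s); rewrite !Hphi; split=> //.
    exact/HD.
  - move=> b; have [x <-] := surj b; rewrite Hphi => /frac_emb_eq0 /(frac_emb_eq0 D1) ->.
    by exists 1; split=> //; rewrite mulr0.
exists n; pose i : {rmorphism k -> frac_ring D} := frac_emb D \o @mpolyC N k.
have kerP x : frac_emb D x = 0 <-> P x := frac_emb_eq0 D x.
have Cex := loc_class_exact (@denom1 _ _ _ D) (@denomM _ _ _ D) kerP (@frac_embP _ _ _ D) (@frac_emb_unit _ _ _ D).
apply: (@ext_van_injdim k (frac_ring D) i (loc_class (frac_emb D) P) Cex).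
- exact: loc_class_shift.
- by apply: (loc_class_ideal (@frac_embP _ _ _ D) (@frac_emb_unit _ _ _ D) is_ideal_ker (@mpoly_fin_generated k N)).
- by apply: (loc_ext_van (@denom1 _ _ _ D) (@denomM _ _ _ D) kerP (@frac_embP _ _ _ D) (@frac_emb_unit _ _ _ D)).
Qed.
End Gorenstein.

(** * Regular variables and inversion of a regular element *)

Section General.
Variables (k : fieldType) (N : nat).
Local Notation R := {mpoly k[N]}.

Lemma hom_congr (T : comNzRingType) (I : set T) (f g : {rmorphism R -> T}) :
  is_ideal I -> (forall a, f a%:MP = g a%:MP) ->
  (forall i, I (f 'X_i - g 'X_i)) -> forall p, I (f p - g p).
Proof.
move=> iI HC HX p; rewrite [p]mpolyE !rmorph_sum -sumrB; apply: ideal_sum => // m _.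
rewrite -mul_mpolyC !rmorphM HC -mulrBr; apply: idealMl => //.
rewrite mpolyXE_id !rmorph_prod; apply: ideal_prod_congr => // i.
rewrite !rmorphXn; elim: (m i) => [|d IH]; first by rewrite subrr; apply: ideal0.
have -> : f 'X_i ^+ d.+1 - g 'X_i ^+ d.+1 =
    (f 'X_i - g 'X_i) * f 'X_i ^+ d + g 'X_i * (f 'X_i ^+ d - g 'X_i ^+ d).
  by rewrite !exprS; ring.
by apply: idealD => //; [apply: idealMr|apply: idealMl].
Qed.

Lemma mpoly_eval (T : comNzRingType) (e : {rmorphism k -> T}) (c : 'I_N -> T) :
  exists g : {rmorphism R -> T}, (forall a, g a%:MP = e a) /\ forall i, g 'X_i = c i.
Proof.
exists (mmap e c); split=> [a|i]; first by rewrite /= mmapC.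
by rewrite /= mmapX mmap1U.
Qed.

Lemma kill_var i : exists g : {rmorphism R -> R},
  [/\ forall a, g a%:MP = a%:MP, g 'X_i = 0 & forall j, j != i -> g 'X_j = 'X_j].
Proof.
have [g [gC gX]] := @mpoly_eval R (@mpolyC N k) (fun j => if j == i then 0 else 'X_j).
by exists g; split=> [a||j /negPf ji]; rewrite ?gC ?gX ?eqxx ?ji.
Qed.

Lemma mpolyX_neq0 i : 'X_i != 0 :> R.
Proof. by rewrite -mleadc_eq0 mleadXm mcoeffX eqxx oner_eq0. Qed.

Lemma kill_var_dvd i (g : {rmorphism R -> R}) : (forall a, g a%:MP = a%:MP) ->
  g 'X_i = 0 -> (forall j, j != i -> g 'X_j = 'X_j) ->
  forall y, exists t, y - g y = 'X_i * t.
Proof.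
move=> gC gi gj y.
have i0 : is_ideal [set x : R | exists t, x = 'X_i * t].
  split; first by exists 0; rewrite mulr0.
    by move=> _ _ [s ->] [t ->]; exists (s + t); rewrite mulrDr.
  by move=> a _ [s ->]; exists (a * s); rewrite mulrCA.
apply: (hom_congr (f := idfun) i0) => [a|j]; first by rewrite gC.
have [->|ji] := eqVneq j i; first by exists 1; rewrite gi subr0 mulr1.
by exists 0; rewrite gj //= subrr mulr0.
Qed.

(** Setting ['X_i] to zero leaves [q] nonzero, as [h] witnesses; so in ['X_i * z = q * y] it is [y]
    that is divisible by ['X_i]. *)
Lemma nzd_var (q : R) i (A : nzRingType) (h : {rmorphism R -> A}) :
  h 'X_i = 0 -> h q != 0 ->
  forall z, (exists y, 'X_i * z = q * y) -> exists y, z = q * y.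
Proof.
move=> hi hq z [y E]; have [g [gC gi gj]] := kill_var i.
have gq : g q != 0.
  apply: contra_neq hq => gq; have [t Et] := kill_var_dvd gC gi gj q.
  by rewrite -[q](subrK (g q)) Et gq addr0 rmorphM hi mul0r.
have gy : g y = 0.
  have /eqP := congr1 g E; rewrite !rmorphM gi mul0r eq_sym mulf_eq0 (negPf gq) /=.
  by move=> /eqP.
have [t Ht] := kill_var_dvd gC gi gj y.
exists t; apply: (mulfI (mpolyX_neq0 i)); rewrite E mulrCA -Ht gy subr0 //.
Qed.
End General.

Section Localization.
Variables (R : idomainType) (d : R).
Hypothesis d0 : d != 0.
Local Notation psi := (@tofrac R).

Let HM s t : (exists n, s = d ^+ n) -> (exists n, t = d ^+ n) -> exists n, s * t = d ^+ n.
Proof. by move=> [a ->] [b ->]; exists (a + b)%N; rewrite exprD. Qed.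
Let H0 s : (exists n, s = d ^+ n) -> psi s != 0.
Proof. by move=> [a ->]; rewrite tofrac_eq0 expf_neq0. Qed.
Definition powers : denominators psi :=
  Denominators (ex_intro (fun n => 1 = d ^+ n) 0%N erefl) HM H0.

Definition loc_ideal (I : set R) : set (frac_ring powers) :=
  [set b | exists a n, I a /\ b * frac_emb powers (d ^+ n) = frac_emb powers a].

Lemma is_ideal_loc I : is_ideal I -> is_ideal (loc_ideal I).
Proof.
move=> iI; split; first by exists 0, 0%N; rewrite mul0r rmorph0; split=> //; apply: ideal0.
  move=> x y [a [p [Ia Ex]]] [b [q [Ib Ey]]].
  exists (a * d ^+ q + b * d ^+ p), (p + q)%N; split.
    by apply: idealD => //; apply: idealMr.
  rewrite exprD !rmorphD !rmorphM /= -Ex -Ey; ring.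
move=> b x [a [p [Ia Ex]]]; have [c [_ [[q ->] Eb]]] := frac_embP b.
exists (c * a), (q + p)%N; split; first exact: idealMl.
rewrite exprD !rmorphM /= -Ex -Eb; ring.
Qed.

Lemma loc_ideal_emb I x : is_ideal I -> nzd_mod I d -> loc_ideal I (frac_emb powers x) -> I x.
Proof.
move=> iI dI [a [n [Ia E]]].
have {E} E : x * d ^+ n = a.
  by apply/eqP; rewrite -subr_eq0 -tofrac_eq0; apply/eqP/(frac_emb_eq0 powers); rewrite rmorphB rmorphM E subrr.
have : I (d ^+ n * x) by rewrite mulrC E.
elim: n {E} => [|n IH]; first by rewrite mul1r.
by rewrite exprS -mulrA => /dI.
Qed.

Lemma frac_emb_inj : injective (frac_emb powers).
Proof.
move=> x y /eqP; rewrite -subr_eq0 -rmorphB => /eqP /frac_emb_eq0 /eqP.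
by rewrite tofrac_eq0 subr_eq0 => /eqP.
Qed.

Lemma powers_inv : exists u, u * frac_emb powers d = 1.
Proof.
have [u Hu] : exists u, frac_emb powers d * u = 1 by apply: frac_emb_unit; exists 1%N.
by exists u; rewrite mulrC.
Qed.
End Localization.

(* Inverting [d] without losing track of an ideal modulo which [d] is regular. *)
Lemma invert_nzd (R : idomainType) (d : R) (I : set R) : d != 0 -> is_ideal I -> nzd_mod I d ->
  exists (T : comNzRingType) (th : {rmorphism R -> T}) (J : set T) (e : T),
    [/\ is_ideal J, forall x, J (th x) <-> I x, e * th d = 1 & injective th].
Proof.
move=> d0 iI nI; have [e He] := powers_inv d0.
exists (frac_ring (powers d0)), (frac_emb (powers d0)), (loc_ideal (d0 := d0) I), e; split=> //.
- exact: is_ideal_loc.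
- move=> x; split; first exact: loc_ideal_emb.
  by move=> Ix; exists x, 0%N; rewrite expr0 rmorph1 mulr1.
- exact: frac_emb_inj.
Qed.

(** * Block matrices of low rank and their parametrization *)

Section Determinants.
Variable R : comNzRingType.

Lemma det_lowrank p n (A : 'M[R]_(p, n)) (B : 'M_(n, p)) : (n < p)%N -> \det (A *m B) = 0.
Proof.
move=> np; have [d e] : exists d, p = (n + d.+1)%N by exists (p - n).-1; lia.
subst p; have -> : A *m B = row_mx A 0 *m col_mx B (0 : 'M_(d.+1, n + d.+1)).
  by rewrite mul_row_col mulmx0 addr0.
rewrite det_mulmx (expand_det_col _ (rshift n ord0)) big1 ?mul0r // => i _.
by rewrite row_mxEr mxE mul0r.
Qed.

Lemma adj_lowrank n (A : 'M[R]_(n + 2, n)) (B : 'M_(n, n + 2)) : \adj (A *m B) = 0.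
Proof.
apply/matrixP => i j; rewrite adjE [in RHS]mxE /cofactor.
have -> : row' j (col' i (A *m B)) = row' j A *m col' i B.
  by apply/matrixP => a b; rewrite !mxE; apply: eq_bigr => c _; rewrite !mxE.
by rewrite det_lowrank ?mulr0 // addn2.
Qed.

Lemma cofactor_lowrank n (A : 'M[R]_(n + 2, n)) (B : 'M_(n, n + 2)) i j :
  cofactor (A *m B) i j = 0.
Proof. by rewrite -adjE adj_lowrank [LHS]mxE. Qed.
End Determinants.

Lemma det_border (R : idomainType) n (C : 'M[R]_n) (u : 'cV_n) (v : 'rV_n) (w : 'M_1) :
  \det C != 0 -> \det (block_mx C u v w) = \det C * w 0 0 - (v *m \adj C *m u) 0 0.
Proof.
move=> c0; apply: (mulIf c0).
have E : \det (block_mx 1%:M (- (\adj C *m u)) 0 (\det C)%:M) = \det C.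
  by rewrite det_ublock det1 mul1r det_mx11 mxE eqxx.
rewrite -[in LHS]E -det_mulmx mulmx_block !mulmx1 !mulmx0 !addr0 !mulmxN !mulmxA mul_mx_adj.
rewrite mul_scalar_mx mul_mx_scalar addNr det_lblock det_mx11 mulrC; congr (_ * _).
by rewrite [LHS]mxE addrC mul_mx_scalar [X in X + _]mxE [X in _ + X]mxE.
Qed.

Lemma ideal_minor_cast (R : comNzRingType) (I : set R) p q (A : 'M[R]_q) (f g : 'I_p -> 'I_q) :
  q = p.+1 -> is_ideal I -> (forall i j, I ((\adj A) i j)) -> I (\det (mxsub f g A)).
Proof. by move=> e; subst q; exact: ideal_minor. Qed.

Section GN1Ideal.
Variables (R : comNzRingType) (m : nat) (X : 'M[R]_m).

Definition gn1_ideal : set R := [set a : R | exists z, a = gn1 X z].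

Lemma is_ideal_gn1 : is_ideal gn1_ideal.
Proof.
split; first by exists 0; rewrite linear0.
  by move=> _ _ [x ->] [y ->]; exists (x + y); rewrite linearD.
by move=> a _ [x ->]; exists (a *: x); rewrite linearZ.
Qed.


Lemma gn1_ideal_adj i j : gn1_ideal ((\adj X) i j).
Proof.
exists (delta_mx j i, 0); rewrite /gn1 /= mulr0 subr0.
have [A HA] : exists A, A = \adj X by exists (\adj X).
rewrite -HA /mxtrace (bigD1 i) //= mxE (bigD1 j) //= mxE !eqxx mulr1.
rewrite !big1 ?addr0 // => [c ci|c cj].
  by rewrite mxE big1 // => d _; rewrite mxE (negPf ci) andbF mulr0.
by rewrite mxE (negPf cj) mulr0.
Qed.

Lemma gn1_ideal_sub (I : set R) : is_ideal I -> (forall i j, I ((\adj X) i j)) -> I (\det X) ->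
  gn1_ideal `<=` I.
Proof.
move=> iI HA Hd _ [z ->]; rewrite /gn1; apply: idealB => //; last exact: idealMr.
apply: ideal_sum => // i _; rewrite mxE; apply: ideal_sum => // j _.
exact: idealMr.
Qed.
End GN1Ideal.

Section Blocks.
Variables (k : fieldType) (n : nat) (hm : (3 <= n + 2)%N).
Local Notation R := {mpoly k[#|gc_var hm|]}.
Local Notation S := {mpoly k[#|{: 'I_(n + 2) * 'I_(n + 2)}|]}.
Local Notation pp := (ord_penult hm).
Local Notation ll := (ord_last hm).

Lemma penult_rshift : pp = rshift n 0.
Proof. by apply: val_inj; rewrite /= addn2 addn0. Qed.
Lemma last_rshift : ll = rshift n 1.
Proof. by apply: val_inj; rewrite /= addn2 addn1. Qed.

(* Keeping the matrices abstract prevents conversion from unfolding their entries. *)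
Variables (X : 'M[R]_(n + 2)) (Y : 'M[S]_(n + 2)).
Hypotheses (EX : X = GC k hm) (EY : Y = generic_mx k (n + 2)).

Lemma gc_eval_mx (T : comNzRingType) (i : {rmorphism k -> T}) C u v (W : 'M[T]_2) :
  W 0 0 = W 1 1 -> map_mx (gc_eval (hm := hm) i (block_mx C u v W)) X = block_mx C u v W.
Proof.
by move=> e; rewrite EX gc_eval_GC // penult_rshift last_rshift !block_mxEdr.
Qed.

Lemma gen_eval_mx (T : comNzRingType) (i : {rmorphism k -> T}) (Z : 'M[T]_(n + 2)) :
  map_mx (gen_eval i Z) Y = Z.
Proof. by rewrite EY gen_eval_generic. Qed.

Lemma gc_var_entry a : exists p q, 'X_a = X p q.
Proof.
exists (val (enum_val a : gc_var hm)).1, (val (enum_val a : gc_var hm)).2.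
by rewrite EX GC_pvar /pvar enum_valK.
Qed.

Lemma gen_var_entry a : 'X_a = Y (enum_val a).1 (enum_val a).2.
Proof. by rewrite EY mxE /pvar -surjective_pairing enum_valK. Qed.

Lemma gc_congr (T : comNzRingType) (I : set T) (f g : {rmorphism R -> T}) :
  is_ideal I -> (forall a, f a%:MP = g a%:MP) ->
  (forall i j, I (f (X i j) - g (X i j))) -> forall p, I (f p - g p).
Proof. by move=> iI HC HX; apply: hom_congr => // a; have [p [q ->]] := gc_var_entry a. Qed.

Lemma gen_congr (T : comNzRingType) (I : set T) (f g : {rmorphism S -> T}) :
  is_ideal I -> (forall a, f a%:MP = g a%:MP) ->
  (forall i j, I (f (Y i j) - g (Y i j))) -> forall p, I (f p - g p).
Proof. by move=> iI HC HX; apply: hom_congr => // a; rewrite gen_var_entry. Qed.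

Lemma gc_unique (T : comNzRingType) (f g : {rmorphism R -> T}) :
  (forall a, f a%:MP = g a%:MP) -> map_mx f X = map_mx g X -> f =1 g.
Proof. by rewrite EX; exact: gc_eval_unique. Qed.


Local Notation C := (ulsubmx X).
Local Notation U := (ursubmx X).
Local Notation V := (dlsubmx X).
Local Notation W := (drsubmx X).
Local Notation c := (\det C).

Lemma X_diag : W 0 0 = W 1 1.
Proof.
rewrite ![drsubmx _ _ _]mxE ![dsubmx _ _ _]mxE -penult_rshift -last_rshift EX.
exact: GC_diag.
Qed.

Lemma corner_neq0 : c != 0.
Proof.
have [f Ef] : exists f : {rmorphism R -> k}, map_mx f X = block_mx 1%:M 0 0 (0 : 'M[k]_2).
  exists (gc_eval (hm := hm) idfun (block_mx 1%:M 0 0 (0 : 'M[k]_2))).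
  by apply: gc_eval_mx; rewrite !mxE.
apply/eqP => /(congr1 f) /eqP; rewrite -det_map_mx map_ulsubmx Ef.
by rewrite block_mxKul det1 rmorph0 oner_eq0.
Qed.

Definition border i j : R := c * W i j - (V *m \adj C *m U) i j.

Lemma border_minor i j : gn1_ideal X (border i j).
Proof.
have -> : border i j = \det (block_mx C (col j U) (row i V) (W i j)%:M).
  rewrite det_border ?corner_neq0 // [X in _ * X]mxE eqxx mulr1n /border; congr (_ - _).
  rewrite !mxE; apply: eq_bigr => a _; rewrite !mxE; congr (_ * _).
  by apply: eq_bigr => b _; rewrite !mxE.
pose f (i : 'I_2) (a : 'I_(n + 1)) : 'I_(n + 2) :=
  match split a with inl b => lshift 2 b | inr _ => rshift n i end.
have -> : block_mx C (col j U) (row i V) (W i j)%:M = mxsub (f i) (f j) X.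
  rewrite -[mxsub _ _ _]submxK; congr block_mx; apply/matrixP => a b;
    rewrite !mxE /f ?(unsplitK (inl _ _)) ?(unsplitK (inr _ _)) ?ord1 ?eqxx //.
apply: ideal_minor_cast; first by rewrite !addnS.
  exact: is_ideal_gn1.
exact: gn1_ideal_adj.
Qed.

Local Notation Cy := (ulsubmx Y).
Local Notation Uy := (ursubmx Y).
Local Notation Vy := (dlsubmx Y).
Local Notation P := (gn1_ideal X).

Lemma Y_blocks (T : comNzRingType) (f : {rmorphism S -> T}) C' U' V' W' :
  map_mx f Y = block_mx C' U' V' W' ->
  [/\ map_mx f Cy = C', map_mx f Uy = U', map_mx f Vy = V' & map_mx f (drsubmx Y) = W'].
Proof.
by move=> E; rewrite map_ulsubmx map_ursubmx map_dlsubmx map_drsubmx E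
  block_mxKul block_mxKur block_mxKdl block_mxKdr.
Qed.

(** Over an invertible [C] every upper right block is of the form [C *m U], and rank [n] forces the
    last block to be [V *m U]. It is kept as a parameter [M], because the diagonal entries of
    [Vy *m Uy] differ, whereas the repeated variable demands equal ones. *)
Definition phi (M : 'M[S]_2) : R -> S := gc_eval (@mpolyC _ k) (block_mx Cy (Cy *m Uy) Vy M).
HB.instance Definition _ M := GRing.RMorphism.on (phi M).

Lemma phi_mx (M : 'M_2) : M 0 0 = M 1 1 -> map_mx (phi M) X = block_mx Cy (Cy *m Uy) Vy M.
Proof. exact: gc_eval_mx. Qed.

Lemma phi_border (M : 'M_2) i j : M 0 0 = M 1 1 ->
  phi M (border i j) = \det Cy * (M i j - (Vy *m Uy) i j).
Proof.
move=> /phi_mx EM.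
have EC : map_mx (phi M) C = Cy by rewrite map_ulsubmx EM block_mxKul.
have EU : map_mx (phi M) U = Cy *m Uy by rewrite map_ursubmx EM block_mxKur.
have EV : map_mx (phi M) V = Vy by rewrite map_dlsubmx EM block_mxKdl.
have EW : map_mx (phi M) W = M by rewrite map_drsubmx EM block_mxKdr.
rewrite /border rmorphB rmorphM mulrBr -det_map_mx EC; congr (_ * _ - _).
  by rewrite -[in RHS]EW [RHS]mxE.
transitivity (map_mx (phi M) (V *m \adj C *m U) i j); first by rewrite [RHS]mxE.
rewrite !map_mxM map_mx_adj EC EU EV -!mulmxA [\adj Cy *m _]mulmxA mul_adj_mx mul_scalar_mx.
by rewrite -scalemxAr mxE.
Qed.

Definition qf : S := (Vy *m Uy) 0 0 - (Vy *m Uy) 1 1.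
(** [Vy *m Uy] with its last diagonal entry corrected by the quadric [qf], so that [GC] can be
    evaluated at it. *)
Definition qW : 'M[S]_2 :=
  \matrix_(a, b) if (a == 1) && (b == 1) then (Vy *m Uy) 0 0 else (Vy *m Uy) a b.
Definition qideal : set S := [set x | exists y, x = qf * y].

Lemma qW_diag : qW 0 0 = qW 1 1. Proof. by rewrite !mxE. Qed.

Lemma is_ideal_q : is_ideal qideal.
Proof.
split; first by exists 0; rewrite mulr0.
  by move=> _ _ [s ->] [t ->]; exists (s + t); rewrite mulrDr.
by move=> a _ [s ->]; exists (a * s); rewrite mulrCA.
Qed.

(** Modulo [qf] the evaluated matrix factors through [n] columns, so its determinant and adjugate
    vanish. *)
Lemma phi_qideal x : P x -> qideal (phi qW x).
Proof.
have iP : is_ideal [set x | qideal (phi qW x)].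
  have iq := is_ideal_q; split; first by rewrite /= rmorph0; apply: ideal0.
    by move=> s t; rewrite /= rmorphD; apply: idealD.
  by move=> s t; rewrite /= rmorphM; apply: idealMl.
have [Z EZ] : exists Z, Z = block_mx Cy (Cy *m Uy) Vy qW by eexists.
have HZ i j : qideal (Z i j - (col_mx Cy Vy *m row_mx 1%:M Uy) i j).
  rewrite mul_col_row !mulmx1 EZ -[i]splitK -[j]splitK.
  case: (split i) (split j) => a [] b /=;
    rewrite ?block_mxEul ?block_mxEur ?block_mxEdl ?block_mxEdr ?subrr; try exact: (ideal0 is_ideal_q).
  rewrite [qW _ _]mxE; case: ifP => [/andP[/eqP-> /eqP->]|_].
    by exists 1; rewrite mulr1.
  by rewrite subrr; exact: (ideal0 is_ideal_q).
have mapX : map_mx (phi qW) X = Z by rewrite EZ phi_mx ?qW_diag.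
apply: (gn1_ideal_sub (I := [set x | qideal (phi qW x)]) iP) => [i j /=|/=].
  have -> : phi qW ((\adj X) i j) = (\adj Z) i j.
    by rewrite -mapX -map_mx_adj [in RHS]mxE.
  have Ec := cofactor_lowrank (col_mx Cy Vy) (row_mx 1%:M Uy) j i.
  rewrite adjE -[cofactor _ _ _]subr0 -Ec /cofactor -mulrBr.
  apply: (idealMl _ is_ideal_q); apply: (ideal_det_congr is_ideal_q) => a b.
  rewrite ![row' _ _ _ _]mxE ![col' _ _ _ _]mxE; exact: HZ.
have -> : phi qW (\det X) = \det Z - 0 by rewrite -mapX det_map_mx subr0.
rewrite -(det_lowrank (col_mx Cy Vy) (row_mx 1%:M Uy)); last by lia.
exact: (ideal_det_congr is_ideal_q).
Qed.

(** Once the corner minor is inverted, [Uy] is recovered as the inverse of the corner block times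
    its right neighbour. The bordered minors, whose images lie in [I], then say that the last block
    of [X] is the product of [Vy] and [Uy] modulo [I]. *)
Lemma psi_exists (T : comNzRingType) (th : {rmorphism R -> T}) (I : set T) ci :
  is_ideal I -> (forall x, P x -> I (th x)) -> ci * th c = 1 ->
  exists2 psi : {rmorphism S -> T},
  [/\ map_mx psi Cy = map_mx th C, map_mx psi (Cy *m Uy) = map_mx th U,
      map_mx psi Vy = map_mx th V & forall a, psi a%:MP = th a%:MP] &
  forall x, I (psi (phi qW x) - th x).
Proof.
move=> iP PI Hci.
pose Z := block_mx (map_mx th C) (ci *: map_mx th (\adj C *m U)) (map_mx th V) (0 : 'M[T]_2).
have [psi [psiC psiZ]] : exists psi : {rmorphism S -> T},
    (forall a, psi a%:MP = th a%:MP) /\ map_mx psi Y = Z.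
  exists (gen_eval (th \o @mpolyC _ k) Z); split; last exact: gen_eval_mx.
  by move=> a; exact: gen_evalC.
have [EC EU EV _] := Y_blocks psiZ.
have ECU : map_mx psi (Cy *m Uy) = map_mx th U.
  rewrite map_mxM EC EU -scalemxAr -map_mxM mulmxA mul_mx_adj mul_scalar_mx map_mxZ.
  by rewrite scalerA Hci scale1r.
exists psi => // x.
have [f Ef] : exists f : {rmorphism R -> T}, forall x, f x = psi (phi qW x).
  by exists (psi \o phi qW).
rewrite -Ef; move: x; apply: (gc_congr iP) => [a|i j].
  by rewrite Ef /phi gc_evalC psiC.
have -> : f (X i j) = map_mx psi (map_mx (phi qW) X) i j by rewrite Ef !mxE.
rewrite phi_mx ?qW_diag // map_block_mx EC ECU EV.
have -> : th (X i j) = map_mx th X i j by rewrite mxE.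
rewrite -[in X in _ - X](submxK X) map_block_mx -[i]splitK -[j]splitK.
case: (split i) (split j) => a [] b /=;
    rewrite ?block_mxEul ?block_mxEur ?block_mxEdl ?block_mxEdr ?subrr; try exact: (ideal0 iP).
have EVU a' b' : psi ((Vy *m Uy) a' b') = ci * th ((V *m \adj C *m U) a' b').
  have -> : psi ((Vy *m Uy) a' b') = map_mx psi (Vy *m Uy) a' b' by rewrite [RHS]mxE.
  by rewrite map_mxM EV EU -scalemxAr -map_mxM mulmxA [LHS]mxE [X in _ * X]mxE.
have B a' b' : I (psi ((Vy *m Uy) a' b') - th (W a' b')).
  have -> : psi ((Vy *m Uy) a' b') - th (W a' b') = - (ci * th (border a' b')).
    rewrite EVU /border rmorphB rmorphM mulrBr mulrA Hci mul1r opprB //.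
  apply: (idealN iP); apply: (idealMl _ iP); apply: PI; exact: border_minor.
rewrite [map_mx psi _ _ _]mxE [map_mx th _ _ _]mxE [qW _ _]mxE.
case: ifP => [/andP[/eqP-> /eqP->]|_]; last exact: B.
by rewrite -X_diag; exact: B.
Qed.

Lemma corner_nzd : [pchar k] =i pred0 -> nzd_mod P c.
Proof.
move=> hk x [z Hz].
have e : (n + 2)%N = n.+2 by rewrite addn2.
have Ec : mxsub (lshift 2) (lshift 2) X = C by apply/matrixP => i j; rewrite !mxE.
have := @gc_corner_nzd k hk _ hm n (lshift 2) x e; rewrite -EX Ec; move: (c) Hz => d Hz H.
by apply: H => //; exists z.
Qed.
End Blocks.

(** * The quadric imposed by the repeated variable *)

Section Quadric.
Variables (k : fieldType) (n : nat).
Local Notation S := {mpoly k[#|{: 'I_(n + 2) * 'I_(n + 2)}|]}.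
Variables (Y : 'M[S]_(n + 2)) (EY : Y = generic_mx k (n + 2)) (j0 : 'I_n).
Local Notation Cy := (ulsubmx Y).
Local Notation Uy := (ursubmx Y).
Local Notation Vy := (dlsubmx Y).
Local Notation Zy := (drsubmx Y).

Definition pivot : S := Uy j0 1.

(* Solving [qf = 0] for the entry [1, j0] of [Vy], after scaling [Vy] by the pivot. *)
Definition tauV : 'M[S]_(2, n) := \matrix_(i, j) if (i == 1) && (j == j0)
  then \sum_j Vy 0 j * Uy j 0 - \sum_(j | j != j0) Vy 1 j * Uy j 1 else pivot * Vy i j.

Definition tau : S -> S := gen_eval (@mpolyC _ k) (block_mx Cy Uy tauV Zy).
HB.instance Definition _ := GRing.RMorphism.on tau.

Lemma tau_mx : map_mx tau Y = block_mx Cy Uy tauV Zy.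
Proof. exact: gen_eval_mx. Qed.

Lemma qfE (T : comNzRingType) (f : {rmorphism S -> T}) : f (qf Y) =
  \sum_j f (Vy 0 j) * f (Uy j 0) - \sum_j f (Vy 1 j) * f (Uy j 1).
Proof.
by rewrite /qf ![(_ *m _) _ _]mxE rmorphB !rmorph_sum; congr (_ - _); apply: eq_bigr => j _; rewrite rmorphM.
Qed.

Lemma tau_qf : tau (qf Y) = 0.
Proof.
have [f [Ef fY]] : exists f : {rmorphism S -> S}, (forall x, tau x = f x) /\
    map_mx f Y = block_mx Cy Uy tauV Zy by exists tau; split=> //; exact: tau_mx.
have [_ EU EV _] := Y_blocks fY.
have eU i j : f (Uy i j) = Uy i j by have := congr1 (fun A : 'M__ => A i j) EU; rewrite [LHS]mxE.
have eV i j : f (Vy i j) = tauV i j by have := congr1 (fun A : 'M__ => A i j) EV; rewrite [LHS]mxE.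
rewrite Ef qfE [X in _ - X](bigD1 j0) //= !eV !eU [tauV 1 j0]mxE !eqxx /=.
have -> : \sum_j f (Vy 0 j) * f (Uy j 0) = pivot * \sum_j Vy 0 j * Uy j 0.
  by rewrite mulr_sumr; apply: eq_bigr => j _; rewrite eV eU [tauV _ _]mxE mulrA.
have -> : \sum_(j | j != j0) f (Vy 1 j) * f (Uy j 1) = pivot * \sum_(j | j != j0) Vy 1 j * Uy j 1.
  by rewrite mulr_sumr; apply: eq_bigr => j jj; rewrite eV eU [tauV _ _]mxE (negPf jj) andbF mulrA.
rewrite -/pivot; ring.
Qed.

Lemma pivot_nzd : nzd_mod (qideal Y) pivot.
Proof.
have [a Ea] : exists a, pivot = 'X_a.
  exists (enum_rank (lshift 2 j0, rshift n 1)).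
  by rewrite (gen_var_entry EY) enum_rankK /pivot mxE [LHS]mxE.
(* A point where the pivot is 0 and the quadric is 1. *)
pose Z : 'M[k]_(n + 2) := block_mx 0 (delta_mx j0 0) (delta_mx 0 j0) 0.
have [h [hC hZ]] : exists h : {rmorphism S -> k}, (forall b, h b%:MP = b) /\ map_mx h Y = Z.
  exists (gen_eval idfun Z); split; last exact: gen_eval_mx.
  by move=> b; exact: gen_evalC.
have [_ hU hV _] := Y_blocks hZ.
have h0 : h 'X_a = 0.
  by rewrite -Ea; have := congr1 (fun A : 'M__ => A j0 1) hU; rewrite [LHS]mxE => ->; rewrite mxE eqxx.
have hq : h (qf Y) = 1.
  have eU i j : h (Uy i j) = (delta_mx j0 0 : 'M_(n, 2)) i j by have := congr1 (fun A : 'M__ => A i j) hU; rewrite [LHS]mxE.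
  have eV i j : h (Vy i j) = (delta_mx 0 j0 : 'M_(2, n)) i j by have := congr1 (fun A : 'M__ => A i j) hV; rewrite [LHS]mxE.
  rewrite qfE (bigD1 j0) //= eU eV !mxE !eqxx mulr1 !big1 ?addr0 ?subr0 // => j.
    by move=> _; rewrite eU eV !mxE /= mul0r.
  by move=> jj; rewrite eU eV !mxE (negPf jj) andbF mul0r.
have q0 : h (qf Y) != 0 by rewrite hq oner_neq0.
by move=> z; rewrite Ea; exact: (nzd_var h0 q0).
Qed.

Lemma pivot_neq0 : pivot != 0.
Proof.
have -> : pivot = 'X_(enum_rank (lshift 2 j0, rshift n 1)).
  by rewrite (gen_var_entry EY) enum_rankK /pivot mxE [LHS]mxE.
exact: mpolyX_neq0.
Qed.

Lemma untau_exists (T : comNzRingType) (th : {rmorphism S -> T}) (I : set T) ci :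
  is_ideal I -> (forall x, qideal Y x -> I (th x)) -> ci * th pivot = 1 ->
  exists2 psi : {rmorphism S -> T},
  [/\ forall a, psi a%:MP = th a%:MP, forall i j, psi (Cy i j) = th (Cy i j),
      forall i j, psi (Uy i j) = th (Uy i j) &
      forall i j, ~~ ((i == 1) && (j == j0)) -> psi (tauV i j) = th (Vy i j)] &
  forall x, I (psi (tau x) - th x).
Proof.
move=> iI qI Hci.
pose Z := block_mx (map_mx th Cy) (map_mx th Uy) (ci *: map_mx th Vy) (map_mx th Zy).
have [psi [psiC psiZ]] : exists psi : {rmorphism S -> T},
    (forall a, psi a%:MP = th a%:MP) /\ map_mx psi Y = Z.
  exists (gen_eval (th \o @mpolyC _ k) Z); split; last exact: gen_eval_mx.
  by move=> a; exact: gen_evalC.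
have [EC EU EV EZ] := Y_blocks psiZ.
have eC i j : psi (Cy i j) = th (Cy i j).
  by have := congr1 (fun A : 'M__ => A i j) EC; rewrite mxE [RHS]mxE.
have eU i j : psi (Uy i j) = th (Uy i j).
  by have := congr1 (fun A : 'M__ => A i j) EU; rewrite mxE [RHS]mxE.
have eV i j : psi (Vy i j) = ci * th (Vy i j).
  by have := congr1 (fun A : 'M__ => A i j) EV; rewrite mxE [RHS]mxE [X in _ * X]mxE.
have eZ i j : psi (Zy i j) = th (Zy i j).
  by have := congr1 (fun A : 'M__ => A i j) EZ; rewrite mxE [RHS]mxE.
have etV i j : ~~ ((i == 1) && (j == j0)) -> psi (tauV i j) = th (Vy i j).
  move=> /negPf nij; rewrite mxE nij rmorphM eV /pivot eU mulrA [_ * ci]mulrC.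
  by rewrite Hci mul1r.
exists psi => // x.
have [f Ef] : exists f : {rmorphism S -> T}, forall x, f x = psi (tau x) by exists (psi \o tau).
rewrite -Ef; move: x; apply: (gen_congr EY iI) => [a|i j].
  by rewrite Ef /tau gen_evalC psiC.
have -> : f (Y i j) = map_mx psi (map_mx tau Y) i j by rewrite Ef !mxE.
have -> : th (Y i j) = map_mx th Y i j by rewrite mxE.
rewrite tau_mx -[in X in _ - X](submxK Y) !map_block_mx -[i]splitK -[j]splitK.
case: (split i) (split j) => a [] b /=;
    rewrite ?block_mxEul ?block_mxEur ?block_mxEdl ?block_mxEdr
      [map_mx psi _ _ _]mxE [map_mx th _ _ _]mxE;
    rewrite ?eC ?eU ?eZ ?subrr; try exact: (ideal0 iI).
have [/andP[/eqP-> /eqP->]|/etV ->] := boolP ((a == 1) && (b == j0)); last first.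
  by rewrite subrr; exact: (ideal0 iI).
suff -> : psi (tauV 1 j0) - th (Vy 1 j0) = ci * th (qf Y).
  by apply: (idealMl _ iI); apply: qI; exists 1; rewrite mulr1.
have -> : psi (tauV 1 j0) =
    ci * (\sum_j th (Vy 0 j) * th (Uy j 0) - \sum_(j | j != j0) th (Vy 1 j) * th (Uy j 1)).
  rewrite mxE !eqxx /= rmorphB !rmorph_sum mulrBr !mulr_sumr; congr (_ - _); apply: eq_bigr => b0 _;
    by rewrite rmorphM eV eU mulrA.
have -> : th (Vy 1 j0) = ci * th (Uy j0 1) * th (Vy 1 j0) by rewrite -/pivot Hci mul1r.
rewrite qfE [X in _ = _ * (_ - X)](bigD1 j0) //=; ring.
Qed.
End Quadric.

(** * Primality and independent entries *)

Section Prime.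
Variables (k : fieldType) (hk : [pchar k] =i pred0) (n : nat) (hm : (3 <= n + 2)%N).
Local Notation R := {mpoly k[#|gc_var hm|]}.
Local Notation S := {mpoly k[#|{: 'I_(n + 2) * 'I_(n + 2)}|]}.
Variables (X : 'M[R]_(n + 2)) (Y : 'M[S]_(n + 2)).
Hypotheses (EX : X = GC k hm) (EY : Y = generic_mx k (n + 2)).
Variable j0 : 'I_n.
Local Notation P := (gn1_ideal X).
Local Notation C := (ulsubmx X).
Local Notation U := (ursubmx X).
Local Notation V := (dlsubmx X).
Local Notation c := (\det C).
Local Notation Cy := (ulsubmx Y).
Local Notation Uy := (ursubmx Y).
Local Notation Vy := (dlsubmx Y).

Definition rank_param : R -> S := tau Y j0 \o phi (hm := hm) Y (qW Y).
HB.instance Definition _ := GRing.RMorphism.on rank_param.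

Lemma qideal_ker y : tau Y j0 y = 0 -> qideal Y y.
Proof.
move=> ty; have [T [th [J [ci [il JE Hci _]]]]] :=
  invert_nzd (pivot_neq0 EY j0) (is_ideal_q Y) (pivot_nzd EY (j0 := j0)).
have [psi _ Hpsi] := @untau_exists k n Y EY j0 _ th _ ci il (fun x => (JE x).2) Hci.
apply/JE; have := idealN il (Hpsi y); rewrite ty rmorph0 sub0r opprK; exact.
Qed.

(** Both factors of [rank_param] can be undone after inverting an element that is regular modulo the
    ideal concerned: the pivot modulo the quadric, the corner minor modulo the minors. *)
Lemma gn1_ideal_ker x : P x <-> rank_param x = 0.
Proof.
split=> [/(phi_qideal Y EX) [y Ey]|/qideal_ker [y Ey]].
  by rewrite /rank_param /= Ey rmorphM /= (tau_qf EY) mul0r.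
have [T [th [J [ci [il JE Hci _]]]]] :=
  invert_nzd (corner_neq0 EX) (is_ideal_gn1 X) (corner_nzd EX hk).
have PI z : P z -> J (th z) by move=> /JE.
have [psi [EC _ _ _] Hpsi] := @psi_exists k n hm X Y EX EY _ th _ ci il PI Hci.
(* Up to the inverted corner minor, the quadric is the value of a bordered minor of [X]. *)
have Iq : J (psi (qf Y)).
  have := Hpsi (border X 1 1); rewrite (phi_border Y EX) ?qW_diag // rmorphM.
  have -> : qW Y 1 1 - (Vy *m Uy) 1 1 = qf Y by rewrite mxE.
  rewrite -det_map_mx EC det_map_mx => H.
  have {H} := idealD il H (PI _ (border_minor EX 1 1)); rewrite subrK.
  by move=> /(idealMl ci il); rewrite mulrA Hci mul1r.
apply/JE.
have := Hpsi x; rewrite Ey rmorphM => H.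
have := idealB il (idealMr (psi y) il Iq) H; rewrite opprB addrC subrK; exact.
Qed.

Lemma gn1_ideal_prime : prime_ideal P.
Proof.
split; first exact: is_ideal_gn1.
  by move=> /gn1_ideal_ker; rewrite rmorph1 => /eqP; rewrite oner_eq0.
move=> x y /gn1_ideal_ker; rewrite rmorphM => /eqP; rewrite mulf_eq0.
by move=> /orP[] /eqP H; [left|right]; apply/gn1_ideal_ker.
Qed.

(** Left out are the three variables of the last block and the entry of [V] that [tauV] solves for:
    four variables, the height to be found. *)
Definition free_entry (x : R) : Prop :=
  [\/ exists i j, x = C i j, exists i j, x = U i j |
      exists i j, x = V i j /\ ~~ ((i == 1) && (j == j0))].

(** On free entries the inverse substitutions are equalities and not only congruences, and both
    localizations are injective; so [rank_param] is injective on polynomials in these entries. *)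
Lemma free_entries_mod (d : nat) (g : {rmorphism {mpoly k[d]} -> R}) :
  (forall a, g a%:MP = a%:MP) -> (forall i, free_entry (g 'X_i)) ->
  forall p, P (g p) -> g p = 0.
Proof.
move=> gC gX p /gn1_ideal_ker Hp.
have [ph [Eph phC [pC pU pV]]] : exists ph : {rmorphism R -> S},
   [/\ forall x, ph x = phi (hm := hm) Y (qW Y) x, forall a, ph a%:MP = a%:MP &
   [/\ map_mx ph C = Cy, map_mx ph U = Cy *m Uy & map_mx ph V = Vy]].
  exists (phi (hm := hm) Y (qW Y)); split=> // [a|]; first exact: gc_evalC.
  by rewrite map_ulsubmx map_ursubmx map_dlsubmx (phi_mx Y EX (qW_diag Y))
    block_mxKul block_mxKur block_mxKdl.
rewrite /rank_param /= -Eph in Hp.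
have phgp : ph (g p) = 0.
  have [T [th [J [ci [il JE Hci thI]]]]] :=
    invert_nzd (pivot_neq0 EY j0) (is_ideal_q Y) (pivot_nzd EY (j0 := j0)).
  have [psi [psiC eC eU eV] _] := @untau_exists k n Y EY j0 _ th _ ci il (fun x => (JE x).2) Hci.
  apply: thI; rewrite rmorph0 -(rmorph0 psi) -{}Hp.
  have [t [tY tC]] : exists t : {rmorphism S -> S}, (forall x, t x = tau Y j0 x) /\ 
     forall a, t a%:MP = a%:MP.
    by exists (tau Y j0); split=> // a; exact: gen_evalC.
  have [tC1 tU1 tV1 _] := Y_blocks (tau_mx EY j0).
  have tmx p' q' (A : 'M_(p', q')) : map_mx (tau Y j0) A = map_mx t A.
    by apply/matrixP => i j; rewrite !mxE tY.
  rewrite !tmx in tC1 tU1 tV1; rewrite -tY.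
  have eCm : map_mx psi Cy = map_mx th Cy.
    by apply/matrixP => i j; rewrite [LHS]mxE [RHS]mxE eC.
  have eUm : map_mx psi Uy = map_mx th Uy.
    by apply/matrixP => i j; rewrite [LHS]mxE [RHS]mxE eU.
  have [f Ef] : exists f : {rmorphism {mpoly k[d]} -> _}, forall x, f x = th (ph (g x)).
    by exists (th \o ph \o g).
  have [f' Ef'] : exists f' : {rmorphism {mpoly k[d]} -> _}, forall x, f' x = psi (t (ph (g x))).
    by exists (psi \o t \o ph \o g).
  rewrite -Ef -Ef'; apply: mmap_unique => [a|i]; first by rewrite Ef Ef' gC phC tC psiC.
  rewrite Ef Ef'; case: (gX i) => [[a [b ->]]|[a [b ->]]|[a [b [-> nab]]]].
  - have -> : ph (C a b) = Cy a b by rewrite -pC [RHS]mxE.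
    have -> : t (Cy a b) = Cy a b by rewrite -[in RHS]tC1 [RHS]mxE.
    by rewrite eC.
  - have -> : ph (U a b) = (Cy *m Uy) a b by rewrite -pU [RHS]mxE.
    have -> : t ((Cy *m Uy) a b) = (Cy *m Uy) a b.
      by have := congr1 (fun A : 'M__ => A a b) (map_mxM t Cy Uy); rewrite tC1 tU1 [LHS]mxE.
    have := congr1 (fun A : 'M__ => A a b) (map_mxM psi Cy Uy).
    by rewrite eCm eUm -map_mxM [LHS]mxE [RHS]mxE => ->.
  - have -> : ph (V a b) = Vy a b by rewrite -pV [RHS]mxE.
    have -> : t (Vy a b) = tauV Y j0 a b by rewrite -tV1 [RHS]mxE.
    by rewrite eV.
have [T [th [J [ci [il JE Hci thI]]]]] :=
  invert_nzd (corner_neq0 EX) (is_ideal_gn1 X) (corner_nzd EX hk).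
have [psi [EC EU EV psiC] _] :=
  @psi_exists k n hm X Y EX EY _ th _ ci il (fun x => (JE x).2) Hci.
apply: thI; rewrite rmorph0 -(rmorph0 psi) -{}phgp.
have [f Ef] : exists f : {rmorphism {mpoly k[d]} -> _}, forall x, f x = th (g x) by exists (th \o g).
have [f' Ef'] : exists f' : {rmorphism {mpoly k[d]} -> _}, forall x, f' x = psi (ph (g x)).
  by exists (psi \o ph \o g).
rewrite -Ef -Ef'; apply: mmap_unique => [a|i]; first by rewrite Ef Ef' gC phC psiC.
rewrite Ef Ef'; case: (gX i) => [[a [b ->]]|[a [b ->]]|[a [b [-> nab]]]].
- have -> : ph (C a b) = Cy a b by rewrite -pC [RHS]mxE.
  by have := congr1 (fun A : 'M__ => A a b) EC; rewrite [LHS]mxE [RHS]mxE.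
- have -> : ph (U a b) = (Cy *m Uy) a b by rewrite -pU [RHS]mxE.
  by have := congr1 (fun A : 'M__ => A a b) EU; rewrite [LHS]mxE [RHS]mxE.
- have -> : ph (V a b) = Vy a b by rewrite -pV [RHS]mxE.
  by have := congr1 (fun A : 'M__ => A a b) EV; rewrite [LHS]mxE [RHS]mxE.
Qed.
End Prime.

(** * Algebraic dependence and lengths of chains of primes *)

Section Dependence.
Variables (k : fieldType) (N : nat).
Local Notation R := {mpoly k[N]}.

Definition mdeg_le (p : R) (b : nat) := forall m, m \in msupp p -> (mdeg m <= b)%N.

Lemma mdeg_leM p q a b : mdeg_le p a -> mdeg_le q b -> mdeg_le (p * q) (a + b).
Proof.
move=> Hp Hq m /msuppM_le /allpairsP [[m1 m2] /= [/Hp H1 /Hq H2 ->]].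
by rewrite mdegD leq_add.
Qed.

Lemma mdeg_le1 : mdeg_le 1 0.
Proof. by move=> m; rewrite msupp1 inE => /eqP ->; rewrite mdeg0. Qed.

Lemma mdeg_leX p a d : mdeg_le p a -> mdeg_le (p ^+ d) (a * d).
Proof.
move=> Hp; elim: d => [|d IH]; first by rewrite expr0 muln0; exact: mdeg_le1.
by rewrite exprS mulnS; apply: mdeg_leM.
Qed.

Lemma mdeg_le_prod (J : finType) (F : J -> R) b : (forall j, mdeg_le (F j) b) ->
  mdeg_le (\prod_j F j) (b * #|J|).
Proof.
move=> H; rewrite cardT -big_enum enumT /=; elim: (Finite.enum J) => [|j r IH] /=.
  by rewrite big_nil muln0; exact: mdeg_le1.
by rewrite big_cons mulnS; apply: mdeg_leM.
Qed.

(* Counting monomials: more polynomials than variables are algebraically dependent. *)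
Lemma no_embedding (g : {rmorphism {mpoly k[N.+1]} -> R}) : (forall a, g a%:MP = a%:MP) ->
  ~ forall p, g p = 0 -> p = 0.
Proof.
move=> gC inj.
pose D0 := (\max_i msize (g 'X_i))%N.
have HD0 i : mdeg_le (g 'X_i) D0.
  move=> m /msize_mdeg_lt/ltnW H; apply: leq_trans H _.
  exact: (@leq_bigmax _ (fun i : 'I_N.+1 => msize (g 'X_i)) i).
have {D0 HD0} [D HD] : exists D, forall i, mdeg_le (g 'X_i) D by exists D0.
(* Images of monomials with exponents below [T] have degree at most [D * T * N.+1], less than
   [B = c * T]. As [T] exceeds [c ^ N], the [T ^ N.+1] source monomials outnumber the [B ^ N]
   exponents that can occur. *)
have [c Ec] : exists c, c = (D * N.+1).+1 by eexists.
have [T ET] : exists T, T = (c ^ N).+1 by eexists.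
have [B EB] : exists B, B = (c * T)%N by eexists.
pose mono d t (a : {ffun 'I_d -> 'I_t}) : 'X_{1..d} := [multinom (a i : nat) | i < d].
have degX (a : {ffun 'I_N.+1 -> 'I_T}) : mdeg_le (g 'X_[mono _ _ a]) (D * T * N.+1).
  rewrite mpolyXE_id rmorph_prod -[X in (_ * X)%N](card_ord N.+1).
  apply: mdeg_le_prod => i; rewrite rmorphXn mnmE => m /(mdeg_leX (d := a i) (HD i)) H.
  by apply: leq_trans H _; rewrite leq_mul2l ltnW ?orbT // ltn_ord.
have DB : (D * T * N.+1 < B)%N.
  have T0 : (0 < T)%N by rewrite ET.
  by rewrite EB Ec mulSn mulnAC -[X in (X < _)%N]add0n ltn_add2r.
pose I := {ffun 'I_N.+1 -> 'I_T}; pose J := {ffun 'I_N -> 'I_B}.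
pose A : 'M[k]_(#|I|, #|J|) :=
  \matrix_(a, b) (g 'X_[mono _ _ (enum_val a)])@_(mono _ _ (enum_val b)).
have cards : (#|J| < #|I|)%N.
  rewrite !card_ffun !card_ord EB expnMn expnS ltn_mul2r expn_gt0 {1}ET /=.
  by rewrite ET ltnSn.
have [v v0 vA] : exists2 v : 'rV_#|I|, v != 0 & v *m A = 0.
  have : kermx A != 0.
    rewrite -mxrank_eq0 mxrank_ker subn_eq0 -ltnNge.
    by apply: leq_ltn_trans cards; apply: rank_leq_col.
  move=> /rowV0Pn [v /sub_kermxP vA v0]; by exists v.
pose p := \sum_a v 0 a *: 'X_[mono _ _ (enum_val a)] : {mpoly k[N.+1]}.
have gp : g p = \sum_a v 0 a *: g 'X_[mono _ _ (enum_val a)].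
  by rewrite rmorph_sum; apply: eq_bigr => a _; rewrite -!mul_mpolyC rmorphM gC.
have mono_inj d t : injective (@mono d t).
  move=> a b /mnmP E; apply/ffunP => i; apply: val_inj; have := E i.
  by rewrite !mnmE.
have p0 : p = 0.
  apply: inj; apply/mpolyP => m; rewrite mcoeff0 gp raddf_sum.
  under eq_bigr do rewrite /= mcoeffZ.
  have [mB|mB] := ltnP (mdeg m) B; last first.
    rewrite big1 // => a _; rewrite memN_msupp_eq0 ?mulr0 //.
    apply/negP => /degX H; have := leq_ltn_trans H DB; rewrite ltnNge mB //.
  have miB i : (m i < B)%N.
    by apply: leq_ltn_trans mB; rewrite mdegE (bigD1 i) //= leq_addr.
  pose b : J := [ffun i => Ordinal (miB i)].
  have -> : m = mono _ _ b by apply/mnmP => i; rewrite mnmE ffunE.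
  have := congr1 (fun w : 'rV_ _ => w 0 (enum_rank b)) vA; rewrite !mxE => E; rewrite -[RHS]E.
  by apply: eq_bigr => a _; rewrite !mxE enum_rankK.
case/negP: v0; apply/eqP/rowP => a; rewrite mxE.
have := congr1 (mcoeff (mono _ _ (enum_val a))) p0; rewrite mcoeff0 raddf_sum /= (bigD1 a) //=.
rewrite mcoeffZ mcoeffX eqxx mulr1 big1 ?addr0 // => a' ne.
rewrite mcoeffZ mcoeffX (inj_eq (@mono_inj _ _)) (inj_eq enum_val_inj) (negPf ne) mulr0 //.
Qed.

Definition indep_mod (Q : set R) d (g : {rmorphism {mpoly k[d]} -> R}) :=
  (forall a, g a%:MP = a%:MP) /\ forall p, Q (g p) -> p = 0.

(** An element [z] of [Q'] outside [Q] joins the family. In a relation modulo [Q], the terms free of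
    the new variable form a relation modulo [Q'] and vanish; the rest is a multiple of [z], which
    primality of [Q] cancels, and the degree drops. *)
Lemma indep_step (Q Q' : set R) d (g : {rmorphism {mpoly k[d]} -> R}) :
  prime_ideal Q -> prime_ideal Q' -> Q `<` Q' -> indep_mod Q' g ->
  exists g' : {rmorphism {mpoly k[d.+1]} -> R}, indep_mod Q g'.
Proof.
move=> [iQ Q1 pQ] [iQ' _ _] [sQ nQ] [gC gI].
have [z [Qz nz]] : exists z, Q' z /\ ~ Q z.
  apply: contrapT => H; apply: nQ => z Qz; apply: contrapT => nz; apply: H; by exists z.
have [g' [gC' gX]] := @mpoly_eval k d.+1 R (@mpolyC _ k)
  (fun i => if unlift ord_max i is Some j then g 'X_j else z).
exists g'; split=> // p.
have [s [sC sX]] := @mpoly_eval k d.+1 _ (@mpolyC d k)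
  (fun i => if unlift ord_max i is Some j then 'X_j else 0).
have [r [rC r0 rX]] := @kill_var k d.+1 ord_max.
have gr x : g' (r x) = g (s x).
  have : g' \o r =1 g \o s; last by apply.
  apply: mmap_unique => [a|i] /=; first by rewrite rC gC' sC gC.
  rewrite sX; case: unliftP => [j ->|->]; last by rewrite r0 !rmorph0.
  have nj : lift ord_max j != ord_max by rewrite eq_sym neq_lift.
  by rewrite (rX _ nj) gX liftK.
have rs x : s x = 0 -> r x = 0.
  have [t [tC tX]] := @mpoly_eval k d _ (@mpolyC d.+1 k) (fun i => 'X_(lift ord_max i)).
  have H : t \o s =1 r.
    apply: mmap_unique => [a|i] /=; first by rewrite sC tC rC.
    rewrite sX; case: unliftP => [j ->|->]; last by rewrite r0 rmorph0.
    have nj : lift ord_max j != ord_max by rewrite eq_sym neq_lift.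
    by rewrite (rX _ nj) tX.
  by move=> sx; rewrite -H /= sx rmorph0.
have [b] := ubnP (msize p); elim: b p => // b IH p /ltnSE pb Qp.
have [->//|p0] := eqVneq p 0.
have [t Et] := kill_var_dvd rC r0 rX p.
have gX0 : g' 'X_ord_max = z by rewrite gX unlift_none.
have Ep : g' p = g (s p) + z * g' t.
  by rewrite -{1}[p](subrK (r p)) Et addrC rmorphD rmorphM gr gX0.
have /gI/rs rp : Q' (g (s p)).
  have -> : g (s p) = g' p - z * g' t by rewrite Ep addrK.
  by apply: (idealB iQ'); [exact: sQ|apply: (idealMr _ iQ')].
have {}Et : p = 'X_ord_max * t by rewrite -Et rp subr0.
have t0 : t != 0 by apply: contra_neq p0 => t0; rewrite Et t0 mulr0.
have Qt : Q (g' t) by move: Qp; rewrite Et rmorphM gX0 => /pQ [].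
rewrite Et (IH t) ?mulr0 //; apply: leq_trans pb.
rewrite Et -!mlead_deg ?mulf_neq0 ?mpolyX_neq0 // mleadM ?mpolyX_neq0 //.
by rewrite mdegD mleadXm mdeg1.
Qed.

(** Each inclusion, descending, contributes one more independent element; at the bottom there are
    [d + e] of them. *)
Lemma chain_bound (P : set R) d e (g : {rmorphism {mpoly k[d]} -> R}) :
  indep_mod P g -> prime_chain e P -> (d + e <= N)%N.
Proof.
move=> Hg [C [pC sC eC]].
have H i : (i <= e)%N -> exists g' : {rmorphism {mpoly k[d + i]} -> R}, indep_mod (C (e - i)%N) g'.
  elim: i => [|i IH] ie; first by rewrite subn0 eC addn0; exists g.
  have [g' Hg'] := IH (ltnW ie); rewrite addnS.
  apply: (indep_step _ _ _ Hg'); first by apply: pC; apply: leq_subr.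
    by apply: pC; apply: leq_subr.
  rewrite -(subnSK ie); apply: sC; rewrite ltn_subrL /=.
  exact: leq_ltn_trans ie.
have [g' [gC' gI']] := H e (leqnn e).
rewrite leqNgt; apply/negP => Nde.
have [w [wC wX]] := @mpoly_eval k N.+1 _ (@mpolyC (d + e) k) (fun i => 'X_(widen_ord Nde i)).
have [w' [wC' wX']] := @mpoly_eval k (d + e) _ (@mpolyC N.+1 k) (fun i => 'X_(inord i)).
have wK : w' \o w =1 idfun.
  apply: mmap_unique => [a|i] /=; first by rewrite wC wC'.
  by rewrite wX wX' /= inord_val.
have [f Ef] : exists f : {rmorphism {mpoly k[N.+1]} -> R}, forall x, f x = g' (w x) by exists (g' \o w).
apply: (@no_embedding f) => [a|p]; first by rewrite Ef wC gC'.
rewrite Ef => gw; have : w p = 0.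
  apply: gI'; rewrite gw; apply: ideal0; rewrite subnn.
  by have [] := pC 0%N (leq0n _).
by move=> wp; rewrite -[p]wK /= wp rmorph0.
Qed.
End Dependence.

Lemma prime_ker (A B : comNzRingType) (f : {rmorphism A -> B}) :
  (forall x y : B, x * y = 0 -> x = 0 \/ y = 0) -> prime_ideal [set x | f x = 0].
Proof.
move=> dom; split; first split=> [|x y /= fx fy|a x /= fx].
- exact: rmorph0.
- by rewrite rmorphD fx fy addr0.
- by rewrite rmorphM fx mulr0.
- by move=> /= /eqP; rewrite rmorph1 oner_eq0.
- by move=> x y /=; rewrite rmorphM => /dom.
Qed.

Lemma ord2P (i : 'I_2) : i = 0 \/ i = 1.
Proof. by case: i => [[|[|//]] H]; [left|right]; apply: val_inj. Qed.

(** * Height four *)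

Section Height.
Variables (k : fieldType) (hk : [pchar k] =i pred0) (n : nat) (hm : (3 <= n + 2)%N).
Local Notation R := {mpoly k[#|gc_var hm|]}.
Local Notation S := {mpoly k[#|{: 'I_(n + 2) * 'I_(n + 2)}|]}.
Variables (X : 'M[R]_(n + 2)) (Y : 'M[S]_(n + 2)).
Hypotheses (EX : X = GC k hm) (EY : Y = generic_mx k (n + 2)).
Variable j0 : 'I_n.
Local Notation P := (gn1_ideal X).
Local Notation Cy := (ulsubmx Y).
Local Notation Uy := (ursubmx Y).
Local Notation Vy := (dlsubmx Y).
Local Notation Zy := (drsubmx Y).
Local Notation G := (Vy *m Uy).

(** The diagonal is already that of [qW]; the off-diagonal entries start as variables and are
    replaced in turn by those of [G], which yields the primes of the chain. *)
Definition chain_mx (a b : S) : 'M[S]_2 :=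
  \matrix_(i, j) if i == j then G 0 0 else if i == 0 then a else b.

Lemma chain_mx_diag a b : chain_mx a b 0 0 = chain_mx a b 1 1.
Proof. by rewrite !mxE. Qed.

(** The block [Zy] enters [phi] only through [M], so substituting for its off-diagonal variables
    turns one kernel of the chain into a larger one. *)
Lemma phi_specialize (M : 'M[S]_2) a b : M 0 0 = M 1 1 ->
  exists2 g : {rmorphism S -> S}, g (Zy 0 1) = a /\ g (Zy 1 0) = b &
    map_mx g Cy = Cy /\ map_mx g G = G /\
    (M 0 0 = G 0 0 \/ True) /\ forall x, g (phi (hm := hm) Y M x) = phi (hm := hm) Y (map_mx g M) x.
Proof.
move=> dM; pose N : 'M[S]_2 := \matrix_(i, j) if i == 0 then a else b.
have [g [gC gY]] : exists g : {rmorphism S -> S}, (forall a, g a%:MP = a%:MP) /\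
    map_mx g Y = block_mx Cy Uy Vy N.
  exists (gen_eval (@mpolyC _ k) (block_mx Cy Uy Vy N)); split; last exact: gen_eval_mx.
  by move=> x; exact: gen_evalC.
have [EC EU EV EZ] := Y_blocks gY.
have eZ i j : g (Zy i j) = N i j by have := congr1 (fun A : 'M__ => A i j) EZ; rewrite [LHS]mxE.
exists g; first by rewrite !eZ !mxE.
split=> //; split; first by rewrite map_mxM EU EV.
split; [by right|move=> x].
have dM' : map_mx g M 0 0 = map_mx g M 1 1 by rewrite [LHS]mxE [RHS]mxE dM.
have [f Ef] : exists f : {rmorphism R -> S}, forall x, f x = g (phi (hm := hm) Y M x).
  by exists (g \o phi (hm := hm) Y M).
rewrite -Ef; apply: (gc_unique EX) => [c|].
  have e M' : phi (hm := hm) Y M' c%:MP = c%:MP by exact: gc_evalC.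
  by rewrite Ef e gC; apply/esym; exact: e.
rewrite (phi_mx Y EX dM').
have -> : map_mx f X = map_mx g (map_mx (phi (hm := hm) Y M) X).
  by apply/matrixP => i j; rewrite [LHS]mxE Ef [RHS]mxE; congr (g _); rewrite [RHS]mxE.
by rewrite (phi_mx Y EX dM) map_block_mx EC EV map_mxM EC EU.
Qed.

Lemma phi_border_neq0 (M : 'M[S]_2) i j (A : 'M[k]_2) U V : M 0 0 = M 1 1 ->
  (forall h : {rmorphism S -> k}, map_mx h Y = block_mx 1%:M U V A ->
     h (M i j - G i j) != 0) ->
  phi (hm := hm) Y M (border X i j) != 0.
Proof.
move=> dM H; rewrite (phi_border Y EX i j dM).
have [h hY] : exists h : {rmorphism S -> k}, map_mx h Y = block_mx 1%:M U V A.
  by exists (gen_eval idfun (block_mx 1%:M U V A)); exact: gen_eval_mx.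
have [EC _ _ _] := Y_blocks hY.
have := H h hY; apply: contra_neq => E.
have := congr1 h E; rewrite rmorph0 rmorphM -det_map_mx EC det1 mul1r; exact.
Qed.

Lemma eval_vanish (h : {rmorphism S -> k}) (A : 'M[k]_2) i j :
  map_mx h Y = block_mx 1%:M 0 0 A -> h (Zy i j) = A i j /\ h (G i j) = 0.
Proof.
move=> hY; have [_ EU EV EZ] := Y_blocks hY; split.
  by have := congr1 (fun A : 'M__ => A i j) EZ; rewrite [LHS]mxE.
by have := congr1 (fun A : 'M__ => A i j) (map_mxM h Vy Uy); rewrite EU EV mul0mx [LHS]mxE [RHS]mxE.
Qed.

(** Each inclusion is strict on account of one bordered minor, which lies in the larger prime and is
    kept out of the smaller one by a numerical matrix. The top of the chain is an arbitrary prime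
    above the minors, as the height of an ideal requires. *)
Lemma gn1_ideal_chain Q : prime_ideal Q -> P `<=` Q -> prime_chain 4 Q.
Proof.
move=> pQ PQ.
have dom (x y : S) : x * y = 0 -> x = 0 \/ y = 0.
  by move=> /eqP; rewrite mulf_eq0 => /orP[] /eqP; [left|right].
pose K a b : set R := [set x | phi (hm := hm) Y (chain_mx a b) x = 0].
have pK a b : prime_ideal (K a b) by exact: (prime_ker (phi (hm := hm) Y (chain_mx a b)) dom).
have dc a b : chain_mx a b 0 0 = chain_mx a b 1 1 by exact: chain_mx_diag.
have EqW : qW Y = chain_mx (G 0 1) (G 1 0).
  apply/matrixP => i j; rewrite [LHS]mxE [RHS]mxE.
  by case: (ord2P i) => ->; case: (ord2P j) => ->.
have KB i j a b : chain_mx a b i j = G i j -> K a b (border X i j).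
  by move=> E; rewrite /K /= (phi_border Y EX i j (dc a b)) E subrr mulr0.
have nKB a b i j (A : 'M[k]_2) U V : (forall h : {rmorphism S -> k}, map_mx h Y = block_mx 1%:M U V A ->
     h (chain_mx a b i j - G i j) != 0) -> ~ K a b (border X i j).
  by move=> H; apply/eqP; exact: (phi_border_neq0 (dc a b) H).
have sub a b a' b' : (forall g : {rmorphism S -> S}, g (Zy 0 1) = a' /\ g (Zy 1 0) = b' ->
    map_mx g G = G -> g a = a' /\ g b = b') -> K a b `<=` K a' b'.
  move=> H x Kx; have [g gZ [_ [gG [_ gphi]]]] := phi_specialize a' b' (dc a b).
  have [ga gb] := H g gZ gG; have := gphi x; rewrite /K /= in Kx *; rewrite Kx rmorph0.
  have -> : map_mx g (chain_mx a b) = chain_mx a' b'.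
    apply/matrixP => i j; rewrite [LHS]mxE [chain_mx _ _ _ _]mxE [RHS]mxE.
    have gG0 : g (G 0 0) = G 0 0 by have := congr1 (fun A : 'M__ => A 0 0) gG; rewrite [LHS]mxE.
    by case: (i == j); case: (i == 0).
  exact: esym.
have gGE (g : {rmorphism S -> S}) i j : map_mx g G = G -> g (G i j) = G i j.
  by move=> gG; have := congr1 (fun A : 'M__ => A i j) gG; rewrite [LHS]mxE.
pose K1 := K (Zy 0 1) (Zy 1 0); pose K2 := K (G 0 1) (Zy 1 0); pose K3 := K (G 0 1) (G 1 0).
have s12 : K1 `<` K2.
  split; first by apply: sub => g [g1 g2] gG.
  move=> H; have : K1 (border X 0 1) by apply: H; apply: KB; rewrite mxE.
  apply: (nKB _ _ _ _ (const_mx 1) 0 0) => h hY; rewrite mxE /= rmorphB.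
  have [-> ->] := eval_vanish 0 1 hY; by rewrite mxE subr0 oner_neq0.
have s23 : K2 `<` K3.
  split; first by apply: sub => g [g1 g2] gG; rewrite gGE.
  move=> H; have : K2 (border X 1 0) by apply: H; apply: KB; rewrite mxE.
  apply: (nKB _ _ _ _ (const_mx 1) 0 0) => h hY; rewrite mxE /= rmorphB.
  have [-> ->] := eval_vanish 1 0 hY; by rewrite mxE subr0 oner_neq0.
have s34 : K3 `<` Q.
  split=> [x Kx|H].
    apply: PQ; apply/(gn1_ideal_ker hk EX EY j0).
    by rewrite /rank_param /= EqW; move: Kx; rewrite /K3 /K /= => ->; rewrite rmorph0.
  have : K3 (border X 1 1) by apply/H/PQ; exact: border_minor.
  (* Here [G 0 0] is 1 and [G 1 1] is 0, a point off the quadric. *)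
  apply: (nKB _ _ _ _ 0 (delta_mx j0 0) (delta_mx 0 j0)) => h hY; rewrite mxE /=.
  have [_ EU EV _] := Y_blocks hY; rewrite rmorphB.
  have hG i j : h (G i j) = ((delta_mx 0 j0 : 'M_(2, n)) *m (delta_mx j0 0 : 'M_(n, 2))) i j.
    by have := congr1 (fun A : 'M__ => A i j) (map_mxM h Vy Uy); rewrite EU EV [LHS]mxE.
  by rewrite !hG mul_delta_mx !mxE /= subr0 oner_neq0.
have s01 : [set 0] `<` K1.
  split=> [_ ->|H]; first by rewrite /K1 /K /= rmorph0.
  have B0 : border X 0 0 = 0 by apply: H; apply: KB; rewrite mxE.
  pose M : 'M[S]_2 := (Zy 0 0)%:M.
  have dM : M 0 0 = M 1 1 by rewrite !mxE.
  have := @phi_border_neq0 M 0 0 (const_mx 1) 0 0 dM; rewrite B0 rmorph0 eqxx => H'.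
  suff : false by []; apply: H' => h hY; rewrite mxE /= mulr1n rmorphB.
  have [-> ->] := eval_vanish 0 0 hY; by rewrite mxE subr0 oner_neq0.
exists (fun i => match i with 0%N => [set 0] | 1%N => K1 | 2 => K2 | 3 => K3 | _ => Q end).
have p0 : prime_ideal [set (0 : R)].
  apply: (@prime_ker R R idfun) => x y /eqP.
  by rewrite mulf_eq0 => /orP[] /eqP; [left|right].
split.
- move=> [|[|[|[|[|i]]]]] hi; [exact: p0|exact: pK|exact: pK|exact: pK|exact: pQ|].
  by move: hi.
- move=> [|[|[|[|i]]]] hi; [exact: s01|exact: s12|exact: s23|exact: s34|].
  by move: hi.
- exact: erefl.
Qed.

Lemma gn1_ideal_no_chain : ~ prime_chain 5 P.
Proof.
pose fr (u : gc_var hm) := match split (sval u).1, split (sval u).2 with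
  | inl _, _ => true | inr a, inl b => ~~ ((a == 1) && (b == j0)) | inr _, inr _ => false end.
pose A := [pred u | fr u]; pose d := #|A|.
have [g [gC gX]] := @mpoly_eval k d R (@mpolyC _ k) (fun i => pvar k (enum_val i : gc_var hm)).
have [r [rC rX]] := @mpoly_eval k #|gc_var hm| {mpoly k[d]} (@mpolyC _ k)
  (fun a => if [pick i : 'I_d | enum_val i == enum_val a] is Some i then 'X_i else 0).
have rg : r \o g =1 idfun.
  apply: mmap_unique => [a|i] /=; first by rewrite gC rC.
  rewrite gX /pvar rX; case: pickP => [j|/(_ i)]; last by rewrite enum_rankK eqxx.
  by rewrite enum_rankK => /eqP/enum_val_inj ->.
have ind : indep_mod P g.
  split=> // p Pgp; have : g p = 0.
    apply: (@free_entries_mod k hk n hm X Y EX EY j0 d g gC _ p Pgp) => i.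
    have fi : fr (enum_val i) by have := enum_valP i.
    have -> : g 'X_i = X (sval (enum_val i)).1 (sval (enum_val i)).2.
      by rewrite gX EX; exact/esym/GC_pvar.
    move: fi; rewrite /fr.
    case: (sval (enum_val i)) => a b /=.
    case: (split_ordP a) => a' ->; case: (split_ordP b) => b' -> //= H.
    - by apply: Or31; exists a', b'; rewrite !mxE.
    - by apply: Or32; exists a', b'; rewrite !mxE.
    - by apply: Or33; exists a', b'; rewrite !mxE.
  by move=> gp; rewrite -[p]rg /= gp rmorph0.
move=> /(chain_bound ind); rewrite -(cardC A) -/d leq_add2l.
suff : (#|[predC A]| <= 4)%N by move=> H /leq_trans /(_ H).
(* The positions of the four variables that are not free; the last diagonal position carries no
   variable of its own. *)
pose s := [:: (rshift n 1, lshift 2 j0); (rshift n 0, rshift n 0); (rshift n 0, rshift n 1);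
  (rshift n 1, rshift n 0)] : seq ('I_(n + 2) * 'I_(n + 2)).
rewrite -(card_image val_inj) cardE; apply: (@leq_trans (size s)) => //.
apply: uniq_leq_size; first exact: enum_uniq.
move=> x; rewrite mem_enum => /mapP [u]; rewrite mem_enum inE /= /fr => nfr ->.
have ul : sval u != (rshift n 1, rshift n 1) by rewrite -(last_rshift hm); exact: (valP u).
have {}nfr : ~~ fr u by exact: nfr.
move: nfr ul; rewrite /fr; case: (sval u) => a b /=.
case: (split_ordP a) => a' ->; case: (split_ordP b) => b' ->;
  rewrite ?(unsplitK (inl _ _)) ?(unsplitK (inr _ _)) //=.
  by rewrite negbK => /andP[/eqP-> /eqP->] _; rewrite inE eqxx.
move=> _; case: (ord2P a') => ->; case: (ord2P b') => ->; rewrite ?eqxx // => _;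
  by rewrite !inE eqxx ?orbT.
Qed.
End Height.

(** * Derivatives of the determinant and the gradient ideal *)

Section DetDerivation.
Variables (R : comNzRingType) (d : R -> R).
Hypotheses (dD : forall x y, d (x + y) = d x + d y) (dM : forall x y, d (x * y) = d x * y + x * d y).

Let d0 : d 0 = 0.
Proof. by have := dD 0 0; rewrite addr0 => /eqP; rewrite -subr_eq0 opprD addrA subrr sub0r oppr_eq0 => /eqP. Qed.
Let d1 : d 1 = 0.
Proof. by have := dM 1 1; rewrite !mulr1 mul1r => /eqP; rewrite -subr_eq0 opprD addrA subrr sub0r oppr_eq0 => /eqP. Qed.
Let dN x : d (- x) = - d x.
Proof. by apply/eqP; rewrite -addr_eq0 -dD addNr d0. Qed.

Lemma derivation_sum (J : Type) (r : seq J) (F : J -> R) : d (\sum_(j <- r) F j) = \sum_(j <- r) d (F j).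
Proof. by elim: r => [|j r IH]; rewrite ?big_nil ?d0 // !big_cons dD IH. Qed.

Lemma derivation_prod p (F : 'I_p -> R) :
  d (\prod_i F i) = \sum_i \prod_j (if j == i then d (F j) else F j).
Proof.
elim: p F => [|p IH] F; first by rewrite !big_ord0 d1.
rewrite big_ord_recl dM IH big_ord_recl /=; congr (_ + _).
  by rewrite big_ord_recl eqxx; congr (_ * _); apply: eq_bigr.
rewrite mulr_sumr; apply: eq_bigr => i _; rewrite big_ord_recl /=; congr (_ * _).
Qed.

Lemma derivation_det p (A : 'M[R]_p) : d (\det A) = \sum_i \sum_j d (A i j) * cofactor A i j.
Proof.
have dsgn (b : bool) x : d ((-1) ^+ b * x) = (-1) ^+ b * d x.
  by case: b; rewrite ?expr0 ?expr1 ?mul1r // !mulN1r dN.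
pose B i := \matrix_(a, b) if a == i then d (A a b) else A a b.
rewrite {1}/determinant derivation_sum.
transitivity (\sum_i \det (B i)).
  rewrite [RHS]exchange_big /=; apply: eq_bigr => s _.
  rewrite dsgn derivation_prod mulr_sumr; apply: eq_bigr => i _; congr (_ * _).
  by apply: eq_bigr => j _; rewrite mxE.
apply: eq_bigr => i _; rewrite (expand_det_row _ i); apply: eq_bigr => j _.
rewrite mxE eqxx /cofactor; congr (_ * (_ * \det _)).
by apply/matrixP => a b; rewrite !mxE eq_sym (negPf (neq_lift _ _)).
Qed.
End DetDerivation.

Lemma sum_delta (T : comNzRingType) p (D c : 'I_p -> 'I_p -> T) i j :
  (forall a b, D a b = ((a, b) == (i, j))%:R) -> \sum_a \sum_b D a b * c a b = c i j.
Proof.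
move=> H; rewrite (bigD1 i) //= (bigD1 j) //= H eqxx mul1r !big1 ?addr0 // => [a ai|b bj].
  by rewrite big1 // => b _; rewrite H xpair_eqE (negPf ai) mul0r.
by rewrite H xpair_eqE (negPf bj) andbF mul0r.
Qed.

Lemma sum_delta2 (T : comNzRingType) p (D c : 'I_p -> 'I_p -> T) i j : i != j ->
  (forall a b, D a b = (((a, b) == (i, i)) || ((a, b) == (j, j)))%:R) ->
  \sum_a \sum_b D a b * c a b = c i i + c j j.
Proof.
move=> ij H; rewrite -(@sum_delta T p (fun a b => ((a, b) == (i, i))%:R) c i i) //.
rewrite -(@sum_delta T p (fun a b => ((a, b) == (j, j))%:R) c j j) //.
rewrite -big_split; apply: eq_bigr => a _; rewrite -big_split; apply: eq_bigr => b _ /=.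
rewrite H -mulrDl; congr (_ * _); rewrite !xpair_eqE.
have [->|] := eqVneq a i; last by rewrite /= add0r.
by rewrite (negPf ij) /= addr0 orbF.
Qed.

Section Gradient.
Variables (k : fieldType) (n : nat) (hm : (3 <= n + 2)%N).
Local Notation R := {mpoly k[#|gc_var hm|]}.
Variables (X : 'M[R]_(n + 2)) (EX : X = GC k hm).
Local Notation J := (gradient_ideal (\det X)).
Local Notation pp := (rshift n (0 : 'I_2)).
Local Notation ll := (rshift n (1 : 'I_2)).


Lemma mderiv_var (a : 'I_#|gc_var hm|) b : mderiv a 'X_b = (a == b)%:R :> R.
Proof.
rewrite mderivX mnm1E eq_sym; case: eqVneq => [->|_]; last by rewrite mulr0n scale0r.
have -> : (U_(b) - U_(b) = 0 :> 'X_{1..#|gc_var hm|})%MM by apply/mnmP => i; rewrite mnmBE mnm0E subnn.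
by rewrite mulr1n scale1r mpolyX0.
Qed.

Lemma mderiv_det (a : 'I_#|gc_var hm|) :
  mderiv a (\det X) = \sum_i \sum_j mderiv a (X i j) * cofactor X i j.
Proof.
apply: (@derivation_det R (mderiv a)) => x y; first by rewrite linearD.
by rewrite mderivM.
Qed.

Lemma entry_var i j : X i j = 'X_(enum_rank (insubd (gc_var_penult hm) (i, j))).
Proof. by rewrite EX mxE. Qed.

Lemma insubd_gc (i j : 'I_(n + 2)) (u : gc_var hm) :
  insubd (gc_var_penult hm) (i, j) = u <-> (i, j) = val u \/ (i, j) = (ll, ll) /\ val u = (pp, pp).
Proof.
have E : ord_last hm = ll := last_rshift hm; have E' : ord_penult hm = pp := penult_rshift hm.
split=> [<-|].
  rewrite val_insubd; case: ifP => [_|/negbFE/eqP ->]; first by left.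
  by right; split; [congr pair; exact: E|rewrite /= E'].
case=> [->|[-> Eu]]; first by rewrite valKd.
apply: val_inj; rewrite val_insubd Eu.
have -> : ((ll, ll) != (ord_last hm, ord_last hm)) = false by rewrite -E eqxx.
by rewrite /= E'.
Qed.

Lemma gradient_adj i j : (i, j) != (pp, pp) -> (i, j) != (ll, ll) -> J ((\adj X) j i).
Proof.
move=> npp nll; have nl : (i, j) != (ord_last hm, ord_last hm) by rewrite (last_rshift hm).
pose u : gc_var hm := Sub (i, j) nl.
apply: sub_ideal_gen; exists (enum_rank u) => //; rewrite mderiv_det adjE.
have D a b : mderiv (enum_rank u) (X a b) = ((a, b) == (i, j))%:R.
  rewrite entry_var mderiv_var (inj_eq enum_rank_inj) eq_sym; congr ((nat_of_bool _)%:R); apply/idP/eqP.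
    by move=> /eqP/insubd_gc [//|[_ /= E]]; rewrite E eqxx in npp.
  by move=> E; apply/eqP/insubd_gc; left.
by rewrite (sum_delta _ D).
Qed.

Lemma pp_neq_ll : (pp == ll) = false.
Proof. by rewrite (inj_eq (@rshift_inj _ _)). Qed.

Lemma mderiv_penult :
  mderiv (enum_rank (gc_var_penult hm)) (\det X) = (\adj X) pp pp + (\adj X) ll ll.
Proof.
rewrite mderiv_det !adjE.
have D a b : mderiv (enum_rank (gc_var_penult hm)) (X a b) = (((a, b) == (pp, pp)) || ((a, b) == (ll, ll)))%:R.
  rewrite entry_var mderiv_var (inj_eq enum_rank_inj) eq_sym; congr ((nat_of_bool _)%:R); apply/idP/orP.
    by move=> /eqP/insubd_gc [->|[-> _]]; [left; rewrite /= (penult_rshift hm)|right].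
  by move=> [] /eqP E; apply/eqP/insubd_gc; rewrite E /= (penult_rshift hm); [left|right].
by rewrite (sum_delta2 _ _ D) // pp_neq_ll.
Qed.

Lemma gradient_sum : J ((\adj X) pp pp + (\adj X) ll ll).
Proof. by rewrite -mderiv_penult; apply: sub_ideal_gen; exists (enum_rank (gc_var_penult hm)). Qed.

Lemma gradient_sub (I : set R) : is_ideal I ->
  (forall i j, (i, j) != (pp, pp) -> (i, j) != (ll, ll) -> I ((\adj X) j i)) ->
  I ((\adj X) pp pp + (\adj X) ll ll) -> J `<=` I.
Proof.
move=> iI H1 H2; apply: ideal_gen_sub => // _ [a _ <-].
have [ep|np] := eqVneq (val (enum_val a : gc_var hm)) (pp, pp).
  have -> : a = enum_rank (gc_var_penult hm).
    by rewrite -[a]enum_valK; congr enum_rank; apply: val_inj; rewrite ep /= (penult_rshift hm).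
  by rewrite mderiv_penult.
have nl : val (enum_val a : gc_var hm) != (ll, ll) by rewrite -(last_rshift hm); exact: (valP (enum_val a)).
rewrite mderiv_det; apply: ideal_sum => // i _; apply: ideal_sum => // j _.
rewrite entry_var mderiv_var; case: eqP => [E|_]; last by rewrite mul0r; apply: ideal0.
rewrite mul1r -adjE; have {E} : insubd (gc_var_penult hm) (i, j) = enum_val a.
  by rewrite E enum_rankK.
move=> /insubd_gc [E|[_ E]]; last by rewrite E eqxx in np.
by apply: H1; rewrite E.
Qed.
End Gradient.

Lemma adj_unique (T : idomainType) p (A Z : 'M[T]_p) :
  \det A != 0 -> A *m Z = (\det A)%:M -> \adj A = Z.
Proof.
move=> d0 AZ; have E : \det A *: \adj A = \det A *: Z.
  by rewrite -[LHS]mul_mx_scalar -AZ mulmxA mul_adj_mx mul_scalar_mx.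
apply/matrixP => i j; apply: (mulfI d0).
by have := congr1 (fun B : 'M_p => B i j) E; rewrite [LHS]mxE [RHS]mxE.
Qed.

(** * Adjugates of block matrices and a test curve *)

Section BlockAdjugate.
Variables (T : idomainType) (n : nat) (C : 'M[T]_n) (U : 'M[T]_(n, 2)) (V : 'M[T]_(2, n)) (M : 'M[T]_2).
Local Notation X := (block_mx C (C *m U) V (V *m U + M)).

Lemma det_rank_block : \det X = \det C * \det M.
Proof.
have -> : X = block_mx C 0 V 1%:M *m block_mx 1%:M U 0 M.
  by rewrite mulmx_block !mulmx1 !mulmx0 !mul0mx !mul1mx !addr0.
by rewrite det_mulmx det_lblock det_ublock !det1 mulr1 mul1r.
Qed.

Lemma adj_rank_block : \det C != 0 -> \det M != 0 -> \adj X =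
  block_mx (\det M *: \adj C + U *m \adj M *m V *m \adj C) (- (\det C *: (U *m \adj M)))
    (- (\adj M *m V *m \adj C)) (\det C *: \adj M).
Proof.
move=> c0 m0; apply: adj_unique; first by rewrite det_rank_block mulf_neq0.
rewrite det_rank_block mulmx_block scalar_mx_block; congr block_mx.
- rewrite mulmxDr -scalemxAr mul_mx_adj mulmxN !mulmxA addrK scale_scalar_mx mulrC //.
- by rewrite mulmxN -!scalemxAr !mulmxA addNr.
- rewrite mulmxDr mulmxN mulmxDl !mulmxA opprD addrA.
  by rewrite -!mulmxA [M *m _]mulmxA mul_mx_adj mul_scalar_mx -scalemxAr addrK subrr.
- rewrite mulmxN -!scalemxAr mulmxDl scalerDr !mulmxA addrA addNr add0r.
  by rewrite mul_mx_adj scale_scalar_mx.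
Qed.
End BlockAdjugate.

Section OrderIdeal.
Variable R : idomainType.

Definition ord_ge d : set {poly R} := [set p | exists q, p = 'X^d * q].

Lemma is_ideal_ord d : is_ideal (ord_ge d).
Proof.
split; first by exists 0; rewrite mulr0.
  by move=> _ _ [s ->] [t ->]; exists (s + t); rewrite mulrDr.
by move=> a _ [s ->]; exists (a * s); rewrite mulrCA.
Qed.

Lemma ord_geM a b p q : ord_ge a p -> ord_ge b q -> ord_ge (a + b) (p * q).
Proof. by move=> [s ->] [t ->]; exists (s * t); rewrite exprD mulrACA. Qed.

Lemma ord_ge1 p : p.[0] = 0 -> ord_ge 1 p.
Proof.
move=> p0; have /factor_theorem [q ->] : root p 0 by apply/rootP.
by exists q; rewrite subr0 expr1 mulrC.
Qed.

Lemma ord_ge_cancel d p q : q.[0] != 0 -> ord_ge d (p * q) -> ord_ge d p.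
Proof.
move=> q0; elim: d p => [|d IH] p; first by exists p; rewrite expr0 mul1r.
move=> [s E]; have p0 : p.[0] = 0.
  have /eqP : (p * q).[0] = 0 by rewrite E exprS !hornerM hornerX !mul0r.
  by rewrite hornerM mulf_eq0 (negPf q0) orbF => /eqP.
have [p' Ep] := ord_ge1 p0; rewrite expr1 in Ep.
have X0 : 'X != 0 :> {poly R} by rewrite polyX_eq0.
have [|t Et] := IH p'; last by exists t; rewrite Ep Et exprS mulrA.
by exists s; apply: (mulfI X0); rewrite mulrA -Ep E exprS mulrA.
Qed.
End OrderIdeal.

Section Curve.
Variables (k : fieldType) (n : nat) (hm : (3 <= n + 2)%N).
Local Notation R := {mpoly k[#|gc_var hm|]}.
Variables (X : 'M[R]_(n + 2)) (EX : X = GC k hm) (j0 : 'I_n).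
Local Notation C := (ulsubmx X).
Local Notation c := (\det C).
Local Notation P := (gn1_ideal X).
Local Notation J := (gradient_ideal (\det X)).
Local Notation pp := (rshift n (0 : 'I_2)).
Local Notation ll := (rshift n (1 : 'I_2)).
Local Notation Dll := ((\adj X) ll ll).

(** The curve consists of matrices [block_mx C (C *m U) V (V *m U + M)] with [U], [V] of order 1 and
    [M] of order 2. Opposite signs in [M] make the last two diagonal cofactors opposite, so that
    their sum in the gradient vanishes; the factor -2 in [Vt] makes the last two diagonal entries of
    the matrix equal again. *)
Let sgn2 : 'M[{poly R}]_2 := \matrix_(i, j) if i == j then if i == 0 then 1 else -1 else 0.
Let Ct := map_mx polyC C.
Let Ut : 'M[{poly R}]_(n, 2) := 'X *: delta_mx j0 0.
Let Vt : 'M[{poly R}]_(2, n) := (- 'X *+ 2) *: delta_mx 0 j0.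
Let Mt : 'M[{poly R}]_2 := 'X^2 *: sgn2.

Let Mt_det : \det Mt = - 'X^4.
Proof.
rewrite detZ (expand_det_row _ 0) big_ord_recl big_ord1 /cofactor !det_mx11 !mxE /=.
rewrite -exprM; ring.
Qed.

Let sgn2K : sgn2 *m sgn2 = 1%:M.
Proof.
apply/matrixP => i j; rewrite mxE big_ord_recl big_ord1 !mxE.
by case: (ord2P i) => ->; case: (ord2P j) => -> /=; ring.
Qed.

Let Mt_adj : \adj Mt = - 'X^2 *: sgn2.
Proof.
apply: adj_unique; first by rewrite Mt_det oppr_eq0 expf_neq0 // polyX_eq0.
rewrite Mt_det /Mt -scalemxAl -scalemxAr sgn2K scalerA scale_scalar_mx mulr1.
by congr (_%:M); ring.
Qed.

(* A curve through the embedded component along which the generators of the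
   gradient ideal have order 3, while the minor [Dll] has order 2. *)
Lemma curve_exists : exists gamma : {rmorphism R -> {poly R}},
  [/\ map_mx (horner_eval 0 \o gamma) X = block_mx C 0 0 0,
      forall a, (gamma a%:MP).[0] = a%:MP,
      gamma (X (lshift 2 j0) pp) = 'X * (X (lshift 2 j0) (lshift 2 j0))%:P,
      gamma Dll = c%:P * 'X^2 &
      J `<=` [set x | ord_ge 3 (gamma x)]].
Proof.
pose Z := block_mx Ct (Ct *m Ut) Vt (Vt *m Ut + Mt).
have VU : Vt *m Ut = (- 'X^2 *+ 2) *: delta_mx 0 0.
  rewrite /Vt /Ut -scalemxAl -scalemxAr mul_delta_mx scalerA; congr (_ *: _); ring.
have dW : (Vt *m Ut + Mt) 0 0 = (Vt *m Ut + Mt) 1 1.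
  by rewrite VU !mxE /=; ring.
have [g [gC gX]] : exists g : {rmorphism R -> {poly R}}, (forall a, g a%:MP = (a%:MP)%:P) /\
    map_mx g X = Z.
  exists (gc_eval (hm := hm) (@polyC R \o @mpolyC _ k) Z); split; last exact: (gc_eval_mx EX).
  by move=> a; exact: gc_evalC.
have adjZ : map_mx g (\adj X) = block_mx (\det Mt *: \adj Ct + Ut *m \adj Mt *m Vt *m \adj Ct)
    (- (\det Ct *: (Ut *m \adj Mt))) (- (\adj Mt *m Vt *m \adj Ct)) (\det Ct *: \adj Mt).
  rewrite map_mx_adj gX adj_rank_block //.
    by rewrite det_map_mx polyC_eq0 (corner_neq0 EX).
  by rewrite Mt_det oppr_eq0 expf_neq0 // polyX_eq0.
have adjE' i j : g ((\adj X) i j) = (map_mx g (\adj X)) i j by rewrite [RHS]mxE.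
have Ell a b : g ((\adj X) (rshift n a) (rshift n b)) = c%:P * (- 'X^2 * sgn2 a b).
  by rewrite adjE' adjZ block_mxEdr Mt_adj det_map_mx [LHS]mxE [X in _ * X]mxE.
exists g; split.
- rewrite map_mx_comp gX map_block_mx; congr block_mx.
  + by apply/matrixP => i j; rewrite !mxE /horner_eval hornerC.
  + by apply/matrixP => i j; rewrite /Ut -scalemxAr !mxE /horner_eval hornerM hornerX mul0r.
  + by apply/matrixP => i j; rewrite /Vt !mxE /horner_eval hornerM hornerMn hornerN hornerX oppr0 mul0rn mul0r.
  + have -> : Vt *m Ut + Mt = 'X *: ((- 'X *+ 2) *: delta_mx 0 0 + 'X *: sgn2).
      by rewrite VU /Mt scalerDr !scalerA; congr (_ *: _ + _ *: _); ring.
    by apply/matrixP => i j; rewrite [LHS]mxE [X in horner_eval _ X]mxE [RHS]mxE /horner_eval hornerM hornerX mul0r.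
- by move=> a; rewrite gC hornerC.
- have e i j : g (X i j) = Z i j by rewrite -gX [RHS]mxE.
  rewrite e block_mxEur /Ut -scalemxAr [LHS]mxE; congr (_ * _).
  rewrite mxE (bigD1 j0) //= !mxE !eqxx mulr1 big1 ?addr0 // => i ij.
  by rewrite [delta_mx _ _ _ _]mxE (negPf ij) mulr0.
- by rewrite Ell mxE /=; ring.
have i3 : is_ideal [set x | ord_ge 3 (g x)].
  have io := @is_ideal_ord R 3; split; first by rewrite /= rmorph0; apply: ideal0.
    by move=> x y; rewrite /= rmorphD; apply: idealD.
  by move=> x y; rewrite /= rmorphM; apply: idealMl.
apply: (gradient_sub EX i3) => [i j|] /=; last first.
  rewrite rmorphD !Ell !mxE /= -mulrDr; exists 0; ring.
rewrite adjE'; have mem3 p q (A B : 'M[{poly R}]_(p, q)) x y : A = 'X^3 *: B -> ord_ge 3 (A x y).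
  by move=> ->; exists (B x y); rewrite mxE.
rewrite adjZ Mt_det Mt_adj.
case: (split_ordP i) => a ->; case: (split_ordP j) => b -> h1 h2.
- rewrite block_mxEul; apply: (mem3 _ _ _ (- 'X *: \adj Ct +
    ('X *+ 2) *: (delta_mx j0 0 *m sgn2 *m delta_mx 0 j0 *m \adj Ct))).
  rewrite /Ut /Vt -!(scalemxAl, scalemxAr) !scalerDr !scalerA.
  by congr (_ *: _ + _ *: _); ring.
- rewrite block_mxEdl; apply: (mem3 _ _ _ (- 2 *: (sgn2 *m delta_mx 0 j0 *m \adj Ct))).
  rewrite /Vt -!(scalemxAl, scalemxAr) !scalerA -scaleNr.
  by congr (_ *: _); ring.
- rewrite block_mxEur; apply: (mem3 _ _ _ (\det Ct *: (delta_mx j0 0 *m sgn2))).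
  rewrite /Ut -!(scalemxAl, scalemxAr) !scalerA -scaleNr.
  by congr (_ *: _); ring.
- rewrite block_mxEdr !mxE; case: eqP => [eba|_]; last by exists 0; ring.
  move: h1 h2; rewrite eba; case: (ord2P a) => ->; rewrite ?eqxx //.
Qed.

Lemma kappa_exists : exists2 kappa : {rmorphism R -> R},
  map_mx kappa X = block_mx C 0 0 0 & forall a, kappa a%:MP = a%:MP.
Proof.
exists (gc_eval (hm := hm) (@mpolyC _ k) (block_mx C 0 0 0)).
  by apply: (gc_eval_mx EX); rewrite !mxE.
by move=> a; exact: gc_evalC.
Qed.
End Curve.

(** * Double structures: minimal, associated and primary data *)

Section DoubleStructure.
Variables (R : comNzRingType) (J P E I3 : set R) (D : R).
Hypotheses (iJ : is_ideal J) (pP : prime_ideal P) (pE : prime_ideal E) (i3 : is_ideal I3).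
Hypotheses (JP : J `<=` P) (PD : P D) (PJD : forall x, P x -> exists b, J (x - b * D)).
Hypotheses (ED : forall x, E x -> J (x * D)) (PE : P `<=` E) (EnP : exists2 e, E e & ~ P e).
Hypotheses (J3 : J `<=` I3) (D3 : forall b, I3 (b * D) -> E b).
Hypotheses (primary3 : forall x y, I3 (x * y) -> ~ E y -> I3 x)
  (E3 : forall x, E x -> exists n, I3 (x ^+ n)) (I3E : I3 `<=` E).

Let iP : is_ideal P. Proof. by case: pP. Qed.
Let iE : is_ideal E. Proof. by case: pE. Qed.

Lemma prime_exp (Q : set R) x n : prime_ideal Q -> Q (x ^+ n) -> Q x.
Proof.
move=> [_ Q1 pQ]; elim: n => [|n IH]; first by rewrite expr0 => /Q1.
by rewrite exprS => /pQ [].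
Qed.

Lemma JD b : J (b * D) <-> E b.
Proof. by split=> [/J3/D3|/ED]. Qed.

(** Modulo [J] the factor [y] is a multiple of [D], and [x], being in [E], multiplies [D] into
    [J]. *)
Lemma double_mul x y : P x -> P y -> J (x * y).
Proof.
move=> Px Py; have [b Hb] := PJD Py.
apply: (ideal_subr iJ (y := b * (x * D))).
  have -> : x * y - b * (x * D) = x * (y - b * D) by ring.
  by apply: (idealMl x iJ).
by apply: (idealMl b iJ); apply/ED/PE.
Qed.

Lemma double_exp : ideal_exp P 2 `<=` J.
Proof.
apply: ideal_gen_sub => // _ [x Px [y Hy <-]]; apply: double_mul => //.
move: y Hy; apply: ideal_gen_sub => // _ [a Pa [b _ <-]]; exact: idealMr.
Qed.

Lemma double_prime_sub Q : prime_ideal Q -> J `<=` Q -> P `<=` Q.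
Proof. by move=> [_ _ pQ] JQ x Px; have /JQ/pQ [] := double_mul Px Px. Qed.

Lemma double_minimal Q : minimal_prime J Q <-> Q = P.
Proof.
split=> [[pQ JQ mQ]|->]; first by apply/esym/mQ => //; exact: double_prime_sub.
by split=> // Q0 pQ JQ QP; apply/seteqP; split=> //; exact: double_prime_sub.
Qed.

(** Let [Q] be the annihilator of [x] modulo [J]. If [x] lies in [P], it is [b * D] modulo [J] with
    [b] outside [E], and [Q] is [E]; otherwise primality of [P] puts [Q] inside [P], and [Q] is
    minimal. *)
Lemma double_embedded Q : embedded_prime J Q <-> Q = E.
Proof.
split=> [[[pQ [x EQ]] nQ]|->]; last first.
  split; first by split=> //; exists D; apply/seteqP; split=> a /JD.
  move=> /double_minimal EP; have [e Ee] := EnP; by rewrite -EP.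
have nJx : ~ J x.
  move=> Jx; have [_ Q1 _] := pQ; apply: Q1; by rewrite EQ /= mul1r.
have JQ : J `<=` Q by move=> a Ja; rewrite EQ; apply: (idealMr x iJ).
have [Px|nPx] := pselect (P x).
  have [b Hb] := PJD Px.
  have Jx a : J (a * x) <-> J (a * b * D).
    have Ha : J (a * x - a * b * D).
      have -> : a * x - a * b * D = a * (x - b * D) by ring.
      exact: (idealMl a iJ).
    by split=> H; [exact: (ideal_subl iJ Ha H)|exact: (ideal_subr iJ Ha H)].
  have nEb : ~ E b by move=> /JD Jb; apply: nJx; rewrite -[x]mul1r; apply/Jx; rewrite mul1r.
  rewrite EQ; apply/seteqP; split=> a /=; rewrite Jx JD; last by move=> Ea; apply: (idealMr b iE).
  by case: pE => _ _ pE' /pE' [].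
case: nQ; apply/double_minimal/seteqP; split; last exact: double_prime_sub.
by move=> a; rewrite EQ => /JP; case: pP => _ _ pP' /pP' [].
Qed.

(** An element of [E] outside [P] multiplies [P] into [J], so every component with radical [P]
    contains [P]. Conversely [P] and [I3] form an irredundant decomposition, [I3] being primary with
    radical [E]. *)
Lemma double_component Q : primary_component J P Q <-> Q = P.
Proof.
split=> [[n [F [i [[prF EJ _ _] <- rF]]]]|->].
  have [iF F1 primF] := prF i.
  apply/seteqP; split=> x Hx.
    by rewrite -rF; exists 1%N; rewrite expr1.
  have [b Hb] := PJD Hx; have [e Ee nPe] := EnP.
  have Jex : J (x * e).
    rewrite mulrC; apply: (ideal_subr iJ (y := b * (e * D))).
      have -> : e * x - b * (e * D) = e * (x - b * D) by ring.
      exact: (idealMl e iJ).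
    by apply: (idealMl b iJ); apply/ED.
  have : F i (x * e) by move: Jex; rewrite EJ => /(_ i); apply.
  by case/primF => // re; case: nPe; rewrite -rF.
have radP : radical P = P.
  apply/seteqP; split=> x; last by move=> Px; exists 1%N; rewrite expr1.
  by move=> [n]; exact: prime_exp.
have rad3 : radical I3 = E.
  by apply/seteqP; split=> x; [move=> [n /I3E]; exact: prime_exp|exact: E3].
(* An element of [P] is [b * D] modulo [J]; if it also lies in [I3], then [b] lies in [E], hence
   [b * D] in [J]. *)
have EPJ : J = P `&` I3.
  apply/seteqP; split=> x; first by move=> Jx; split; [exact: JP|exact: J3].
  move=> [Px Ix]; have [b Hb] := PJD Px; apply: (ideal_subr iJ Hb); apply/JD/D3.
  by apply: (ideal_subl i3 (J3 Hb)).
have [e Ee nPe] := EnP.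
have nEP : E <> P by move=> EP; apply: nPe; rewrite -EP.
pose F (i : 'I_2) := if i == 0 then P else I3.
have F2 (Z : 'I_2 -> Prop) : (forall i, Z i) <-> Z 0 /\ Z 1.
  split=> [H|[H0 H1] [[|[|//]] Hi]]; first by split.
    by have -> : Ordinal Hi = 0 by apply: val_inj.
  by have -> : Ordinal Hi = 1 by apply: val_inj.
have o2 (l : 'I_2) : l = 0 \/ l = 1 by move: l; apply/F2; split; [left|right].
have radF i : radical (F i) = if i == 0 then P else E by rewrite /F; case: (i == 0).
exists 2, F, 0; split=> //; split.
- apply/F2; split; rewrite /F /=; split=> //.
  + by case: pP.
  + by case: pP => _ _ pP' x y /pP' []; [left|right; rewrite radP].
  + by move=> /I3E; case: pE.
  + by move=> x y H; rewrite rad3; have [Ey|nEy] := pselect (E y); [right|left; exact: primary3 H nEy].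
- rewrite EPJ; apply/seteqP; split=> x; first by move=> [Px Ix] i _; rewrite /F; case: (i == 0).
  by move=> H; split; [exact: (H 0 I)|exact: (H 1 I)].
- move=> i j; rewrite !radF.
  by case: (o2 i) => ->; case: (o2 j) => -> //= H; case: nEP.
- have [q Iq nPq] : exists2 q, I3 q & ~ P q.
    have [m Hm] := E3 Ee; exists (e ^+ m) => //; by move=> /(prime_exp pP).
  apply/F2; split=> H.
    by apply: nPq; apply: (H q) => j; rewrite /= /F => /negPf ->.
  have : I3 D.
    by apply: (H D) => j /= j1; case: (o2 j) j1 => ->; rewrite ?eqxx.
  by rewrite -[D]mul1r => /D3; case: pE.
Qed.
End DoubleStructure.

(** * The double structure defined by the gradient ideal *)

Section GradientStructure.
Variables (k : fieldType) (hk : [pchar k] =i pred0) (n : nat) (hm : (3 <= n + 2)%N).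
Local Notation R := {mpoly k[#|gc_var hm|]}.
Variables (X : 'M[R]_(n + 2)) (EX : X = GC k hm) (j0 : 'I_n).
Local Notation C := (ulsubmx X).
Local Notation c := (\det C).
Local Notation P := (gn1_ideal X).
Local Notation J := (gradient_ideal (\det X)).
Local Notation pp := (rshift n (0 : 'I_2)).
Local Notation ll := (rshift n (1 : 'I_2)).
Local Notation D := ((\adj X) ll ll).

Let iJ : is_ideal J. Proof. exact: is_ideal_gen. Qed.

Lemma lr_neq (a : 'I_n) (b : 'I_2) : (lshift 2 a == rshift n b) = false.
Proof. by apply/eqP => /(congr1 val) /= E; have := ltn_ord a; lia. Qed.

Lemma gradient_offdiag i j : i != j -> J ((\adj X) i j).
Proof.
by move=> ij; apply: (gradient_adj EX); rewrite xpair_eqE; apply/negP => /andP[/eqP e1 /eqP e2];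
  rewrite e1 e2 eqxx in ij.
Qed.

Lemma gradient_corner (a : 'I_n) : J ((\adj X) (lshift 2 a) (lshift 2 a)).
Proof. by apply: (gradient_adj EX); rewrite xpair_eqE lr_neq. Qed.

(** The expansion runs along a row through the corner block, where every cofactor is a partial
    derivative; in the last two rows the diagonal cofactor is known only up to the sum. *)
Lemma gradient_det : J (\det X).
Proof.
suff : J (\sum_j X (lshift 2 j0) j * cofactor X (lshift 2 j0) j) by rewrite -expand_det_row.
apply: (ideal_sum _ iJ) => j _.
rewrite -adjE; apply: (idealMl _ iJ).
have [->|/gradient_offdiag //] := eqVneq j (lshift 2 j0).
exact: gradient_corner.
Qed.

Lemma gradient_sub_gn1 : J `<=` P.
Proof.
apply: (gradient_sub EX (is_ideal_gn1 X)) => [i j _ _|]; first exact: gn1_ideal_adj.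
by apply: (idealD (is_ideal_gn1 X)); exact: gn1_ideal_adj.
Qed.

Lemma gn1_mod_gradient x : P x -> exists b, J (x - b * D).
Proof.
have iI : is_ideal [set x | exists b, J (x - b * D)].
  split; first by exists 0; rewrite mul0r subr0; exact: (ideal0 iJ).
    move=> u v [a Ha] [b Hb]; exists (a + b).
    have -> : u + v - (a + b) * D = (u - a * D) + (v - b * D) by ring.
    exact: (idealD iJ Ha Hb).
  move=> a u [b Hb]; exists (a * b).
  have -> : a * u - a * b * D = a * (u - b * D) by ring.
  exact: (idealMl _ iJ).
apply: (gn1_ideal_sub (I := [set x | exists b, J (x - b * D)]) iI) => [i j|]; last first.
  by exists 0; rewrite mul0r subr0; exact: gradient_det.
have [->|ij] := eqVneq i j; last first.
  by exists 0; rewrite mul0r subr0; exact: gradient_offdiag.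
case: (split_ordP j) => a ->; first by exists 0; rewrite mul0r subr0; exact: gradient_corner.
case: (ord2P a) => ->; last by exists 1; rewrite mul1r subrr; exact: (ideal0 iJ).
by exists (-1); rewrite mulN1r opprK; exact: (gradient_sum EX).
Qed.

Lemma gradient_entry i b : J (X i (rshift n b) * D) /\ J (X (rshift n b) i * D).
Proof.
have sgn y : J (y * (\adj X) (rshift n b) (rshift n b)) -> J (y * D).
  case: (ord2P b) => -> // H; have S := idealMl y iJ (gradient_sum EX).
  apply: (ideal_subr iJ (y := - (y * (\adj X) pp pp))); last exact: (idealN iJ H).
  by rewrite opprK addrC -mulrDr.
split; apply: sgn.
  have E : \sum_j X i j * (\adj X) j (rshift n b) = \det X *+ (i == rshift n b).
    by have := congr1 (fun A : 'M__ => A i (rshift n b)) (mul_mx_adj X); rewrite [LHS]mxE [X in _ = X]mxE.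
  rewrite (bigD1 (rshift n b)) //= in E.
  have {}E : X i (rshift n b) * (\adj X) (rshift n b) (rshift n b) =
      \det X *+ (i == rshift n b) - \sum_(j | j != rshift n b) X i j * (\adj X) j (rshift n b).
    by rewrite -E addrK.
  rewrite E; apply: (idealB iJ); first by case: (i == _); [exact: gradient_det|exact: (ideal0 iJ)].
  by apply: (ideal_sum _ iJ) => j jb; apply: (idealMl _ iJ); exact: gradient_offdiag.
have E : \sum_j (\adj X) (rshift n b) j * X j i = \det X *+ (rshift n b == i).
  by have := congr1 (fun A : 'M__ => A (rshift n b) i) (mul_adj_mx X); rewrite [LHS]mxE [X in _ = X]mxE.
rewrite (bigD1 (rshift n b)) //= in E.
have {}E : X (rshift n b) i * (\adj X) (rshift n b) (rshift n b) =
    \det X *+ (rshift n b == i) - \sum_(j | j != rshift n b) (\adj X) (rshift n b) j * X j i.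
  by rewrite -E addrK mulrC.
rewrite E; apply: (idealB iJ); first by case: (_ == i); [exact: gradient_det|exact: (ideal0 iJ)].
by apply: (ideal_sum _ iJ) => j jb; apply: (idealMr _ iJ); apply: gradient_offdiag; rewrite eq_sym.
Qed.

Section Kappa.
Variable kappa : {rmorphism R -> R}.
Hypotheses (kX : map_mx kappa X = block_mx C 0 0 0) (kC : forall a, kappa a%:MP = a%:MP).

Lemma kappa_entry i j : kappa (X i j) = (block_mx C 0 0 0 : 'M_(n + 2)) i j.
Proof. by rewrite -kX [RHS]mxE. Qed.

(** Modulo an ideal containing the last two rows and columns, [kappa] is the identity. *)
Lemma kappa_congr (I : set R) : is_ideal I ->
  (forall i b, I (X i (rshift n b)) /\ I (X (rshift n b) i)) -> forall x, kappa x = 0 -> I x.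
Proof.
move=> iI H x kx; have : I (x - kappa x); last by rewrite kx subr0.
apply: (gc_congr EX (f := idfun) iI) => [a|i j /=]; first by rewrite kC.
rewrite kappa_entry; case: (split_ordP i) => a ->; case: (split_ordP j) => b ->.
- by rewrite block_mxEul !mxE subrr; exact: ideal0.
- by rewrite block_mxEur mxE subr0; case: (H (lshift 2 a) b).
- by rewrite block_mxEdl mxE subr0; case: (H (lshift 2 b) a).
- by rewrite block_mxEdr mxE subr0; case: (H (rshift n a) b).
Qed.

Lemma kappa_gn1 x : P x -> kappa x = 0.
Proof.
have [iK _ _] : prime_ideal [set x | kappa x = 0].
  by apply: prime_ker => u v /eqP; rewrite mulf_eq0 => /orP[] /eqP; [left|right].
have E : map_mx kappa X = col_mx C 0 *m row_mx 1%:M 0.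
  by rewrite kX mul_col_row !mulmx1 !mulmx0.
apply: (gn1_ideal_sub (I := [set x | kappa x = 0]) iK) => [i j|] /=.
  have -> : kappa ((\adj X) i j) = (map_mx kappa (\adj X)) i j by rewrite [RHS]mxE.
  by rewrite map_mx_adj E adj_lowrank mxE.
by rewrite -det_map_mx E det_lowrank //; lia.
Qed.

Lemma linear_ideal_kappa : linear_ideal (4 * (n + 2) - 5) [set x | kappa x = 0].
Proof.
have [iK _ _] : prime_ideal [set x | kappa x = 0].
  by apply: prime_ker => u v /eqP; rewrite mulf_eq0 => /orP[] /eqP; [left|right].
pose inC (u : gc_var hm) := match split (sval u).1, split (sval u).2 with inl _, inl _ => true | _, _ => false end.
pose A := [pred u | ~~ inC u].
(* Outside the corner block there are [m ^ 2 - 1 - n ^ 2] variables, which is [4 * m - 5] for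
   [m = n + 2]. *)
have cA : #|A| = (4 * (n + 2) - 5)%N.
  have cB : #|[predC A]| = (n * n)%N.
    have nl (p : 'I_n * 'I_n) : (lshift 2 p.1, lshift 2 p.2) != (ord_last hm, ord_last hm).
      by rewrite (last_rshift hm) xpair_eqE lr_neq.
    pose F p : gc_var hm := Sub (lshift 2 p.1, lshift 2 p.2) (nl p).
    have Finj : injective F.
      move=> [a b] [a' b'] /(congr1 val) /= E.
      by rewrite (lshift_inj (congr1 fst E)) (lshift_inj (congr1 snd E)).
    rewrite -[in RHS](card_ord n) -card_prod -(card_codom Finj); apply: eq_card => u.
    rewrite !inE negbK; apply/idP/codomP => [|[p ->]]; last first.
      by rewrite /inC /= !(unsplitK (inl _ _)).
    rewrite /inC; case Eu : (sval u) => [a b] /=.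
    case: (split_ordP a) Eu => a' -> //; case: (split_ordP b) => b' -> // Eu _.
    by exists (a', b'); apply: val_inj.
  have : (#|A| + #|[predC A]| = #|gc_var hm|)%N by exact: cardC.
  have -> : #|gc_var hm| = ((n + 2) * (n + 2)).-1.
    rewrite card_sig -[in RHS](card_ord (n + 2)) -card_prod -(cardC1 (ord_last hm, ord_last hm)).
    by apply: eq_card => x; rewrite !inE.
  have := hm; rewrite cB; nia.
rewrite -cA; exists (fun i => pvar k (enum_val i : gc_var hm)); split.
- by move=> i; rewrite /pvar dhomogX; apply/eqP; exact: mdeg1.
- move=> a H i; have := congr1 (mcoeff U_(enum_rank (enum_val i))) H.
  rewrite mcoeff0 raddf_sum /= (bigD1 i) //= mcoeffZ mcoeffX eqxx mulr1 big1 ?addr0 // => j ji.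
  rewrite mcoeffZ mcoeffX; case: eqP => [/mnmP E|]; last by rewrite mulr0.
  have := E (enum_rank (enum_val i)); rewrite !mnm1E eqxx.
  by case: eqP => // /enum_rank_inj/enum_val_inj E'; rewrite E' eqxx in ji.
have entryK i b : kappa (X i (rshift n b)) = 0 /\ kappa (X (rshift n b) i) = 0.
  rewrite !kappa_entry; case: (split_ordP i) => a ->.
    by rewrite block_mxEur block_mxEdl !mxE.
  by rewrite !block_mxEdr !mxE.
apply/seteqP; split; last first.
  apply: ideal_gen_sub => // _ [i _ <-] /=.
  have : A (enum_val i) by exact: (enum_valP i).
  have -> : pvar k (enum_val i) = X (sval (enum_val i)).1 (sval (enum_val i)).2 by rewrite EX; exact/esym/GC_pvar.
  rewrite /A /= /inC; case: (sval (enum_val i)) => a b /=.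
  case: (split_ordP a) => a' ->; case: (split_ordP b) => b' -> //= _.
  - by case: (entryK (lshift 2 a') b').
  - by case: (entryK (lshift 2 b') a').
  - by case: (entryK (rshift n a') b').
have genA (u : gc_var hm) : A u -> ideal_gen (range (fun i : 'I_#|A| => pvar k (enum_val i : gc_var hm))) (pvar k u).
  move=> Au; apply: sub_ideal_gen; exists (enum_rank_in Au u) => //.
  by rewrite enum_rankK_in.
have gen i j : ~~ (if split i is inl _ then (if split j is inl _ then true else false) else false) ->
    ideal_gen (range (fun i : 'I_#|A| => pvar k (enum_val i : gc_var hm))) (X i j).
  move=> nij; rewrite (entry_var EX).
  set u := insubd _ _; apply: genA; rewrite /A /= /inC.
  have : insubd (gc_var_penult hm) (i, j) = u by [].
  move=> /insubd_gc [<- /=|[_ ->]] //=.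
  by rewrite !(unsplitK (inr _ _)).
apply: (kappa_congr (is_ideal_gen _)) => i b; split; apply: gen; rewrite (unsplitK (inr _ _)) //.
by case: (split i).
Qed.
End Kappa.

Lemma corner_entry_neq0 : X (lshift 2 j0) (lshift 2 j0) != 0.
Proof. by rewrite (entry_var EX) mpolyX_neq0. Qed.

Lemma gradient_structure :
  [/\ ideal_exp P 2 `<=` J, forall Q, prime_ideal Q -> J `<=` Q -> P `<=` Q,
      forall Q, minimal_prime J Q <-> Q = P, forall Q, primary_component J P Q <-> Q = P &
      exists E, (forall Q, embedded_prime J Q <-> Q = E) /\ linear_ideal (4 * (n + 2) - 5) E]
  /\ ~ reduction J P.
Proof.
have [Y EY] : exists Y, Y = generic_mx k (n + 2) by eexists.
have pP : prime_ideal P := gn1_ideal_prime hk EX EY j0.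
have [kappa kX kC] := kappa_exists EX.
have [gamma [gX gC g1 gD gJ]] := curve_exists EX j0.
have gk x : (gamma x).[0] = kappa x.
  have : horner_eval 0 \o gamma =1 kappa; last by apply.
  by apply: (gc_unique EX) => [a|]; rewrite ?kX // kC; exact: gC.
have pE : prime_ideal [set x | kappa x = 0].
  by apply: prime_ker => u v /eqP; rewrite mulf_eq0 => /orP[] /eqP; [left|right].
have i3 : is_ideal [set x | ord_ge 3 (gamma x)].
  have io := @is_ideal_ord R 3; split; first by rewrite /= rmorph0; apply: ideal0.
    by move=> x y; rewrite /= rmorphD; apply: idealD.
  by move=> x y; rewrite /= rmorphM; apply: idealMl.
have ED x : kappa x = 0 -> J (x * D).
  move: x; apply: (kappa_congr kX kC (I := [set x | J (x * D)])) => [|i b].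
    split; first by rewrite /= mul0r; exact: (ideal0 iJ).
      by move=> x y Hx Hy; rewrite /= mulrDl; exact: (idealD iJ Hx Hy).
    by move=> a x Hx; rewrite /= -mulrA; exact: (idealMl a iJ Hx).
  exact: gradient_entry.
have X0 : 'X != 0 :> {poly R} by rewrite polyX_eq0.
have c0 := corner_neq0 EX.
have EnP : exists2 e, kappa e = 0 & ~ P e.
  exists (X (lshift 2 j0) pp); first by rewrite (kappa_entry kX) block_mxEur mxE.
  move=> /gn1_mod_gradient [b /gJ /= [q]]; rewrite rmorphB rmorphM gD g1 => E.
  have /(mulfI X0) /(congr1 (horner_eval 0)) : 'X * (X (lshift 2 j0) (lshift 2 j0))%:P =
      'X * ('X * ('X * q + gamma b * c%:P)).
    by apply: (subIr (gamma b * (c%:P * 'X^2))); rewrite E; ring.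
  rewrite /horner_eval hornerC hornerM hornerX mul0r => /eqP.
  by rewrite (negPf corner_entry_neq0).
have D3 b : ord_ge 3 (gamma (b * D)) -> kappa b = 0.
  move=> [q]; rewrite rmorphM gD => E.
  have X20 : 'X^2 != 0 :> {poly R} by rewrite expf_neq0.
  have /(mulfI X20) /(congr1 (horner_eval 0)) : 'X^2 * (gamma b * c%:P) = 'X^2 * ('X * q).
    by rewrite mulrA -exprSr -E; ring.
  rewrite /horner_eval !hornerM hornerC hornerX mul0r gk => /eqP.
  by rewrite mulf_eq0 (negPf c0) orbF => /eqP.
have primary3 x y : ord_ge 3 (gamma (x * y)) -> ~ kappa y = 0 -> ord_ge 3 (gamma x).
  by rewrite rmorphM => H /eqP; rewrite -gk => /ord_ge_cancel; apply.
have E3 x : kappa x = 0 -> exists d, ord_ge 3 (gamma (x ^+ d)).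
  rewrite -gk => /ord_ge1 H; exists 3; rewrite rmorphXn.
  have H2 := ord_geM H H; have H3 := ord_geM H H2; rewrite !exprS expr0 mulr1; exact: H3.
have I3E : [set x | ord_ge 3 (gamma x)] `<=` [set x | kappa x = 0].
  by move=> x [q E]; rewrite /= -gk E exprS !hornerM hornerX !mul0r.
have PE : P `<=` [set x | kappa x = 0] by move=> x; exact: (kappa_gn1 kX).
have PD : P D := gn1_ideal_adj X ll ll.
have PJD := gn1_mod_gradient.
have JP := gradient_sub_gn1.
pose E := [set x | kappa x = 0]; pose I3 := [set x | ord_ge 3 (gamma x)].
split; first split.
- move=> x Hx; exact: (@double_exp R J P E D iJ pP PJD ED PE x Hx).
- move=> Q pQ JQ x Px; exact: (@double_prime_sub R J P E D iJ PJD ED PE Q pQ JQ x Px).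
- move=> Q; exact: (@double_minimal R J P E D iJ pP JP PJD ED PE Q).
- move=> Q; exact: (@double_component R J P E I3 D iJ pP pE i3 JP PD PJD ED EnP gJ D3 primary3 E3 I3E Q).
- exists E; split; last exact: linear_ideal_kappa.
  move=> Q; exact: (@double_embedded R J P E I3 D iJ pP pE JP PJD ED PE EnP gJ D3 Q).
(* All of [P] has order at least 2 along the curve, so [J] times the power [d] of [P] has order at
   least [2 * d + 3], whereas [D ^+ d.+1] has order exactly [2 * d + 2]. *)
move=> [_ [d Ed]].
have P2 x : P x -> ord_ge 2 (gamma x).
  move=> /PJD [b /gJ /= [q Eq]]; exists ('X * q + gamma b * c%:P).
  have -> : gamma x = gamma (x - b * D) + gamma b * gamma D by rewrite rmorphB rmorphM subrK.
  by rewrite Eq gD; ring.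
have ordi a : is_ideal [set x | ord_ge a (gamma x)].
  have io := @is_ideal_ord R a; split; first by rewrite /= rmorph0; apply: ideal0.
    by move=> x y; rewrite /= rmorphD; apply: idealD.
  by move=> x y; rewrite /= rmorphM; apply: idealMl.
have Pexp a : ideal_exp P a `<=` [set x | ord_ge (2 * a) (gamma x)].
  elim: a => [|a IH]; first by move=> x _; exists (gamma x); rewrite mul1r.
  apply: ideal_gen_sub; first exact: ordi.
  move=> _ [x Px [y Py <-]]; rewrite /= rmorphM mulnS.
  by apply: ord_geM; [exact: P2|exact: IH].
have Dexp a : ideal_exp P a (D ^+ a).
  elim: a => [//|a IH]; rewrite exprS; apply: sub_ideal_gen.
  by exists D => //; exists (D ^+ a).
have : ord_ge (2 * d + 3) (gamma (D ^+ d.+1)).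
  have := Dexp d.+1; rewrite Ed; move: (D ^+ d.+1).
  apply: (ideal_gen_sub (ordi (2 * d + 3)%N)) => _ [x Jx [y Py <-]].
  rewrite /= rmorphM [(2 * d + 3)%N]addnC; apply: ord_geM; [exact: gJ|exact: Pexp].
rewrite rmorphXn gD exprMn -exprM => -[q Eq].
have e23 : (2 * d + 3 = 2 * d.+1 + 1)%N by lia.
have Xn0 : 'X^(2 * d.+1) != 0 :> {poly R} by rewrite expf_neq0.
have /(mulfI Xn0) /(congr1 (horner_eval 0)) :
    'X^(2 * d.+1) * c%:P ^+ d.+1 = 'X^(2 * d.+1) * ('X * q).
  by rewrite mulrC Eq e23 exprD expr1 mulrA.
rewrite /horner_eval hornerM hornerX mul0r horner_exp hornerC => /eqP.
by rewrite expf_eq0 (negPf c0) andbF.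
Qed.
End GradientStructure.

(** * Regularity of the generic determinant modulo the image equation *)

Section CyclicPencil.
Variables (W : comNzRingType) (z0 z1 : W) (p : nat).
Hypothesis p0 : (0 < p)%N.

(* The pencil [z1 + z0 N], with [N] the cyclic permutation of all indices but the last. *)
Definition cyc (i j : nat) := ((i == j.+1) && (i <= p)%N) || ((i == 0%N) && (j == p)).
Definition pencil d : 'M[W]_d := \matrix_(i, j) (z1 *+ (i == j) + z0 *+ cyc i j).

(** Only the identity and the full cycle contribute. *)
Lemma det_pencil : \det (pencil p.+1) = z1 ^+ p.+1 + (-1) ^+ p * z0 ^+ p.+1.
Proof.
rewrite (expand_det_col _ ord_max) (bigD1 ord_max) //= (bigD1 ord0) /=; last first.
  by apply/eqP => /(congr1 val) /= E; move: p0; rewrite -E.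
rewrite big1 ?addr0 => [|i /andP[i1 i2]]; last first.
  rewrite mxE (negPf i1) mulr0n add0r; have -> : cyc i (ord_max : 'I_p.+1) = false.
    rewrite /cyc /= eqxx andbT; have := ltn_ord i; rewrite ltnS => ip.
    by rewrite [i == _ :> nat]ltn_eqF ?ltnS //= -[0%N]/(val (ord0 : 'I_p.+1)) val_eqE (negPf i2).
  by rewrite mulr0n mul0r.
have -> : pencil p.+1 ord_max ord_max = z1.
  by rewrite mxE eqxx /cyc /= ltn_eqF // (gtn_eqF p0) mulr0n addr0.
have -> : pencil p.+1 ord0 ord_max = z0.
  by rewrite mxE /cyc /= eqxx; have -> : (ord0 == ord_max :> 'I_p.+1) = false;
    [apply/eqP => /(congr1 val) /= E; move: p0; rewrite -E|rewrite add0r].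
rewrite /cofactor /= addnn -mul2n exprM sqrrN expr1n expr1n mul1r add0n.
have -> : \det (row' ord_max (col' ord_max (pencil p.+1))) = z1 ^+ p.
  rewrite det_trig; last first.
    apply/is_trig_mxP => i j ij; rewrite !mxE /cyc !lift_max (inj_eq (@lift_inj _ _)) -val_eqE /=.
    rewrite (ltn_eqF ij) (ltn_eqF (leqW ij)) [j == p :> nat]ltn_eqF // andbF orbF /=.
    by rewrite !mulr0n addr0.
  rewrite (eq_bigr (fun _ => z1)) ?prodr_const ?card_ord // => i _.
  by rewrite !mxE /cyc !lift_max eqxx ltn_eqF // [i == p :> nat]ltn_eqF // andbF !mulr0n addr0.
have lE (i j : 'I_p) : (lift ord0 i == lift ord_max j :> 'I_p.+1) = (i.+1 == j :> nat).
  by rewrite -val_eqE /= /bump; have := ltn_ord j; lia.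
have -> : \det (row' ord0 (col' ord_max (pencil p.+1))) = z0 ^+ p.
  rewrite -det_tr det_trig; last first.
    apply/is_trig_mxP => i j ij; rewrite !mxE lE /cyc !lift_max lift0.
    have -> : (j.+1 == i :> nat) = false by lia.
    have -> : (j.+1 == i.+1 :> nat) = false by lia.
    by rewrite /= !mulr0n addr0.
  rewrite (eq_bigr (fun _ => z0)) ?prodr_const ?card_ord // => i _.
  rewrite !mxE lE /cyc !lift_max lift0 eqxx ltn_ord /=.
  have -> : (i.+1 == i :> nat) = false by lia.
  by rewrite mulr0n add0r.
by rewrite !exprS; ring.
Qed.

Let pp : 'I_p.+2 := inord p.
Let ll : 'I_p.+2 := ord_max.

Lemma cofactor_pencil_last : cofactor (pencil p.+2) ll ll = \det (pencil p.+1).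
Proof.
rewrite /cofactor addnn -mul2n exprM sqrrN expr1n expr1n mul1r; congr (\det _).
by apply/matrixP => i j; rewrite !mxE !lift_max (inj_eq (@lift_inj _ _)).
Qed.

(** Removing an index of the cycle leaves a triangular matrix. *)
Lemma cofactor_pencil_penult : cofactor (pencil p.+2) pp pp = z1 ^+ p.+1.
Proof.
rewrite /cofactor addnn -mul2n exprM sqrrN expr1n expr1n mul1r.
have vp : pp = p :> nat by rewrite inordK.
have vl (i : 'I_p.+1) : lift pp i = (if (p <= i)%N then i.+1 else i) :> nat.
  by rewrite /= /bump vp; case: leqP.
rewrite det_trig; last first.
  apply/is_trig_mxP => i j ij; rewrite !mxE (inj_eq (@lift_inj _ _)) -val_eqE /= (ltn_eqF ij) mulr0n add0r.
  have -> : cyc (lift pp i) (lift pp j) = false; last by rewrite mulr0n.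
  have jp := ltn_ord j; rewrite /cyc !vl; move: (nat_of_ord i) (nat_of_ord j) ij jp p0 => a b.
  by case: (leqP p a); case: (leqP p b); clear; simpl; lia.
rewrite (eq_bigr (fun _ => z1)) ?prodr_const ?card_ord // => i _.
rewrite !mxE eqxx; have -> : cyc (lift pp i) (lift pp i) = false.
  have ip := ltn_ord i; rewrite /cyc !vl; move: (nat_of_ord i) ip p0 => a.
  by case: (leqP p a); clear; simpl; lia.
by rewrite mulr0n addr0.
Qed.

Lemma det_pencil_last : \det (pencil p.+2) = z1 * \det (pencil p.+1).
Proof.
rewrite (expand_det_row _ ll) (bigD1 ll) //= big1 ?addr0 => [|j jl].
  rewrite cofactor_pencil_last mxE eqxx; have -> : cyc ll ll = false by rewrite /cyc /=; lia.
  by rewrite mulr0n addr0.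
rewrite mxE eq_sym (negPf jl); have -> : cyc ll j = false by rewrite /cyc /=; lia.
by rewrite !mulr0n addr0 mul0r.
Qed.
End CyclicPencil.

Section DetNzd.
Variables (k : fieldType) (p : nat).
Hypothesis p0 : (0 < p)%N.
Local Notation S := {mpoly k[#|{: 'I_p.+2 * 'I_p.+2}|]}.
Local Notation Y := (generic_mx k p.+2).
Local Notation W := {mpoly S[2]}.

Definition hdiff (T : comNzRingType) (A : 'M[T]_p.+2) : T :=
  cofactor A ord_max ord_max - cofactor A (inord p) (inord p).

Lemma hdiff_map (T T' : comNzRingType) (f : {rmorphism T -> T'}) (A : 'M[T]_p.+2) :
  f (hdiff A) = hdiff (map_mx f A).
Proof. by rewrite /hdiff rmorphB -!cofactor_map_mx. Qed.

(** The generic matrix is translated by the pencil. Deleting the last index keeps the cycle and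
    deleting the one before breaks it, so in [hdiff] the powers of [z1] cancel and the leading form
    is [z0 ^+ p.+1] up to sign. Modulo that, the leading form of the determinant is [z1 ^+ p.+2]. *)
Lemma generic_det_nzd x y : \det Y * x = hdiff Y * y -> exists z, x = hdiff Y * z.
Proof.
have [Yo EY] : exists Yo, Yo = Y by eexists.
rewrite -EY.
pose z0 : W := 'X_ord0; pose z1 : W := 'X_ord_max.
have [B EB] : exists B, B = pencil z0 z1 p p.+2 by eexists.
have [Y' EY'] : exists Y' : 'M[W]_p.+2, Y' = map_mx (@mpolyC 2 S) Yo + B by eexists.
have [f [fY fC]] : exists f : {rmorphism S -> W}, map_mx f Yo = Y' /\ forall a, f a%:MP = a%:MP%:MP.
  exists (gen_eval (@mpolyC 2 S \o @mpolyC _ k) Y'); split; first by rewrite EY gen_eval_generic.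
  by move=> a; exact: gen_evalC.
have [g [gC gX]] : exists g : {rmorphism W -> S}, (forall s, g s%:MP = s) /\ forall i, g 'X_i = 0.
  exists (meval (fun _ : 'I_2 => 0)); split=> [s|i] /=; [exact: mevalC|exact: mevalXU].
have gf : g \o f =1 idfun.
  apply: gen_eval_unique => [a|] /=; first by rewrite fC gC.
  have gpen : map_mx g (pencil z0 z1 p p.+2) = 0.
    by apply/matrixP => i j; rewrite !mxE rmorphD !rmorphMn !gX !mul0rn addr0.
  have gc : map_mx g (map_mx (@mpolyC 2 S) Yo) = Yo.
    by apply/matrixP => i j; rewrite !mxE gC.
  by rewrite -EY map_mx_comp fY EY' map_mxD EB gpen gc addr0 map_mx_id.
have hX (i : 'I_2) : ('X_i : W) \is 1.-homog by rewrite dhomogX; apply/eqP; exact: mdeg1.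
have hpen i j : B i j \is 1.-homog.
  by rewrite EB mxE; apply: rpredD; apply: rpredMn; exact: hX.
have hC (s : S) : (s%:MP : W) \is 0.-homog by rewrite -[s%:MP]mulr1 mul_mpolyC rpredZ // dhomog1.
have dY i j : dlt 2 (Y' i j).
  rewrite EY' mxE; apply: dltD; last exact: dlt_homog.
  by rewrite mxE; apply: (dlt_leq (leqnSn 1)); apply: dlt_homog.
have cY i j : comp 1 (Y' i j) = B i j.
  rewrite EY' mxE compD (homog_comp (hpen i j)) mxE (dlt_comp (dlt_homog (hC _))) // add0r //.
have [ddet cdet] := top_det dY cY.
have dcof a : dlt p.+2 (cofactor Y' a a) /\ comp p.+1 (cofactor Y' a a) = cofactor B a a.
  by rewrite -(adjE Y') -(adjE B); exact: (top_adj dY cY a a).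
have [dl cl] := dcof ord_max; have [dp cp] := dcof (inord p).
have cB (u v u' v' : W) : comp p.+1 u = u' -> comp p.+1 v = v' -> comp p.+1 (u - v) = u' - v'.
  by move=> <- <-; exact: compB.
have top_h : dlt p.+2 ((-1) ^+ p * hdiff Y') /\ comp p.+1 ((-1) ^+ p * hdiff Y') = z0 ^+ p.+1.
  have [|e1 e2] := @top_sgn 2 S p p.+1 (hdiff Y') ((-1) ^+ p * z0 ^+ p.+1) (dltB dl dp).
    apply: (etrans (cB _ _ _ _ cl cp)); rewrite EB cofactor_pencil_last cofactor_pencil_penult // det_pencil //.
    by rewrite addrAC subrr add0r.
  split=> //; rewrite e2 mulrA -exprD addnn -mul2n exprM sqrrN expr1n expr1n mul1r //.
set hs := (-1) ^+ p * hdiff Y' in top_h; case: top_h => dh ch.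
have i0 : is_ideal [set (0 : W)] := is_ideal0 _.
have reg0 : nzd_mod [set (0 : W)] (z0 ^+ p.+1).
  by rewrite -(mon_ideal_nil 2 S); apply: mon_reg.
have init := initial_step i0 i0 (initial0 2 S) dh ch reg0.
have EJ : adjoin [set (0 : W)] (z0 ^+ p.+1) = mon_ideal [:: (ord0, p.+1)].
  by rewrite -(mon_ideal_nil 2 S) mon_adjoin.
have iJ : is_ideal (adjoin [set (0 : W)] (z0 ^+ p.+1)) by apply: is_ideal_adjoin.
have regdet : nzd_mod (adjoin [set (0 : W)] (z0 ^+ p.+1)) (\det B).
  move=> w; rewrite EB det_pencil_last // det_pencil // => Hw.
  have reg1 : nzd_mod (mon_ideal [:: (ord0 : 'I_2, p.+1)]) ((z1 : W) ^+ p.+2) by apply: mon_reg.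
  rewrite EJ in Hw iJ *; apply: reg1.
  have Hz : mon_ideal [:: (ord0 : 'I_2, p.+1)] (z0 ^+ p.+1 * (z1 * (-1) ^+ p * w)).
    apply: (idealMr _ iJ); rewrite -EJ; exact: mem_adjoin.
  have := idealB iJ Hw Hz.
  have -> // : z1 * (z1 ^+ p.+1 + (-1) ^+ p * z0 ^+ p.+1) * w - z0 ^+ p.+1 * (z1 * (-1) ^+ p * w) = z1 ^+ p.+2 * w.
  have E1 (a b d w' : W) : a * (a ^+ p.+1 + d * b) * w' - b * (a * d * w') = a ^+ p.+2 * w'.
    by rewrite [a ^+ p.+2]exprS; ring.
  exact: E1.
have reg := initial_reg (is_ideal_adjoin hs i0) init ddet cdet regdet.
move=> E; have Hw : adjoin [set 0] hs (\det Y' * f x).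
  exists ((-1) ^+ p * f y); rewrite /hs -fY -hdiff_map det_map_mx -!rmorphM E rmorphM.
  rewrite mulrACA -exprD addnn -mul2n exprM sqrrN expr1n expr1n mul1r subrr //.
have [w /= /eqP] := reg _ Hw; rewrite subr_eq0 => /eqP Ew.
exists (g ((-1) ^+ p * w)); have := congr1 g Ew.
have -> : g (f x) = x := gf x.
have gfY : map_mx g Y' = Yo.
  by apply/matrixP => i j; rewrite -fY !mxE; exact: gf.
move=> ->; rewrite /hs !rmorphM hdiff_map gfY rmorphXn rmorphN rmorph1.
by rewrite mulrCA mulrA.
Qed.
End DetNzd.

(** * The polar map, its image and its inverse *)

Lemma psubst_eval (k : fieldType) (I T : finType) (F : T -> {mpoly k[#|I|]}) :
  exists g : {rmorphism {mpoly k[#|T|]} -> {mpoly k[#|I|]}},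
    [/\ psubst F =1 g, forall a, g a%:MP = a%:MP & forall t, g (pvar k t) = F t].
Proof.
have [g [gC gX]] := @mpoly_eval k #|T| {mpoly k[#|I|]} (@mpolyC _ k) (fun a => F (enum_val a)).
exists g; split=> [|a|t]; [|exact: gC|by rewrite /pvar gX enum_rankK].
apply: (mmap_unique (f := comp_mpoly [tuple F (enum_val t) | t < #|T|])) => [a|i] /=.
  by rewrite comp_mpolyC gC.
by rewrite comp_mpolyXU gX -tnth_nth tnth_mktuple.
Qed.

Section Homogeneous.
Variables (k : fieldType) (n p : nat) (g : {rmorphism {mpoly k[n]} -> {mpoly k[p]}}).
Hypothesis gC : forall a, g a%:MP = a%:MP.

Lemma eval_homog d e x : (forall i, g 'X_i \is d.-homog) -> x \is e.-homog ->
  g x \is (d * e).-homog.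
Proof.
move=> gX /dhomogP hx; rewrite [x]mpolyE rmorph_sum big_seq; apply: rpred_sum => m /hx em.
have {}em : (\sum_i m i)%N = e by rewrite -mdegE; exact: em.
rewrite -mul_mpolyC rmorphM gC mul_mpolyC -em; apply: rpredZ.
rewrite mpolyXE_id rmorph_prod.
elim: (index_enum _) => [|i r IH]; first by rewrite !big_nil muln0 dhomog1.
rewrite !big_cons mulnDr; apply: dhomogM => //.
by rewrite rmorphXn; apply: dhomogMn.
Qed.
End Homogeneous.

Lemma eval_scale (k : fieldType) n (g : {rmorphism {mpoly k[n]} -> {mpoly k[n]}}) s e x :
  (forall a, g a%:MP = a%:MP) -> (forall i, g 'X_i = s * 'X_i) -> x \is e.-homog ->
  g x = s ^+ e * x.
Proof.
move=> gC gX /dhomogP hx; rewrite [in RHS](mpolyE x) {1}[x]mpolyE rmorph_sum mulr_sumr.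
rewrite big_seq [RHS]big_seq; apply: eq_bigr => m /hx em.
have {}em : (\sum_i m i)%N = e by rewrite -mdegE; exact: em.
rewrite -!mul_mpolyC rmorphM gC mulrCA -em; congr (_ * _).
rewrite mpolyXE_id rmorph_prod.
elim: (index_enum _) => [|i r IH]; first by rewrite !big_nil mulr1.
by rewrite !big_cons rmorphXn gX exprMn exprD IH mulrACA.
Qed.

Lemma adj_adj (T : idomainType) p (A : 'M[T]_p.+2) : \det A != 0 ->
  \adj (\adj A) = \det A ^+ p *: A.
Proof.
move=> d0; have dadj : \det (\adj A) = \det A ^+ p.+1.
  apply: (mulfI d0); rewrite -det_mulmx mul_mx_adj det_scalar exprS //.
apply: adj_unique; first by rewrite dadj expf_neq0.
by rewrite -scalemxAr mul_adj_mx dadj scale_scalar_mx -exprSr.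
Qed.

Lemma ideal_adj_congr (T : comNzRingType) (I : set T) p (A B : 'M[T]_p) : is_ideal I ->
  (forall i j, I (A i j - B i j)) -> forall i j, I ((\adj A) i j - (\adj B) i j).
Proof.
move=> iI H i j; rewrite !adjE /cofactor -mulrBr; apply: idealMl => //.
by apply: ideal_det_congr => // a b; rewrite !mxE.
Qed.

Lemma span_mod_reindex (k : fieldType) n (H : set {mpoly k[n]}) (I : finType)
    (F G : I -> {mpoly k[n]}) (s : I -> I) : involutive s -> (forall u, F u = G (s u)) ->
  span_mod H F `<=` span_mod H G.
Proof.
move=> sK E x [a Ha]; exists (a \o s).
rewrite (reindex_inj (inv_inj sK)); move: Ha; congr (H (_ - _)).
by apply: eq_bigr => u _; rewrite /= sK E.
Qed.

Section Polar.
Variables (k : fieldType) (p : nat) (hm : (3 <= p.+2)%N).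
Local Notation R := {mpoly k[#|gc_var hm|]}.
Local Notation S := {mpoly k[#|{: 'I_p.+2 * 'I_p.+2}|]}.
Local Notation pp := (ord_penult hm).
Local Notation ll := (ord_last hm).
Variables (X : 'M[R]_p.+2) (Y : 'M[S]_p.+2).
Hypotheses (EX : X = GC k hm) (EY : Y = generic_mx k p.+2).
Local Notation f := (\det X).
Variable h : S.
Hypothesis Eh : h = cofactor Y ll ll - cofactor Y pp pp.

Let p0 : (0 < p)%N. Proof. by have := hm; rewrite !ltnS. Qed.
Lemma hdiffE (T : comNzRingType) (A : 'M[T]_p.+2) : hdiff A = cofactor A ll ll - cofactor A pp pp.
Proof.
rewrite /hdiff; have -> : ll = ord_max by apply: val_inj.
by have -> : pp = inord p by apply: val_inj; rewrite /= inordK.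
Qed.

Lemma X_var u : X (val u).1 (val u).2 = pvar k u. Proof. by rewrite EX GC_pvar. Qed.
Lemma Y_var i j : Y i j = pvar k (i, j). Proof. by rewrite EY mxE. Qed.
Lemma X_entry i j : exists u, X i j = pvar k u.
Proof. by exists (insubd (gc_var_penult hm) (i, j)); rewrite EX mxE. Qed.

Lemma gc_det_neq0 : f != 0.
Proof.
have [g gX] : exists g : {rmorphism R -> k}, map_mx g X = 1%:M.
  by exists (gc_eval (hm := hm) idfun 1%:M); rewrite EX gc_eval_GC // !mxE !eqxx.
apply/eqP => /(congr1 g) /eqP; rewrite -det_map_mx gX det1 rmorph0 oner_eq0 //.
Qed.

Lemma linear_det_homog (N : nat) (Z : 'M[{mpoly k[N]}]_p.+2) : (forall i j, Z i j \is 1.-homog) ->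
  forall i j, (\adj Z) i j \is p.+1.-homog.
Proof.
move=> hZ i j; have [||_ <-] := @top_adj N k p.+1 Z Z _ _ i j.
- by move=> a b; apply: dlt_homog.
- by move=> a b; apply: homog_comp.
- exact: comp_homog.
Qed.

Lemma X_homog i j : X i j \is 1.-homog.
Proof. by have [u ->] := X_entry i j; rewrite /pvar dhomogX; apply/eqP; exact: mdeg1. Qed.
Lemma Y_homog i j : Y i j \is 1.-homog.
Proof. by rewrite Y_var /pvar dhomogX; apply/eqP; exact: mdeg1. Qed.

Lemma h_homog : h \is p.+1.-homog.
Proof.
have H i : cofactor Y i i \is p.+1.-homog by rewrite -adjE; exact: (linear_det_homog Y_homog).
by rewrite Eh; apply: rpredB; exact: H.
Qed.

Lemma h_neq0 : h != 0.
Proof.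
have [g gY] : exists g : {rmorphism S -> k}, map_mx g Y = pencil 1 0 p p.+2.
  by exists (gen_eval idfun (pencil 1 0 p p.+2)); rewrite EY gen_eval_generic.
have e : g h = (-1) ^+ p.
  rewrite Eh -hdiffE hdiff_map gY /hdiff cofactor_pencil_last cofactor_pencil_penult // det_pencil //.
  by rewrite expr0n expr1n mulr1 /= subr0 add0r.
by apply/eqP => /(congr1 g) /eqP; rewrite e rmorph0 signr_eq0.
Qed.

Variable ev : {rmorphism S -> R}.
Hypotheses (evY : map_mx ev Y = \adj X) (evC : forall a, ev a%:MP = a%:MP).

Lemma ev_adj i j : ev ((\adj Y) i j) = f ^+ p * X i j.
Proof.
have -> : ev ((\adj Y) i j) = (map_mx ev (\adj Y)) i j by rewrite [RHS]mxE.
by rewrite map_mx_adj evY (adj_adj gc_det_neq0) mxE.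
Qed.

Lemma ev_h : ev h = 0.
Proof.
have Xd : X pp pp = X ll ll by rewrite EX; exact: GC_diag.
by rewrite Eh -!adjE rmorphB !ev_adj Xd subrr.
Qed.

Let hI : set S := [set x | exists y, x = h * y].
Let ihI : is_ideal hI.
Proof.
split; first by exists 0; rewrite mulr0.
  by move=> _ _ [s ->] [t ->]; exists (s + t); rewrite mulrDr.
by move=> a _ [s ->]; exists (a * s); rewrite mulrCA.
Qed.

(** The substitution inverse to [ev] modulo [h]. The two last diagonal entries of [\adj Y] differ by
    [h] up to sign, so one replaces the other before [GC] is evaluated. *)
Lemma adj_map_mod : exists2 b : {rmorphism R -> S}, (forall a, b a%:MP = a%:MP) &
  forall i j, hI (b (X i j) - (\adj Y) i j).
Proof.
have [A HA] : exists A, A = \adj Y by eexists.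
pose A' := \matrix_(i, j) if (i == ll) && (j == ll) then A pp pp else A i j.
have dA : A' pp pp = A' ll ll.
  by rewrite !mxE !eqxx /= (negPf (penult_neq_last hm)).
have [b [bC bA]] : exists b : {rmorphism R -> S}, (forall a, b a%:MP = a%:MP) /\ map_mx b X = A'.
  exists (gc_eval (hm := hm) (@mpolyC _ k) A'); split=> [a|]; first exact: gc_evalC.
  by rewrite EX gc_eval_GC.
exists b => // i j; have -> : b (X i j) = A' i j by rewrite -bA [RHS]mxE.
rewrite -HA mxE; case: ifP => [/andP[/eqP-> /eqP->]|_]; last by rewrite subrr; exact: (ideal0 ihI).
exists (-1); rewrite mulrN1 Eh -!adjE -HA opprB //.
Qed.

(** Going to [R] and back multiplies a form of degree [e] by [\det Y ^+ (p * e)] modulo [h], by the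
    formula for the double adjugate; the determinant is then cancelled. *)
Lemma ker_ev x : ev x = 0 -> hI x.
Proof.
have [b bC bX] := adj_map_mod.
have [sc [scC scX]] := @mpoly_eval k _ S (@mpolyC _ k) (fun a => \det Y ^+ p * 'X_a).
have scY i j : sc (Y i j) = \det Y ^+ p * Y i j by rewrite Y_var /pvar scX.
have dY0 : \det Y != 0.
  apply/eqP => dY; have := det_map_mx ev Y; rewrite evY dY rmorph0 => d0.
  have := gc_det_neq0; have := det_mulmx X (\adj X); rewrite d0 mulr0 mul_mx_adj det_scalar.
  by move=> /eqP; rewrite expf_eq0 /= => ->.
have adjXY i j : hI (b ((\adj X) i j) - \det Y ^+ p * Y i j).
  have -> : \det Y ^+ p * Y i j = (\adj (\adj Y)) i j by rewrite (adj_adj dY0) [RHS]mxE.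
  have -> : b ((\adj X) i j) = (\adj (map_mx b X)) i j by rewrite -map_mx_adj [RHS]mxE.
  have [A HA] : exists A, A = \adj Y by eexists.
  have [Z HZ] : exists Z, Z = map_mx b X by eexists.
  rewrite -HA -HZ; apply: (ideal_adj_congr ihI) => s t.
  by rewrite HZ HA [map_mx b X _ _]mxE; exact: bX.
have cong s : hI (b (ev s) - sc s).
  have [g Eg] : exists g : {rmorphism S -> S}, forall s, g s = b (ev s) by exists (b \o ev).
  rewrite -Eg; move: s; apply: (hom_congr ihI) => [a|a]; first by rewrite Eg evC bC scC.
  have -> : 'X_a = Y (enum_val a).1 (enum_val a).2.
    by rewrite Y_var /pvar -surjective_pairing enum_valK.
  rewrite Eg scY; have -> : ev (Y (enum_val a).1 (enum_val a).2) = (\adj X) (enum_val a).1 (enum_val a).2.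
    by rewrite -evY [RHS]mxE.
  exact: adjXY.
have homX a : ev 'X_a \is p.+1.-homog.
  have -> : 'X_a = Y (enum_val a).1 (enum_val a).2.
    by rewrite Y_var /pvar -surjective_pairing enum_valK.
  have -> : ev (Y (enum_val a).1 (enum_val a).2) = (\adj X) (enum_val a).1 (enum_val a).2.
    by rewrite -evY [RHS]mxE.
  exact: (linear_det_homog X_homog).
have dnzd s N : hI (\det Y ^+ N * s) -> hI s.
  elim: N => [|N IH]; first by rewrite mul1r.
  move=> [y]; rewrite exprS -mulrA Eh -hdiffE EY => /(generic_det_nzd p0) [z Ez].
  by apply: IH; exists z; rewrite Eh -hdiffE EY -Ez.
have kerh e s : s \is e.-homog -> ev s = 0 -> hI s.
  move=> hs es; have := cong s; rewrite es rmorph0 sub0r (eval_scale scC scX hs) -exprM.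
  by move=> /(idealN ihI); rewrite opprK => /dnzd.
move=> ex.
(* [ev] multiplies degrees by [p.+1], so the images of different homogeneous components have
   different degrees and vanish separately. *)
have [M xE] : exists M, x = \sum_(e < M) comp e x.
  by exists (msize x); exact: (pihomog_partitionE (leqnn _)).
rewrite xE; apply: (ideal_sum _ ihI) => e _; apply: (kerh e); first exact: comp_homog.
have hom e' : ev (comp e' x) \is (p.+1 * e').-homog.
  by apply: (eval_homog evC) => //; exact: comp_homog.
have H : \sum_(e' < M) comp (p.+1 * e) (ev (comp e' x)) = 0.
  rewrite -(big_morph (comp (p.+1 * e)) (compD _) (comp0 _ _ _)).
  have <- : ev x = \sum_(e' < M) ev (comp e' x) by rewrite {1}xE rmorph_sum.
  by rewrite ex comp0.
rewrite (bigD1 e) //= (homog_comp (hom e)) big1 ?addr0 in H => // e' ne.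
by apply: pihomog_ne0 (hom e'); rewrite eqn_pmul2l.
Qed.

Lemma ker_ev_gen : [set x | ev x = 0] = ideal_gen [set h].
Proof.
apply/seteqP; split=> [x /ker_ev [y ->]|].
  by rewrite mulrC; apply: (idealMl _ (is_ideal_gen _)); exact: sub_ideal_gen.
apply: ideal_gen_sub => [|_ ->]; last exact: ev_h.
split; first exact: rmorph0.
  by move=> x y /= Hx Hy; rewrite rmorphD Hx Hy addr0.
by move=> a x /= Hx; rewrite rmorphM Hx mulr0.
Qed.

(** Taken from the adjugate, hence transposed against the cofactors of the statement, since it is
    the double adjugate that is proportional to [X]. Transposition permutes the index set and leaves
    the span unchanged. *)
Definition polar_inv (u : gc_var hm) : S := (\adj Y) (val u).1 (val u).2.

Lemma polar_inv_span (H : set S) :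
  span_mod H polar_inv = span_mod H (fun u : gc_var hm => cofactor Y (val u).1 (val u).2).
Proof.
have sw_sub (u : gc_var hm) : ((val u).2, (val u).1) != (ll, ll).
  by have := valP u; case: (val u) => a b; rewrite !xpair_eqE andbC.
pose sw u : gc_var hm := Sub ((val u).2, (val u).1) (sw_sub u).
have swK : involutive sw by move=> u; apply: val_inj => /=; case: (val u).
apply/seteqP; split; apply: (span_mod_reindex swK) => u; rewrite /polar_inv adjE //=.
Qed.
End Polar.

(** * Assembly of the five statements *)

(** The determinant, which [gn1] adds to the minors, is a combination of them by expansion along a
    row. *)
Lemma minors_gn1 (R : comNzRingType) m (A : 'M[R]_m) : (0 < m)%N ->
  minors_ideal m.-1 A = gn1_ideal A.
Proof.
case: m A => // p A _ /=; have iM : is_ideal (minors_ideal p A) by exact: is_ideal_gen.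
have iG := is_ideal_gn1 A.
have adjM i j : minors_ideal p A ((\adj A) i j).
  rewrite adjE /cofactor; apply: (idealMl _ iM); apply: sub_ideal_gen.
  have lift_homo (h : 'I_p.+1) : {homo lift h : a b / (a < b)%N}.
    by move=> a b; rewrite /= /bump; lia.
  exists (lift j), (lift i); split; [exact: lift_homo|exact: lift_homo|].
  by congr (\det _); apply/matrixP => a b; rewrite !mxE.
apply/seteqP; split.
  apply: ideal_gen_sub => // _ [f [g [_ _ ->]]].
  by apply: (ideal_minor _ _ iG); exact: gn1_ideal_adj.
apply: gn1_ideal_sub => //; rewrite (expand_det_row _ ord0).
by apply: (ideal_sum _ iM) => j _; rewrite -adjE; apply: (idealMl _ iM).
Qed.

Lemma cosyzygy_mpoly_inj (k : fieldType) N n : (N <= n)%N ->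
  inj_ext (cosyzygy (@mpolyC N k) n ({mpoly k[N]}^o : lmodType {mpoly k[N]})).
Proof.
move=> Nn; pose C : set (resolution {mpoly k[N]}) := [set Y | exact_mod [set 0] Y].
have Cex Y : C Y -> exact_mod [set 0] Y by [].
have Csh Y : C Y -> C (shift Y) by move=> exY i; exact: (exY i.+1).
have Cgen : ideal_resolutions C.
  move=> I iI; have [Y [exY r1 HY]] := resolution_exists (@mpoly_fin_generated k N) (is_ideal0 _) iI.
  by exists Y.
have EV : ext_van C n [set: ({mpoly k[N]}^o : lmodType {mpoly k[N]})].
  by apply: (ext_van_leq Csh Nn) => Y CY e He de; exact: (ext_van_mpoly Cex Csh CY He de).
move=> Q G HG funG; exact: (@cosyzygy_inj k _ (@mpolyC N k) C Cex Csh Cgen n _ EV Q G HG funG).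
Qed.

Section GorensteinGN.
Variables (k : fieldType) (hk : [pchar k] =i pred0) (n : nat) (hm : (3 <= n + 2)%N).
Local Notation R := {mpoly k[#|gc_var hm|]}.
Variables (X : 'M[R]_(n + 2)) (EX : X = GC k hm) (j0 : 'I_n).

Lemma gn1_gorenstein : gorenstein_ideal (gn1_ideal X).
Proof.
have [Y EY] : exists Y, Y = generic_mx k (n + 2) by eexists.
(* The parametrization followed by the embedding into fractions places the quotient by the minors in
   a field. *)
have [psi Hpsi] : exists psi : {rmorphism R -> {fraction {mpoly k[#|{: 'I_(n + 2) * 'I_(n + 2)}|]}}},
    forall x, psi x = 0 <-> gn1_ideal X x.
  exists (@tofrac _ \o rank_param (hm := hm) Y j0) => x.
  rewrite (gn1_ideal_ker hk EX EY j0) /=; split=> [/eqP|->]; last exact: rmorph0.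
  by rewrite tofrac_eq0 => /eqP.
have EP : gn1_ideal X = [set x | psi x = 0] by apply/seteqP; split=> x /Hpsi.
have [] := @gc_exact k hk (n + 2)%N hm; rewrite -EX => ex1 ex2 ex3 ex4.
rewrite EP; apply: (@gorenstein_ker k _ _ psi #|gc_var hm|).
rewrite -EP => F exF e He.
have Csh Z : exact_mod (gn1_ideal X) Z -> exact_mod (gn1_ideal X) (shift Z).
  by move=> exZ i; exact: (exZ i.+1).
apply: (@gn_ext_van R (n + 2)%N X ex1 ex2 ex3 ex4 k (@mpolyC _ k)
  [set Z | exact_mod (gn1_ideal X) Z] #|gc_var hm| (fun Z H => H) Csh _ F exF _ e (leqnn _) He).
by apply: cosyzygy_mpoly_inj; rewrite -addn4 leq_addr.
Qed.
End GorensteinGN.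

Lemma polar_inverse (k : fieldType) (p : nat) (hm : (3 <= p.+2)%N)
    (X : 'M[{mpoly k[#|gc_var hm|]}]_p.+2) (Y : 'M[{mpoly k[#|{: 'I_p.+2 * 'I_p.+2}|]}]_p.+2) h
    (Delta : 'I_p.+2 * 'I_p.+2 -> {mpoly k[#|gc_var hm|]}) :
  X = GC k hm -> Y = generic_mx k p.+2 ->
  h = cofactor Y (ord_last hm) (ord_last hm) - cofactor Y (ord_penult hm) (ord_penult hm) ->
  (forall ij, Delta ij = (\adj X) ij.1 ij.2) ->
  [/\ birational_onto_image Delta, h != 0 /\ h \is p.+1.-homog,
      image_ideal Delta = ideal_gen [set h] &
      exists G : gc_var hm -> _, inverse_map Delta G /\
        span_mod (ideal_gen [set h]) G = span_mod (ideal_gen [set h])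
          (fun u : gc_var hm => cofactor Y (val u).1 (val u).2)].
Proof.
move=> EX EY Eh ED; have [ev [Eev evC evX]] := psubst_eval Delta.
have evY : map_mx ev Y = \adj X.
  by apply/matrixP => i j; rewrite [LHS]mxE (Y_var EY) evX ED.
have f0 := gc_det_neq0 EX.
have inv : inverse_map Delta (polar_inv (hm := hm) Y).
  split.
  - by exists p.+1 => u; apply: (linear_det_homog (Y_homog EY)).
  - exists (gc_var_penult hm); rewrite /image_ideal /= Eev /polar_inv (ev_adj EX evY).
    rewrite (X_var EX) => /eqP; rewrite mulf_eq0 expf_eq0 (negPf f0) andbF /=.
    by rewrite /pvar (negPf (mpolyX_neq0 _ _)).
  - move=> u v; rewrite !Eev /polar_inv !(ev_adj EX evY) !(X_var EX).
    by rewrite -!mulrA [pvar k u * _]mulrC.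
split.
- split; last by exists (polar_inv (hm := hm) Y).
  split; first by exists p.+1 => ij; rewrite ED; exact: (linear_det_homog (X_homog EX)).
  apply: contrapT => H; case/negP: f0; apply/eqP.
  rewrite (expand_det_row _ ord0) big1 // => j _; rewrite -adjE.
  have -> : (\adj X) j ord0 = Delta (j, ord0) by rewrite ED.
  have [->|D0] := eqVneq (Delta (j, ord0)) 0; first by rewrite mulr0.
  by case: H; exists (j, ord0).
- by split; [exact: (h_neq0 EY Eh)|exact: (h_homog EY Eh)].
- rewrite -(ker_ev_gen EX EY Eh evY evC); apply/seteqP; split=> x; rewrite /image_ideal /= Eev //.
- exists (polar_inv (hm := hm) Y); split=> //; exact: (polar_inv_span hm Y).
Qed.

Lemma polar_inverse_ge3 (k : fieldType) (m : nat) (hm : (3 <= m)%N) h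
    (Delta : 'I_m * 'I_m -> {mpoly k[#|gc_var hm|]}) :
  h = cofactor (generic_mx k m) (ord_last hm) (ord_last hm)
    - cofactor (generic_mx k m) (ord_penult hm) (ord_penult hm) ->
  (forall ij, Delta ij = (\adj (GC k hm)) ij.1 ij.2) ->
  [/\ birational_onto_image Delta, h != 0 /\ h \is m.-1.-homog,
      image_ideal Delta = ideal_gen [set h] &
      exists G : gc_var hm -> _, inverse_map Delta G /\
        span_mod (ideal_gen [set h]) G = span_mod (ideal_gen [set h])
          (fun u : gc_var hm => cofactor (generic_mx k m) (val u).1 (val u).2)].
Proof.
by case: m hm h Delta => [|[|p]] // hm h Delta; exact: (polar_inverse erefl erefl).
Qed.

Lemma ideal_part (k : fieldType) (hk : [pchar k] =i pred0) (m : nat) (hm : (3 <= m)%N) :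
  let J := gradient_ideal (\det (GC k hm)) in let P := gn1_ideal (GC k hm) in
  [/\ [/\ prime_ideal P, gorenstein_ideal P & ideal_height P 4],
  [/\ ideal_height J 4, (forall Q, minimal_prime J Q <-> Q = P) &
      (forall Q, primary_component J P Q <-> Q = P)] &
  [/\ ideal_exp P 2 `<=` J, J `<=` P & exists E,
        (forall Q, embedded_prime J Q <-> Q = E) /\
        linear_ideal (4 * m - 5)%N E] /\ ~ reduction J P].
Proof.
have [n em] : exists n, m = (n + 2)%N by exists (m - 2)%N; rewrite subnK // ltnW.
subst m; have j0 : 'I_n by exists 0%N; move: hm; rewrite addn2 !ltnS.
have [X EX] : exists X, X = GC k hm by eexists.
have [Y EY] : exists Y, Y = generic_mx k (n + 2) by eexists.
rewrite -EX /=.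
have pP := gn1_ideal_prime hk EX EY j0.
have JP := gradient_sub_gn1 EX.
have [[P2 PQ minP compP embJ] nred] := gradient_structure hk EX j0.
have chain Q := @gn1_ideal_chain k hk n hm X Y EX EY j0 Q.
have htP : prime_height (gn1_ideal X) 4.
  by split; [exact: chain|exact: (gn1_ideal_no_chain hk EX EY j0)].
split; last by split.
  split=> //; first exact: (gn1_gorenstein hk EX j0).
  split; last by move=> Q pQ PQ'; exact: chain.
  by exists (gn1_ideal X); split=> // x.
(* Every prime above [J] contains [P], so the chains found for [P] serve for [J]. *)
split=> //; split; first by exists (gn1_ideal X); split.
by move=> Q pQ JQ; apply: chain => //; exact: PQ.
Qed.

Theorem theorem2p4 (k : fieldType) (hk : [pchar k] =i pred0)
    (m : nat) (hm : (3 <= m)%N) :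
  let R := {mpoly k[#|gc_var hm|]} in
  let S := {mpoly k[#|{: 'I_m * 'I_m}|]} in
  let f : R := \det (GC k hm) in
  let J : set R := gradient_ideal f in
  let P : set R := minors_ideal m.-1 (GC k hm) in
  let Delta : 'I_m * 'I_m -> R := fun ij => (\adj (GC k hm)) ij.1 ij.2 in
  let D : 'I_m -> 'I_m -> S := fun i j => cofactor (generic_mx k m) i j in
  let h : S := D (ord_last hm) (ord_last hm)
               - D (ord_penult hm) (ord_penult hm) in
  let Dtilde : gc_var hm -> S := fun u => D (val u).1 (val u).2 in
  (* (i) *)
  [/\ prime_ideal P, gorenstein_ideal P & ideal_height P 4] /\
  (* (ii) *)
  [/\ ideal_height J 4,
      (forall Q : set R, minimal_prime J Q <-> Q = P) &
      (forall Q : set R, primary_component J P Q <-> Q = P)] /\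
  (* (iii) *)
  [/\ ideal_exp P 2 `<=` J, J `<=` P &
      exists E : set R,
        (forall Q : set R, embedded_prime J Q <-> Q = E) /\
        linear_ideal (4 * m - 5)%N E] /\
  (* (iv) *)
  [/\ birational_onto_image Delta,
      h != 0 /\ h \is m.-1.-homog,
      image_ideal Delta = ideal_gen [set h] &
      exists G : gc_var hm -> S,
        inverse_map Delta G /\
        span_mod (ideal_gen [set h]) G = span_mod (ideal_gen [set h]) Dtilde] /\
  (* (v) *)
  ~ reduction J P.
Proof.
move=> R S f J P Delta D h Dtilde.
have polar : [/\ birational_onto_image Delta, h != 0 /\ h \is m.-1.-homog,
      image_ideal Delta = ideal_gen [set h] & exists G : gc_var hm -> S,
        inverse_map Delta G /\
        span_mod (ideal_gen [set h]) G = span_mod (ideal_gen [set h]) Dtilde].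
  exact: (@polar_inverse_ge3 k m hm h Delta erefl (fun=> erefl)).
suff [HP HJ [HE nred]] : [/\ [/\ prime_ideal P, gorenstein_ideal P & ideal_height P 4],
  [/\ ideal_height J 4, (forall Q : set R, minimal_prime J Q <-> Q = P) &
      (forall Q : set R, primary_component J P Q <-> Q = P)] &
  [/\ ideal_exp P 2 `<=` J, J `<=` P & exists E : set R,
        (forall Q : set R, embedded_prime J Q <-> Q = E) /\
        linear_ideal (4 * m - 5)%N E] /\ ~ reduction J P].
  by split.
have EP : P = gn1_ideal (GC k hm) := minors_gn1 _ (leq_trans (isT : (0 < 3)%N) hm).
by rewrite EP; exact: (ideal_part hk hm).
Qed.
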